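(* Let $\varphi$ be an Orlicz $N$-function, let $w$ be a weight function on $I=[0,\gamma)$, $0<\gamma\le\infty$, and let $F$ be a bounded linear functional on $\Lambda_{\varphi,w}$ (with the Luxemburg norm). Then $F=H+S$, where $H(f)=\int_Ifh$ for all $f\in\Lambda_{\varphi,w}$, for some $h\in\mathcal M^0_{\varphi_*,w}$, with $\|H\|=\|h\|_{\mathcal M^0_{\varphi_*,w}}$; $S$ is a bounded linear functional on $\Lambda_{\varphi,w}$ with $S(f)=0$ for all $f\in(\Lambda_{\varphi,w})_a$; and $$\|F\|_{(\Lambda_{\varphi,w})^*}=\|h\|_{\mathcal M^0_{\varphi_*,w}}+\|S\|,$$ where $\|H\|$ and $\|S\|$ are norms in $(\Lambda_{\varphi,w})^*$.
   Context: An Orlicz function is a convex function $\varphi:[0,\infty)\to[0,\infty)$ with $\varphi(0)=0$ and $\varphi(t)>0$ for $t>0$. It is an $N$-function if $\lim_{t\to0}\varphi(t)/t=0$ and $\lim_{t\to\infty}\varphi(t)/t=\infty$. The complementary function is $\varphi_*(v)=\sup\{uv-\varphi(u):u\ge0\}$, $v\ge0$; it is an $N$-function when $\varphi$ is. $I=[0,\gamma)$, $0<\gamma\le\infty$, with Lebesgue measure $m$; $L^0$ is the set of (classes of) Lebesgue measurable functions $f:I\to\mathbb R$. For $f\in L^0$, $d_f(\lambda)=m\{t\in I:|f(t)|>\lambda\}$ for $\lambda>0$, and $f^*(t)=\inf\{\lambda>0:d_f(\lambda)\le t\}$, $t\in[0,\gamma)$. A weight function $w:I\to(0,\infty)$ is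 decreasing (non-increasing) and locally integrable, with $W(t)=\int_0^tw<\infty$ for $t\in I$, and $W(\infty)=\infty$ if $\gamma=\infty$. Put $\rho_{\varphi,w}(f)=\int_0^\gamma\varphi(f^*(t))w(t)\,dt$. The Orlicz-Lorentz space $\Lambda_{\varphi,w}$ is the set of all $f\in L^0$ with $\rho_{\varphi,w}(\lambda f)<\infty$ for some $\lambda>0$, equipped with the Luxemburg norm $\|f\|=\inf\{\epsilon>0:\rho_{\varphi,w}(f/\epsilon)\le1\}$. The order-continuous subspace $(\Lambda_{\varphi,w})_a$ consists of all $f\in\Lambda_{\varphi,w}$ such that $\|f_n\|\downarrow0$ whenever $0\le f_n\le|f|$, $f_n\downarrow0$ a.e.; it equals $\{f:\rho_{\varphi,w}(\lambda f)<\infty\ \text{for all}\ \lambda>0\}$. For an Orlicz function $\psi$ and $h\in L^0$ put $P_{\psi,w}(h)=\inf\{\int_I\psi(|h|/v)\,v:\ v\prec w\}$, where $v\ge0$ ranges over measurable functions and $v\prec w$ means $\int_0^tv^*\le\int_0^tw$ for all $t\in(0,\gamma)$; where $v=0$ the integrand $\psi(|h|/v)v$ is $0$ if $h=0$ and $\infty$ if $h\ne0$. $\mathcal M^0_{\psi,w}$ is the set of $h\in L^0$ with $P_{\psi,w}(\lambda h)<\infty$ for some $\lambda>0$, equipped with the norm $\|h\|_{\mathcal M^0_{\psi,w}}=\inf_{k>0}\frac1k(1+P_{\psi,w}(kh))$. *)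

(* Defs.v *)
From HB Require Import structures.
From mathcomp Require Import all_boot all_order all_algebra.
From mathcomp Require Import all_classical all_reals all_analysis.

Set Implicit Arguments.
Unset Strict Implicit.
Unset Printing Implicit Defensive.

Import Order.TTheory GRing.Theory Num.Theory.
Import numFieldNormedType.Exports.

Local Open Scope classical_set_scope.
Local Open Scope ring_scope.

(* Conventions.
   - Functions on I = [0, gamma) are total functions R -> R whose values
     outside I are never used.
   - "Measurable" is the library's (Borel) measurability: every class modulo
     a.e. equality of Lebesgue measurable functions on I has a Borel
     representative, and everything below only depends on such classes.
   - Modulars, norms and rearrangements are \bar R-valued, so that infima of
     empty sets are +oo. *)

(** Orlicz functions. Only the values on [0, +oo[ are relevant. *)

Definition orlicz_function (R : realType) (phi : R -> R) : Prop :=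
  [/\ convex_function (`[0, +oo[%classic : set R) phi,
      phi 0 = 0 &
      forall t, 0 < t -> 0 < phi t].

Definition N_function (R : realType) (phi : R -> R) : Prop :=
  [/\ orlicz_function phi,
      phi t / t @[t --> 0^'+] --> (0 : R) &
      phi t / t @[t --> +oo] --> +oo].

(* The supremum is finite for every v >= 0 when phi is an N-function. *)
Definition complementary (R : realType) (phi : R -> R) (v : R) : R :=
  sup [set u * v - phi u | u in [set u : R | 0 <= u]].

(* Rearrangements may take the value +oo. *)
Definition extend_orlicz (R : realType) (phi : R -> R) (x : \bar R) : \bar R :=
  match x with
  | r%:E => (phi r)%:E
  | _ => +oo%E
  end.

(** Rearrangements *)

Definition Iset (R : realType) (gamma : \bar R) : set R :=
  [set t : R | 0 <= t /\ (t%:E < gamma)%E].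

Definition L0 (R : realType) (gamma : \bar R) : set (R -> R) :=
  [set f | measurable_fun (Iset gamma) f].

Definition distribution_function (R : realType) (gamma : \bar R)
    (f : R -> R) (lambda : R) : \bar R :=
  lebesgue_measure [set t | Iset gamma t /\ lambda < `|f t|].

Definition rearrangement (R : realType) (gamma : \bar R)
    (f : R -> R) (t : R) : \bar R :=
  ereal_inf [set lambda%:E | lambda in
    [set lambda : R | 0 < lambda /\
                      (distribution_function gamma f lambda <= t%:E)%E]].

(** Weights. Monotonicity is only required on ]0, gamma[, so that weights
    unbounded near 0 (e.g. t `^ (- 2^-1)) are covered. *)

Definition weight (R : realType) (gamma : \bar R) (w : R -> R) : Prop :=
  [/\ forall t, Iset gamma t -> 0 < w t,
      forall s t, 0 < s -> s <= t -> Iset gamma t -> w t <= w s,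
      forall t, Iset gamma t ->
        lebesgue_measure.-integrable `[0, t] (fun s => (w s)%:E) &
      gamma = +oo%E ->
        (\int[lebesgue_measure]_(s in Iset gamma) (w s)%:E = +oo)%E].

(** Orlicz-Lorentz spaces *)

Definition modular (R : realType) (gamma : \bar R) (phi w f : R -> R)
    : \bar R :=
  (\int[lebesgue_measure]_(t in Iset gamma)
     (extend_orlicz phi (rearrangement gamma f t) * (w t)%:E))%E.

Definition Lambda (R : realType) (gamma : \bar R) (phi w : R -> R)
    : set (R -> R) :=
  [set f | L0 gamma f /\
           exists2 lambda : R, 0 < lambda &
             (modular gamma phi w (fun t => (lambda * f t)%R) < +oo)%E].

Definition luxemburg_norm (R : realType) (gamma : \bar R) (phi w f : R -> R)
    : \bar R :=
  ereal_inf [set eps%:E | eps in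
    [set eps : R | 0 < eps /\
                   (modular gamma phi w (fun t => (f t / eps)%R) <= 1)%E]].

Definition Lambda_oc (R : realType) (gamma : \bar R) (phi w : R -> R)
    : set (R -> R) :=
  [set f | Lambda gamma phi w f /\
    forall f_ : nat -> R -> R,
      (forall n, L0 gamma (f_ n)) ->
      {ae lebesgue_measure, forall t, Iset gamma t ->
        [/\ forall n, 0 <= f_ n t <= `|f t|,
            nonincreasing_seq (fun n => f_ n t) &
            f_ n t @[n --> \oo] --> (0 : R)]} ->
      nonincreasing_seq (fun n => luxemburg_norm gamma phi w (f_ n)) /\
      luxemburg_norm gamma phi w (f_ n) @[n --> \oo] --> (0%E : \bar R)].

(** Bounded linear functionals on Lambda: only the values of F on Lambda are
    relevant, and they depend on classes modulo a.e. equality on I. *)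

Definition bounded_linear_functional (R : realType) (gamma : \bar R)
    (phi w : R -> R) (F : (R -> R) -> R) : Prop :=
  [/\ forall f g, Lambda gamma phi w f -> Lambda gamma phi w g ->
        {ae lebesgue_measure, forall t, Iset gamma t -> f t = g t} ->
        F f = F g,
      forall (a : R) f g, Lambda gamma phi w f -> Lambda gamma phi w g ->
        F (fun t => a * f t + g t) = a * F f + F g &
      exists C : R, forall f, Lambda gamma phi w f ->
        (`|F f|%:E <= C%:E * luxemburg_norm gamma phi w f)%E].

Definition dual_norm (R : realType) (gamma : \bar R) (phi w : R -> R)
    (F : (R -> R) -> R) : \bar R :=
  ereal_sup [set `|F f|%:E | f in
    [set f | Lambda gamma phi w f /\ (luxemburg_norm gamma phi w f <= 1)%E]].

(** The spaces M^0 *)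

Definition submajorized (R : realType) (gamma : \bar R) (v w : R -> R)
    : Prop :=
  forall t : R, 0 < t -> (t%:E < gamma)%E ->
    (\int[lebesgue_measure]_(s in `[0%R, t]) rearrangement gamma v s
     <= \int[lebesgue_measure]_(s in `[0%R, t]) (w s)%:E)%E.

(* The perspective psi (|x| / v) * v, with its convention at v = 0. *)
Definition perspective (R : realType) (psi : R -> R) (x v : R) : \bar R :=
  if v == 0 then (if x == 0 then 0%E else +oo%E)
  else (psi (`|x| / v) * v)%:E.

Definition P_modular (R : realType) (gamma : \bar R) (psi w h : R -> R)
    : \bar R :=
  ereal_inf
    [set (\int[lebesgue_measure]_(t in Iset gamma)
            perspective psi (h t) (v t))%E | v in
      [set v : R -> R | [/\ L0 gamma v,
                            forall t, Iset gamma t -> 0 <= v t &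
                            submajorized gamma v w]]].

Definition M0 (R : realType) (gamma : \bar R) (psi w : R -> R)
    : set (R -> R) :=
  [set h | L0 gamma h /\
           exists2 lambda : R, 0 < lambda &
             (P_modular gamma psi w (fun t => (lambda * h t)%R) < +oo)%E].

Definition M0_norm (R : realType) (gamma : \bar R) (psi w h : R -> R)
    : \bar R :=
  ereal_inf [set (k^-1%:E * (1 + P_modular gamma psi w (fun t => (k * h t)%R)))%E
            | k in [set k : R | 0 < k]].

(* Main.v *)
(* The modular of [f] is the Choquet integral of [phi |f|] with respect to
   the concave capacity [A |-> W (m A)], hence subadditive in [phi |f|].

   A bounded functional [F], restricted to bounded functions of bounded
   support, has a density [h]; [H] is integration against [h], and [S = F - H]
   kills these functions, hence the order-continuous part.

   [||H|| <= ||h||] is Young's inequality together with the bound of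
   [\int phi |f| v] by the modular of [f] for every [v] submajorized by [w]. For
   the converse, a Lagrange multiplier [1 / k] turns [||H||] into the estimate
   [\int f |k h| - rho f <= k ||H|| - 1]. By Mazur-Orlicz the Choquet integral
   in it can be replaced by integration against a single [v] submajorized by
   [w], and maximizing the integrand over [f] bounds the [P]-modular of [k h].

   Norms add up because [f] can be spliced with the tail of [g], on which [H] is
   negligible, while [S] does not see the difference from [g]; the modular of
   that tail tends to 0. *)

Require Import Defs.
From HB Require Import structures.
From mathcomp Require Import all_boot all_order all_algebra.
From mathcomp Require Import all_classical all_reals all_analysis.
From mathcomp Require Import measurable_realfun.
From mathcomp Require Import ring lra.

Set Implicit Arguments.
Unset Strict Implicit.
Unset Printing Implicit Defensive.

Import Order.TTheory GRing.Theory Num.Theory.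
Import numFieldNormedType.Exports.

Local Open Scope classical_set_scope.
Local Open Scope ring_scope.

(** * Hahn-Banach and Mazur-Orlicz *)

(** The [P]-modular is an infimum over [v] of integrals whose integrand is, by Young's inequality, a
    supremum over [u]; bounding it from above therefore means exchanging an infimum and a supremum.
    Mazur-Orlicz does this without any compactness of the set of all [v]: convexity of [phi] turns
    the inequalities to be preserved into a convex cone, and concavity of [W] makes the Choquet
    integral of the positive part a sublinear [p]. A linear functional squeezed between them is
    positive, because [p] vanishes on nonpositive functions, and on indicators it is at most [W] of
    the measure, which tends to 0 with the measure. Hence it has a Radon-Nikodym density, and
    domination by [p] becomes submajorization of this density by [w]. All this takes place on
    bounded measurable functions supported in some [[0, n[], where Choquet integrals are finite, so
    that [p] is real-valued; monotone and dominated convergence then lead to general functions. *)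

(** Relative to a set [E], because the space of interest consists of the test functions inside all
    functions [R -> R^o]. *)
Definition sublinear (R : realType) (V : lmodType R) (E : set V) (q : V -> R) : Prop :=
  (forall x y, E x -> E y -> q (x + y) <= q x + q y) /\
  (forall c x, 0 < c -> E x -> q (c *: x) = c * q x).

Definition linear_on (R : realType) (V : lmodType R) (E : set V) (L : V -> R) : Prop :=
  forall c x y, E x -> E y -> L (c *: x + y) = c * L x + L y.

Definition subspace (R : realType) (V : lmodType R) (E : set V) : Prop :=
  E 0 /\ forall c x y, E x -> E y -> E (c *: x + y).

Section hahn_banach.
Context (R : realType) (V : lmodType R) (E : set V).
Hypothesis subE : subspace E.

Lemma subspaceD x y : E x -> E y -> E (x + y).
Proof. by move=> Ex Ey; rewrite -[x]scale1r; apply: subE.2. Qed.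

Lemma subspaceZ c x : E x -> E (c *: x).
Proof. by move=> Ex; rewrite -[_ *: _]addr0; apply: subE.2 => //; exact: subE.1. Qed.

Lemma subspaceN x : E x -> E (- x).
Proof. by move=> Ex; rewrite -scaleN1r; exact: subspaceZ. Qed.

Lemma sublinear0 q : sublinear E q -> q 0 = 0.
Proof.
move=> [_ qZ]; have := qZ 2 0 ltac:(by []) subE.1.
rewrite scaler0; lra.
Qed.

Lemma sublinearZ q c x : sublinear E q -> 0 <= c -> E x -> q (c *: x) = c * q x.
Proof.
move=> sq; rewrite le_eqVlt => /predU1P[<- _|c0 Ex]; last exact: sq.2.
by rewrite scale0r mul0r sublinear0.
Qed.

Lemma sublinearN q x : sublinear E q -> E x -> - q (- x) <= q x.
Proof.
move=> sq Ex; have := sq.1 _ _ Ex (subspaceN Ex).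
by rewrite subrr (sublinear0 sq) -lerBlDr sub0r.
Qed.

Section shift.
Variables (p : V -> R) (C : V -> R -> Prop).
Hypothesis sp : sublinear E p.
Hypothesis CE : forall y b, C y b -> E y /\ b <= p y.
Hypothesis C0 : C 0 0.
Hypothesis CD : forall y b y' b', C y b -> C y' b' -> C (y + y') (b + b').
Hypothesis CZ : forall c y b, 0 < c -> C y b -> C (c *: y) (c * b).

(** A linear functional below [shift] lies below [p] (take the pair 0, 0), and its value at [- y] is
    at most [- b], so it is at least [b] at [y]. The infimum is over a set bounded below, since
    [b <= p y <= p (x + y) + p (- x)]. *)
Definition shift (x : V) : R :=
  inf [set z | exists y b, C y b /\ z = p (x + y) - b].

Let lb x : E x -> lbound [set z | exists y b, C y b /\ z = p (x + y) - b] (- p (- x)).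
Proof.
move=> Ex _ [y [b [Cyb ->]]]; have [Ey bp] := CE Cyb.
have := sp.1 _ _ (subspaceD Ex Ey) (subspaceN Ex).
rewrite addrAC subrr add0r; lra.
Qed.

Lemma shift_le_cone x y b : E x -> C y b -> shift x <= p (x + y) - b.
Proof.
move=> Ex Cyb; apply: ge_inf; last by exists y, b.
by exists (- p (- x)); exact: lb.
Qed.

Lemma shift_le x : E x -> shift x <= p x.
Proof. by move=> Ex; rewrite -[p x]subr0 -{2}[x]addr0; exact: shift_le_cone. Qed.

Lemma shift_cone y b : C y b -> shift (- y) <= - b.
Proof.
move=> Cyb; have [Ey _] := CE Cyb.
have := shift_le_cone (subspaceN Ey) Cyb.
by rewrite addNr (sublinear0 sp) sub0r.
Qed.

Let le_shift x z : (forall y b, C y b -> z <= p (x + y) - b) -> z <= shift x.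
Proof.
move=> H; apply: lb_le_inf; first by exists (p (x + 0) - 0), 0, 0.
by move=> _ [y [b [Cyb ->]]]; exact: H.
Qed.

Lemma shift_sublinear : sublinear E shift.
Proof.
split=> [x y Ex Ey|].
  rewrite -lerBlDr; apply: le_shift => u b Cu; have [Eu _] := CE Cu.
  suff : shift (x + y) - (p (x + u) - b) <= shift y by lra.
  apply: le_shift => v d Cv; have [Ev _] := CE Cv.
  have := shift_le_cone (subspaceD Ex Ey) (CD Cu Cv).
  have := sp.1 _ _ (subspaceD Ex Eu) (subspaceD Ey Ev).
  by rewrite addrACA; lra.
have half c x : 0 < c -> E x -> shift (c *: x) <= c * shift x.
  move=> c0 Ex; rewrite -ler_pdivrMl//; apply: le_shift => y b Cyb.
  have [Ey _] := CE Cyb.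
  rewrite ler_pdivrMl//; have := shift_le_cone (subspaceZ c Ex) (CZ c0 Cyb).
  by rewrite -scalerDr sp.2 ?mulrBr//; exact: subspaceD.
move=> c x c0 Ex; apply/eqP; rewrite eq_le half//=.
have /(_ _)/= := half c^-1 (c *: x); rewrite invr_gt0 => /(_ c0 (subspaceZ c Ex)).
by rewrite scalerA mulVf ?gt_eqF// scale1r ler_pdivlMl.
Qed.

End shift.

(* A minimal sublinear functional [q] is additive: for fixed [y], shifting [q]
   along the ray of [y] cannot make it smaller. *)
Theorem hahn_banach p : sublinear E p ->
  exists L, linear_on E L /\ forall x, E x -> L x <= p x.
Proof.
move=> sp.
(* Values outside [E] are fixed to 0 so that the order [rT] is antisymmetric. *)
pose P q := [/\ sublinear E q, forall x, E x -> q x <= p x &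
                forall x, ~ E x -> q x = 0].
pose T := {q : V -> R | P q}.
(* The order is reversed: maximal elements for [rT] are minimal sublinear functionals. *)
pose rT (s t : T) := `[< forall x, E x -> sval t x <= sval s x >].
have cut q : sublinear E q -> (forall x, E x -> q x <= p x) ->
    exists t : T, forall x, E x -> sval t x = q x.
  move=> sq qp.
  have H : P (fun x => if `[< E x >] then q x else 0).
    split.
    - split=> [x y Ex Ey|c x c0 Ex].
        by rewrite !asboolT//; [exact: sq.1|exact: subspaceD].
      by rewrite !asboolT//; [exact: sq.2|exact: subspaceZ].
    - by move=> x Ex; rewrite asboolT//; exact: qp.
    - by move=> x Ex; rewrite asboolF.
  by exists (exist P _ H) => x Ex /=; rewrite asboolT.
have tP (t : T) := svalP t.
have [||||t tmin] := @Zorn T rT.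
- by move=> t; apply/asboolP => x.
- move=> r s t /asboolP rs /asboolP st; apply/asboolP => x Ex.
  exact: le_trans (st _ Ex) (rs _ Ex).
- move=> [s Ps] [t Pt] /asboolP/= st /asboolP/= ts; apply: eq_exist.
  apply/funext => x; have [Ex|nEx] := pselect (E x).
    by apply/eqP; rewrite eq_le st// ts.
  by case: Ps => _ _ ->//; case: Pt => _ _ ->.
- move=> A Atot; have [[t0 At0]|A0] := pselect (exists t, A t); last first.
    have [t tE] := cut p sp (fun x _ => lexx _).
    by exists t => s As; exfalso; apply: A0; exists s.
  pose q x := inf [set sval t x | t in A].
  have qle t x : E x -> A t -> q x <= sval t x.
    move=> Ex At; apply: ge_inf; last by exists t.
    exists (- p (- x)) => _ [s As <-]; have [ss sp' _] := tP s.
    apply: le_trans (sublinearN ss Ex); rewrite lerN2; apply: sp'.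
    exact: subspaceN.
  have le_q z x : (forall t, A t -> z <= sval t x) -> z <= q x.
    move=> H; apply: lb_le_inf; first by exists (sval t0 x), t0.
    by move=> _ [t At <-]; exact: H.
  have [t tE] : exists t : T, forall x, E x -> sval t x = q x.
    apply: cut.
      split=> [x y Ex Ey|c x c0 Ex].
        suff : q (x + y) - q y <= q x by lra.
        apply: (le_q) => s As.
        suff : q (x + y) - sval s x <= q y by lra.
        apply: (le_q) => s' As'; rewrite lerBlDl.
        (* Of two members of the chain, the smaller one serves for both [x] and [y]; this makes the
           pointwise infimum subadditive. *)
        have [/asboolP st|/asboolP st] := Atot _ _ As As'.
          apply: le_trans (qle s' _ (subspaceD Ex Ey) As') _.
          have [[ss _] _ _] := tP s'.
          by apply: le_trans (ss _ _ Ex Ey) _; rewrite lerD2r; exact: st.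
        apply: le_trans (qle s _ (subspaceD Ex Ey) As) _.
        have [[ss _] _ _] := tP s.
        by apply: le_trans (ss _ _ Ex Ey) _; rewrite lerD2l; exact: st.
      apply/eqP; rewrite eq_le; apply/andP; split.
        rewrite -ler_pdivrMl//; apply: (le_q) => s As; rewrite ler_pdivrMl//.
        have [[_ sZ] _ _] := tP s; rewrite -sZ//.
        by apply: qle => //; exact: subspaceZ.
      apply: (le_q) => s As; have [[_ sZ] _ _] := tP s; rewrite sZ// ler_pM2l//.
      exact: qle.
    move=> x Ex; apply: le_trans (qle _ _ Ex At0) _; have [_ tp _] := tP t0.
    exact: tp.
  by exists t => s As; apply/asboolP => x Ex; rewrite tE//; exact: qle.
have [sq qp _] := tP t; set q := sval t in sq qp.
have minq r : sublinear E r -> (forall x, E x -> r x <= q x) ->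
    forall x, E x -> r x = q x.
  move=> sr rq x Ex.
  have [s sE] := cut r sr (fun x Ex => le_trans (rq x Ex) (qp x Ex)).
  rewrite -sE// /q (tmin s)//; apply/asboolP => z Ez; rewrite sE//; exact: rq.
have qD x y : E x -> E y -> q (x + y) = q x + q y.
  move=> Ex Ey; apply/eqP; rewrite eq_le sq.1//=.
  pose C z b := exists2 s, 0 <= s & z = s *: y /\ b = s * q y.
  have CE z b : C z b -> E z /\ b <= q z.
    by move=> [s s0 [-> ->]]; split; [exact: subspaceZ|rewrite sublinearZ].
  have C0 : C 0 0 by exists 0 => //; rewrite scale0r mul0r.
  have CD z b z' b' : C z b -> C z' b' -> C (z + z') (b + b').
    move=> [s s0 [-> ->]] [s' s0' [-> ->]]; exists (s + s'); first exact: addr_ge0.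
    by rewrite scalerDl mulrDl.
  have CZ c z b : 0 < c -> C z b -> C (c *: z) (c * b).
    move=> c0 [s s0 [-> ->]]; exists (c * s); first by apply: mulr_ge0 => //; exact: ltW.
    by rewrite scalerA mulrA.
  have <- := minq _ (shift_sublinear sq CE C0 CD CZ)
                    (fun z Ez => shift_le sq CE C0 Ez) x Ex.
  rewrite -lerBrDr -[q y]mul1r -[X in q (x + X)]scale1r.
  by apply: (shift_le_cone sq CE) => //; exists 1.
have qN x : E x -> q (- x) = - q x.
  move=> Ex; apply/eqP; rewrite -addr_eq0 -qD//; last exact: subspaceN.
  by rewrite addNr (sublinear0 sq).
exists q; split=> // c x y Ex Ey; rewrite qD//; last exact: subspaceZ.
congr (_ + _); have [c0|c0] := leP 0 c; first by rewrite sublinearZ.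
rewrite -[c *: x]opprK qN; last by apply: subspaceN; exact: subspaceZ.
by rewrite -scaleNr sublinearZ ?oppr_ge0 ?ltW// mulNr opprK.
Qed.

(** Hahn-Banach for [shift p C] in place of [p]. *)
Theorem mazur_orlicz p (C : V -> R -> Prop) : sublinear E p ->
  (forall y b, C y b -> E y /\ b <= p y) -> C 0 0 ->
  (forall y b y' b', C y b -> C y' b' -> C (y + y') (b + b')) ->
  (forall c y b, 0 < c -> C y b -> C (c *: y) (c * b)) ->
  exists L, [/\ linear_on E L, forall x, E x -> L x <= p x &
                forall y b, C y b -> b <= L y].
Proof.
move=> sp CE C0 CD CZ.
have [L [linL Lq]] := hahn_banach (shift_sublinear sp CE C0 CD CZ).
exists L; split=> // [x Ex|y b Cyb].
  exact: le_trans (Lq _ Ex) (shift_le sp CE C0 Ex).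
have [Ey _] := CE _ _ Cyb.
have := le_trans (Lq _ (subspaceN Ey)) (shift_cone sp CE Cyb).
have := linL (-1) y 0 Ey subE.1; have := linL 1 0 0 subE.1 subE.1.
by rewrite !scaler0 scaleN1r !addr0; lra.
Qed.

End hahn_banach.

(** * The layer-cake formula *)

(** No measurability is assumed: the integral of a nonnegative function is a supremum over the
    simple functions below it. *)
Lemma ge0_le_integralW d (T : measurableType d) (R : realType)
    (mu : {measure set T -> \bar R}) (D : set T) (f1 f2 : T -> \bar R) :
  (forall x, D x -> (0 <= f1 x)%E) -> (forall x, D x -> (f1 x <= f2 x)%E) ->
  (\int[mu]_(x in D) f1 x <= \int[mu]_(x in D) f2 x)%E.
Proof.
move=> f10 f12; rewrite 2!(integral_mkcond D).
have f20 x : D x -> (0 <= f2 x)%E by move=> Dx; exact: le_trans (f10 _ Dx) (f12 _ Dx).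
rewrite !ge0_integralTE; [|exact: erestrict_ge0..].
apply: ereal_sup_le => _ [h/= hf <-]; exists h => // x.
apply: le_trans (hf x) _; rewrite /patch; case: ifPn => // /set_mem; exact: f12.
Qed.

Section layer_cake.
Context (R : realType).
Local Notation mu := (@lebesgue_measure R).
Local Open Scope ereal_scope.

Lemma lebesgue_measure_level (s0 : R) (y : \bar R) :
  mu [set s | (s0 <= s)%R /\ s%:E < y] = maxe (y - s0%:E) 0.
Proof.
case: y => [y| |].
- have -> : [set s | (s0 <= s)%R /\ s%:E < y%:E] = `[s0, y[%classic.
    by apply/seteqP; split => s /=; rewrite in_itv/= lte_fin; [move=> [-> ->]|move=> /andP[]].
  rewrite lebesgue_measure_itv/= lte_fin -EFinB.
  case: ltP => h; first by rewrite max_l// lee_fin subr_ge0 ltW.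
  by rewrite max_r// lee_fin subr_le0.
- have -> : [set s | (s0 <= s)%R /\ s%:E < +oo] = `[s0, +oo[%classic.
    apply/seteqP; split => s /=; rewrite in_itv/= andbT; first by case.
    by move=> ->; rewrite ltry.
  by rewrite lebesgue_measure_itv/= ltry addye// max_l.
- have -> : [set s | (s0 <= s)%R /\ s%:E < -oo] = set0.
    by apply/seteqP; split => s //= [].
  by rewrite measure0 addNye max_r.
Qed.

(** Tonelli's theorem on the region between the level [s0] and the graph of [y]. The case [v = 1]
    with a general [s0] computes [excess]; the case [s0 = 0] is the usual formula. *)
Lemma layer_cake (D : set R) (y v : R -> \bar R) (s0 : R) :
  measurable D -> measurable_fun D y -> measurable_fun D v ->
  (forall t, D t -> 0 <= v t) ->
  \int[mu]_(t in D) (maxe (y t - s0%:E) 0 * v t) =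
  \int[mu]_(s in `[s0, +oo[) \int[mu]_(t in D `&` [set t | s%:E < y t]) v t.
Proof.
move=> mD my mv v0.
pose A := [set z : R * R | [/\ D z.1, (s0 <= z.2)%R & z.2%:E < y z.1]].
pose B t := [set s : R | (s0 <= s)%R /\ s%:E < y t].
have inA t s : ((t, s) \in A) = (t \in D) && (s \in B t).
  apply/idP/andP => [/set_mem[Dt s0s sy]|[/set_mem Dt /set_mem[s0s sy]]].
    by split; apply: mem_set.
  exact: mem_set.
have mA : measurable A.
  have -> : A = (D `*` `[s0, +oo[) `&` (setT `&` [set z | z.2%:E < (y \_ D) z.1]).
    rewrite /A; apply/seteqP; split => -[t s]/=.
      by move=> [Dt s0s sy]; rewrite in_itv/= andbT patchT ?inE.
    by rewrite in_itv/= andbT => -[[Dt s0s] [_]]; rewrite patchT ?inE.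
  apply: measurableI; first exact: measurableX.
  apply: measurable_lte => //.
    by apply/measurable_EFinP; exact: measurable_snd.
  apply: (measurableT_comp (f := y \_ D)) => //.
  exact: (iffLR (measurable_restrictT _ mD)).
have mB t : D t -> measurable (B t).
  move=> Dt; have -> : B t = xsection A t; last exact: measurable_xsection.
  apply/seteqP; split=> s => [Bs|/xsectionP As].
    by apply/xsectionP; case: Bs.
  by case: As.
pose f z := (v \_ D) z.1 * (\1_A z)%:E.
have fE t s : f (t, s) = (v \_ D) t * (\1_(B t) s)%:E.
  rewrite /f [(t, s).1]/= !indicE inA; case: (boolP (t \in D)) => //= nDt.
  by rewrite patchN// !mul0e.
rewrite [LHS]integral_mkcond [RHS]integral_mkcond.
have -> : \int[mu]_t ((fun t => maxe (y t - s0%:E) 0 * v t) \_ D) t =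
    \int[mu]_t \int[mu]_s f (t, s).
  apply: eq_integral => t _; under eq_integral do rewrite fE.
  rewrite /patch; case: ifPn => [/set_mem Dt|nDt]; last first.
    by rewrite integral0_eq// => s _; rewrite mul0e.
  have mBf : measurable_fun [set: measurableTypeR R] (fun s => (\1_(B t) s)%:E : \bar R).
    by apply/measurable_EFinP; apply: measurable_indic; exact: mB.
  rewrite (ge0_integralZl mu measurableT mBf) ?v0//.
  rewrite (integral_indic mu measurableT (mB _ Dt)) setIT muleC; congr (_ * _).
  exact/esym/lebesgue_measure_level.
have -> : \int[mu]_s ((fun s => \int[mu]_(t in D `&` [set t | s%:E < y t]) v t)
    \_ `[s0, +oo[) s = \int[mu]_s \int[mu]_t f (t, s).
  apply/esym; apply: eq_integral => s _; rewrite [RHS]/patch.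
  under eq_integral do rewrite fE.
  case: ifPn => [/set_mem/=|/negP sN].
    rewrite in_itv/= andbT => s0s.
    rewrite [RHS]integral_mkcond; apply: eq_integral => t _.
    rewrite /patch indicE; case: (boolP (t \in D)) => [/set_mem Dt|nDt].
      case: (ltP s%:E (y t)) => st; last first.
        rewrite memNset ?mule0//; last by move=> [_]; rewrite ltNge st.
        by rewrite memNset//; move=> [_]/=; rewrite ltNge st.
      by rewrite !mem_set ?mule1.
    by rewrite mul0e memNset// => -[Dt _]; move: nDt; rewrite mem_set.
  rewrite integral0_eq// => t _; rewrite indicE memNset ?mule0// => -[s0s _].
  by apply: sN; apply: mem_set; rewrite /= in_itv/= s0s.
have mf : measurable_fun setT f.
  apply: emeasurable_funM; last exact/measurable_EFinP/measurable_indic.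
  apply: (measurableT_comp (f := v \_ D)) => //.
  exact: (iffLR (measurable_restrictT _ mD)).
have f0 z : 0 <= f z.
  by apply: mule_ge0; [exact: erestrict_ge0|rewrite lee_fin].
exact: (fubini_tonelli (m1 := mu) (m2 := mu) f mf f0).
Qed.

Lemma ge0_layer_cake (D : set R) (y v : R -> \bar R) :
  measurable D -> measurable_fun D y -> measurable_fun D v ->
  (forall t, D t -> 0 <= y t) -> (forall t, D t -> 0 <= v t) ->
  \int[mu]_(t in D) (y t * v t) =
  \int[mu]_(s in `[0%R, +oo[) \int[mu]_(t in D `&` [set t | s%:E < y t]) v t.
Proof.
move=> mD my mv y0 v0; rewrite -layer_cake//; apply: eq_integral => t /set_mem Dt.
by rewrite sube0 max_l// y0.
Qed.

End layer_cake.

(** * Orlicz functions *)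

Section orlicz.
Context (R : realType) (phi : R -> R).
Hypothesis hphi : orlicz_function phi.

Lemma orlicz0 : phi 0 = 0. Proof. by have [] := hphi. Qed.

Lemma orlicz_ge0 t : 0 <= t -> 0 <= phi t.
Proof.
have [_ phi0 phi_gt0] := hphi.
by rewrite le_eqVlt => /predU1P[<-|/phi_gt0/ltW//]; rewrite phi0.
Qed.

Lemma orlicz_convex c x y : 0 <= c -> c <= 1 -> 0 <= x -> 0 <= y ->
  phi (c * x + (1 - c) * y) <= c * phi x + (1 - c) * phi y.
Proof.
move=> c0 c1 x0 y0; have [cphi _ _] := hphi.
have := cphi (Itv01 c0 c1) x y; rewrite !inE/= !in_itv/= !andbT => /(_ x0 y0).
by rewrite !convRE.
Qed.

Lemma orlicz_scale c x : 0 <= c -> c <= 1 -> 0 <= x -> phi (c * x) <= c * phi x.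
Proof.
move=> c0 c1 x0; have := orlicz_convex c0 c1 x0 (lexx 0).
by rewrite orlicz0 !mulr0 !addr0.
Qed.

Lemma orlicz_le x y : 0 <= x -> x <= y -> phi x <= phi y.
Proof.
move=> x0 xy; have y0 := le_trans x0 xy.
move: y0; rewrite le_eqVlt => /predU1P[y0|y0].
  by have -> : x = y by lra.
have -> : x = x / y * y by rewrite divfK ?gt_eqF.
have d1 : x / y <= 1 by rewrite ler_pdivrMr ?mul1r.
apply: le_trans (orlicz_scale _ d1 (ltW y0)) _; first exact: divr_ge0 (ltW y0).
by rewrite ler_piMl// orlicz_ge0// ltW.
Qed.

(* [u] is the generalized inverse of [phi] at [s]; convexity provides the
   left continuity that makes the supremum attained. *)
Lemma orlicz_level s : 0 <= s ->
  exists2 u, 0 <= u & forall x, 0 <= x -> (s < phi x) = (u < x).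
Proof.
move=> s0; pose A := [set x : R | 0 <= x /\ phi x <= s].
have phi1 : 0 < phi 1 by have [_ _] := hphi; apply.
have A0 : A 0 by split=> //; rewrite orlicz0.
(* Convexity and [phi 0 = 0] give [x * phi 1 <= phi x] for [x >= 1]. *)
have ubA : ubound A (Num.max 1 (s / phi 1)).
  move=> x [x0 xs]; rewrite le_max; have [//|x1] := leP x 1; apply/orP; right.
  rewrite ler_pdivlMr//; apply: le_trans xs.
  have x00 : 0 < x by lra.
  have := @orlicz_scale x^-1 x; rewrite mulVf ?gt_eqF// invr_ge0 invf_le1// => h.
  have := h x0 (ltW x1) x0.
  by rewrite ler_pdivlMl.
have supA : has_sup A by split; [exists 0|exists (Num.max 1 (s / phi 1))].
have u0 : 0 <= sup A by exact: ub_le_sup supA.2 _ A0.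
have phiu : phi (sup A) <= s.
  set u := sup A in u0 *.
  have pu : 0 < phi (u + 1) by have [_ _] := hphi; apply; lra.
  apply/ler_addgt0Pr => e e0.
  have e'0 : 0 < e / phi (u + 1) by exact: divr_gt0.
  have [x [x0 xs] ux] := sup_adherent e'0 supA.
  have xu : x <= u by apply: ub_le_sup supA.2 _ _; split.
  (* The weight that writes [u] as a convex combination of [u + 1] and a point [x] of [A]; it tends
     to 0 with [u - x], and [phi x <= s]. *)
  set c := (u - x) / (u + 1 - x).
  have d1 : 1 <= u + 1 - x by lra.
  have c0 : 0 <= c by apply: divr_ge0; lra.
  have c1 : c <= u - x by rewrite ler_pdivrMr ?ler_peMr//; lra.
  have c2 : c <= 1 by rewrite ler_pdivrMr; lra.
  have uE : u = c * (u + 1) + (1 - c) * x.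
    have : c * (u + 1 - x) = u - x by rewrite divfK// gt_eqF//; lra.
    lra.
  have := orlicz_convex c0 c2 (ltac:(lra) : 0 <= u + 1) x0.
  rewrite -uE => H; apply: le_trans H _; rewrite addrC lerD//.
    apply: le_trans xs; rewrite ler_piMl ?orlicz_ge0//; lra.
  apply: (@le_trans _ _ ((u - x) * phi (u + 1))); first by rewrite ler_wpM2r// ltW.
  by rewrite -ler_pdivlMr//; rewrite -/u in ux; lra.
exists (sup A) => // x x0; apply/idP/idP => [sx|ux].
  by rewrite ltNge; apply/negP => xu; have := orlicz_le x0 xu; lra.
rewrite ltNge; apply/negP => xs; suff : x <= sup A by lra.
by apply: ub_le_sup supA.2 _ _; split.
Qed.

End orlicz.

(** * Level sets *)

Section interval.
Context (R : realType) (gamma : \bar R).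
Local Notation mu := (@lebesgue_measure R).
Local Notation I := (Iset gamma).
Local Open Scope ereal_scope.

Lemma measurable_Iset : measurable I.
Proof.
rewrite /Iset; case: gamma => [r| |].
- have -> : [set t : R | (0 <= t)%R /\ t%:E < r%:E] = `[0%R, r[%classic.
    by apply/seteqP; split => t /=; rewrite in_itv/= lte_fin; [move=> [-> ->]|move=> /andP[]].
  exact: measurable_itv.
- have -> : [set t : R | (0 <= t)%R /\ t%:E < +oo] = `[0%R, +oo[%classic.
    apply/seteqP; split => t /=; rewrite in_itv/= andbT; first by case.
    by move=> ->; rewrite ltry.
  exact: measurable_itv.
- have -> : [set t : R | (0 <= t)%R /\ t%:E < -oo] = set0.
    by apply/seteqP; split => t //= [].
  exact: measurable0.
Qed.

Lemma lebesgue_measure_Iset (x : \bar R) : 0 <= x -> mu (Iset x) = x.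
Proof.
move=> x0; have := lebesgue_measure_level 0 x; rewrite sube0 max_l//.
Qed.

Lemma Iset_setI (x : \bar R) : I `&` [set t | t%:E < x] = Iset (mine gamma x).
Proof.
apply/seteqP; split => t; rewrite /Iset/= lt_min; first by move=> [[-> ->] ->].
by move=> [-> /andP[-> ->]].
Qed.

Lemma measurable_level (f : R -> R) s : measurable_fun I f ->
  measurable (I `&` [set t | (s < f t)%R]).
Proof.
move=> mf; have := mf measurable_Iset _ (measurable_itv `]s, +oo[).
congr (measurable (_ `&` _)).
by apply/seteqP; split => t /=; rewrite in_itv/= andbT.
Qed.

Definition level_measure (g : R -> R) (s : R) : \bar R :=
  mu (I `&` [set t | (s < g t)%R]).

Lemma level_measure_le_gamma (g : R -> R) s : 0 <= gamma -> measurable_fun I g ->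
  level_measure g s <= gamma.
Proof.
move=> gamma0 mg; rewrite -[leRHS](lebesgue_measure_Iset gamma0).
apply: le_measure; rewrite ?inE; [exact: measurable_level|exact: measurable_Iset|].
by move=> t [].
Qed.

Lemma le_level_measure (f g : R -> R) : measurable_fun I f -> measurable_fun I g ->
  (forall t, I t -> (f t <= g t)%R) -> forall s, level_measure f s <= level_measure g s.
Proof.
move=> mf mg fg s; apply: le_measure; rewrite ?inE; [exact: measurable_level..|].
by move=> t [It /= sf]; split => //=; exact: lt_le_trans sf (fg _ It).
Qed.

Lemma level_measure_nonincreasing (g : R -> R) : measurable_fun I g ->
  forall s s', (s <= s')%R -> level_measure g s' <= level_measure g s.
Proof.
move=> mg s s' ss'; apply: le_measure; rewrite ?inE; [exact: measurable_level..|].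
by move=> t [It /= sf]; split => //=; exact: le_lt_trans ss' sf.
Qed.

(** The set where [g > s] is the increasing union of the sets where [g > s + 1 / (n + 1)]. *)
Lemma level_measure_right_continuous (g : R -> R) s x : measurable_fun I g ->
  x < level_measure g s -> exists2 s', (s < s')%R & x < level_measure g s'.
Proof.
move=> mg xs.
pose F n := I `&` [set t | (s + n.+1%:R^-1 < g t)%R].
have mF n : measurable (F n) by exact: measurable_level.
have FE : \bigcup_n F n = I `&` [set t | (s < g t)%R].
  apply/seteqP; split => t.
    move=> [n _ [It /= h]]; split => //=; apply: lt_trans h.
    by rewrite ltrDl.
  move=> [It /= h]; have gs : (0 < g t - s)%R by rewrite subr_gt0.
  have [n _ /(_ n (leqnn n)) hn] := near_infty_natSinv_lt (PosNum gs).
  by exists n => //; split => //=; rewrite -ltrBrDl.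
have cF : mu (F n) @[n --> \oo] --> level_measure g s.
  rewrite /level_measure -FE; apply: nondecreasing_cvg_mu => //.
    exact: bigcupT_measurable.
  move=> m n mn; apply/subsetPset => t [It /= h]; split => //=; apply: le_lt_trans h.
  by rewrite lerD2l lef_pV2 ?posrE// ler_nat.
apply: contrapT => nex; move: xs; rewrite ltNge => /negP; apply.
rewrite -(cvg_lim _ cF)//; apply: lime_le; first exact/cvgP/cF.
near=> n; rewrite leNgt; apply/negP => xn; apply: nex.
by exists (s + n.+1%:R^-1)%R => //; rewrite ltrDl.
Unshelve. all: by end_near. Qed.

(** Rearrangement and distribution function are generalized inverses; right continuity gives the
    equivalence with strict inequalities. Through it the layer-cake formula trades rearrangements
    for level measures. *)
Lemma rearrangement_gt (f : R -> R) (l t : R) : measurable_fun I f ->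
  (0 <= l)%R ->
  (l%:E < rearrangement gamma f t) = (t%:E < level_measure (fun t => `|f t|%R) l).
Proof.
move=> mf l0.
have mnf : measurable_fun I (fun t => `|f t|)%R by exact: measurableT_comp.
apply/idP/idP => [lf|tl]; last first.
  have [l' ll' tl'] := level_measure_right_continuous mnf tl.
  apply: (@lt_le_trans _ _ l'%:E); rewrite ?lte_fin//.
  apply: le_ereal_inf_tmp => _ [l'' [l''0 /= dl'' ] <-]; rewrite lee_fin leNgt.
  apply/negP => l''l'; move: tl'; apply/negP; rewrite -leNgt.
  by apply: le_trans dl''; apply: level_measure_nonincreasing => //; exact: ltW.
rewrite ltNge; apply/negP => tl; move: lf; apply/negP; rewrite -leNgt.
apply/lee_addgt0Pr => e e0; apply: ereal_inf_lbound; exists (l + e)%R => //.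
split; first by rewrite ltr_wpDl.
apply: le_trans tl; apply: level_measure_nonincreasing => //.
by rewrite lerDl ltW.
Qed.

Lemma rearrangement_ge0 f t : 0 <= rearrangement gamma f t.
Proof. by apply: le_ereal_inf_tmp => _ [l [l0 _] <-]; rewrite lee_fin ltW. Qed.

End interval.

Lemma max0_subadd (R : realDomainType) (x y z s t : R) : x <= y + z ->
  Num.max (x - (s + t)) 0 <= Num.max (y - s) 0 + Num.max (z - t) 0.
Proof.
move=> xyz; rewrite ge_max addr_ge0 ?le_max ?lexx ?orbT// andbT.
have le_maxl (u : R) : u <= Num.max u 0 by rewrite le_max lexx.
by have := le_maxl (y - s); have := le_maxl (z - t); lra.
Qed.

Lemma nonincreasing_emeasurable (R : realType) (D : set R) (f : R -> \bar R) :
  measurable D -> {homo f : x y / x <= y >-> (y <= x)%E} -> measurable_fun D f.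
Proof.
move=> mD f_ni.
apply: (measurability _ (ErealGenCInfty.measurableE R)) => /= _ [_] [r] -> <-.
apply: measurableI => //; apply: is_interval_measurable => s t/=.
rewrite !in_itv/= !andbT => fs ft u /andP[su ut].
by rewrite in_itv/= andbT (le_trans ft)// f_ni.
Qed.

(** * Integrals of truncated level measures *)

Section truncated_level.
Context (R : realType) (gamma : \bar R).
Local Notation mu := (@lebesgue_measure R).
Local Notation I := (Iset gamma).
Local Notation level_measure := (level_measure gamma).
Local Open Scope ereal_scope.

Let mI : measurable I := measurable_Iset gamma.

Definition excess (g : R -> R) (s : R) : \bar R :=
  \int[mu]_(t in I) (Num.max (g t - s) 0)%:E.

Lemma excess_ge0 g s : 0 <= excess g s.
Proof. by apply: integral_ge0 => t _; rewrite lee_fin le_max lexx orbT. Qed.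

Lemma measurable_excess_fun (g : R -> R) (s : R) : measurable_fun I g ->
  measurable_fun I (fun t => (Num.max (g t - s) 0)%:E).
Proof.
move=> mg; apply/measurable_EFinP; apply: measurable_maxr => //.
exact: measurable_funB.
Qed.

Lemma excessE (g : R -> R) s : measurable_fun I g ->
  excess g s = \int[mu]_(r in `[s, +oo[) level_measure g r.
Proof.
move=> mg; transitivity (\int[mu]_(t in I) (maxe ((g t)%:E - s%:E) 0 * (cst 1 t))).
  by apply: eq_integral => t _; rewrite /cst mule1 -EFinB EFin_max.
rewrite layer_cake//; last exact/measurable_EFinP.
by apply: eq_integral => r _; rewrite integral_cst ?mul1e//; exact: measurable_level.
Qed.

(* For [g >= 0] this is the integral of [g^*] over [0, a], or the K-functional of
   [g] for the couple (L^1, L^oo) at [a]. *)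
Definition truncated_level (a : \bar R) (g : R -> R) : \bar R :=
  \int[mu]_(s in `[0%R, +oo[) mine a (level_measure g s).

Lemma truncated_level_ge0 a g : 0 <= a -> 0 <= truncated_level a g.
Proof. by move=> a0; apply: integral_ge0 => s _; rewrite le_min a0/=. Qed.

Lemma measurable_level_measure (D : set R) (g : R -> R) : measurable D ->
  measurable_fun I g -> measurable_fun D (level_measure g).
Proof.
by move=> mD mg; apply: nonincreasing_emeasurable => // s s'; exact: level_measure_nonincreasing.
Qed.

Let mmin (D : set R) a (g : R -> R) : measurable D ->
  measurable_fun I g -> measurable_fun D (fun s => mine a (level_measure g s)).
Proof. by move=> mD mg; apply: measurable_mine => //; exact: measurable_level_measure. Qed.

Let splitE a (g : R -> R) s : 0 <= a -> measurable_fun I g -> (0 <= s)%R ->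
  truncated_level a g = \int[mu]_(r in `[0%R, s[) mine a (level_measure g r) +
                        \int[mu]_(r in `[s, +oo[) mine a (level_measure g r).
Proof.
move=> a0 mg s0; rewrite /truncated_level.
have -> : `[0%R, +oo[%classic = `[0%R, s[%classic `|` `[s, +oo[%classic :> set R.
  apply/seteqP; split => r /=; rewrite !in_itv/= !andbT.
    by move=> r0; case: (ltP r s) => rs; [left; rewrite r0|right].
  by move=> [/andP[]//|]; exact: le_trans.
rewrite ge0_integral_setU//.
- by apply: mmin => //; exact: measurableU.
- by move=> r _; rewrite le_min a0/=.
- by apply/disj_setPS => r [/=]; rewrite !in_itv/= andbT => /andP[_ rs]; rewrite leNgt rs.
Qed.

(** Together with [truncated_level_attained] this presents [truncated_level a g] as the minimum over
    [s] of [a * s + excess g s], the form from which subadditivity can be read off. *)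
Lemma truncated_level_le a (g : R -> R) s : 0 <= a -> measurable_fun I g ->
  (0 <= s)%R -> truncated_level a g <= a * s%:E + excess g s.
Proof.
move=> a0 mg s0; rewrite (splitE a0 mg s0) excessE//; apply: leeD.
  have -> : a * s%:E = \int[mu]_(r in `[0%R, s[) (cst a r).
    rewrite integral_cst//=. rewrite lebesgue_measure_itv/= lte_fin oppr0 adde0.
    by move: s0; rewrite le_eqVlt => /predU1P[<-|->//]; rewrite ltxx.
  apply: ge0_le_integralW => r _; first by rewrite le_min a0/=.
  by rewrite ge_min lexx.
apply: ge0_le_integralW => r _; first by rewrite le_min a0/=.
by rewrite ge_min lexx orbT.
Qed.

(** In the second case [s] is the least level whose measure is at most [a]; right continuity shows
    that the infimum is attained. *)
Lemma level_quantile a (g : R -> R) : measurable_fun I g ->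
  (forall s, (0 <= s)%R -> a < level_measure g s) \/
  exists s, [/\ (0 <= s)%R, level_measure g s <= a &
    forall s', (0 <= s')%R -> (s' < s)%R -> a < level_measure g s'].
Proof.
move=> mg; have [|] := pselect (forall s, (0 <= s)%R -> a < level_measure g s); first by left.
move=> /existsNP[s1 /not_implyP[s10 /negP]]; rewrite -leNgt => ds1; right.
pose A := [set s : R | (0 <= s)%R /\ level_measure g s <= a].
have infA : has_inf A by split; [exists s1|exists 0%R => s []].
exists (inf A); split.
- by apply: lb_le_inf; [exists s1|move=> s []].
- rewrite leNgt; apply/negP => /(level_measure_right_continuous mg)[s' s'A ds'].
  have := @inf_adherent _ A (s' - inf A)%R ltac:(rewrite subr_gt0; exact: s'A) infA.
  move=> [s [s0 ds]]; rewrite addrC subrK => ss'.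
  have := le_lt_trans ds ds'; apply/negP; rewrite -leNgt.
  by apply: level_measure_nonincreasing => //; exact: ltW.
- move=> s s0 sA; rewrite ltNge; apply/negP => ds.
  by have := ge_inf infA.2 (conj s0 ds : A s); rewrite leNgt sA.
Qed.

(** The optimal cut is the quantile: below it the minimum is [a], above it the level measure.
    Without a quantile the integrand is the positive constant [a] on a half-line. *)
Lemma truncated_level_attained a (g : R -> R) : 0 < a -> measurable_fun I g ->
  truncated_level a g = +oo \/
  exists2 s, (0 <= s)%R & truncated_level a g = a * s%:E + excess g s.
Proof.
move=> a0 mg; have [all_gt|[s [s0 ds sd]]] := level_quantile a mg.
  left; transitivity (\int[mu]_(r in `[0%R, +oo[) (cst a r)).
    apply: eq_integral => r; rewrite inE/= in_itv/= andbT => r0.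
    by rewrite /cst min_l// ltW// all_gt.
  by rewrite integral_cst//= lebesgue_measure_itv/= ltry oppr0 adde0 gt0_muley.
right; exists s => //; rewrite (splitE (ltW a0) mg s0) excessE//; congr (_ + _).
  transitivity (\int[mu]_(r in `[0%R, s[) (cst a r)).
    apply: eq_integral => r; rewrite inE/= in_itv/= => /andP[r0 rs].
    by rewrite /cst min_l// ltW// sd.
  rewrite integral_cst//= lebesgue_measure_itv/= lte_fin oppr0 adde0.
  by move: s0; rewrite le_eqVlt => /predU1P[<-|->//]; rewrite ltxx.
apply: eq_integral => r; rewrite inE/= in_itv/= andbT => sr.
by rewrite min_r//; apply: le_trans ds; exact: level_measure_nonincreasing.
Qed.

Let truncated_level0 g : truncated_level 0 g = 0.
Proof. by apply: integral0_eq => s _; rewrite min_l. Qed.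

(** Cut [g1] and [g2] at their optimal levels [s1] and [s2], and [g] at [s1 + s2]: excesses add
    up. *)
Lemma truncated_level_subadd a (g g1 g2 : R -> R) : 0 <= a ->
  measurable_fun I g -> measurable_fun I g1 -> measurable_fun I g2 ->
  (forall t, I t -> (g t <= g1 t + g2 t)%R) ->
  truncated_level a g <= truncated_level a g1 + truncated_level a g2.
Proof.
rewrite le_eqVlt => /predU1P[<-|a0] mg mg1 mg2 gle.
  by rewrite !truncated_level0 adde0.
have [->|[s1 s10 ->]] := truncated_level_attained a0 mg1.
  by rewrite addye ?leey// gt_eqF// (lt_le_trans (ltNyr 0))// truncated_level_ge0 ?ltW.
have [->|[s2 s20 ->]] := truncated_level_attained a0 mg2.
  rewrite addey ?leey// gt_eqF// (lt_le_trans (ltNyr 0))// adde_ge0 ?excess_ge0//.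
  by apply: mule_ge0; [exact: ltW|rewrite lee_fin].
apply: le_trans (truncated_level_le (ltW a0) mg (addr_ge0 s10 s20)) _.
rewrite EFinD ge0_muleDr ?lee_fin// [leRHS]addeACA. apply: leeD2l.
rewrite /excess -ge0_integralD//; first last.
- exact: measurable_excess_fun.
- by move=> t _; rewrite lee_fin le_max lexx orbT.
- exact: measurable_excess_fun.
- by move=> t _; rewrite lee_fin le_max lexx orbT.
apply: ge0_le_integralW => t It; first by rewrite lee_fin le_max lexx orbT.
by rewrite -EFinD lee_fin max0_subadd// gle.
Qed.

Lemma truncated_levelZ a c (g : R -> R) : 0 <= a -> (0 < c)%R -> measurable_fun I g ->
  truncated_level a (fun t => c * g t)%R <= c%:E * truncated_level a g.
Proof.
rewrite le_eqVlt => /predU1P[<-|a0] c0 mg.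
  by rewrite !truncated_level0 mule0.
have [->|[s s0 ->]] := truncated_level_attained a0 mg.
  by rewrite gt0_muley ?leey// lte_fin.
have mcg : measurable_fun I (fun t => c * g t)%R by exact: measurable_funM.
have cs0 : (0 <= c * s)%R by rewrite mulr_ge0// ltW.
apply: le_trans (truncated_level_le (ltW a0) mcg cs0) _.
rewrite ge0_muleDr ?excess_ge0//; last by apply: mule_ge0; [exact: ltW|rewrite lee_fin].
rewrite EFinM muleCA; apply: leeD2l; rewrite /excess -ge0_integralZl_EFin//; first last.
- exact: ltW.
- exact: measurable_excess_fun.
- by move=> t _; rewrite lee_fin le_max lexx orbT.
apply: ge0_le_integralW => t It; first by rewrite lee_fin le_max lexx orbT.
by rewrite -EFinM lee_fin -mulrBr maxr_pMr ?mulr0// ltW.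
Qed.

End truncated_level.

(** * Weights and the Choquet integral *)

Section weight.
Context (R : realType) (gamma : \bar R) (w : R -> R).
Local Notation mu := (@lebesgue_measure R).
Local Notation I := (Iset gamma).
Local Notation level_measure := (level_measure gamma).
Local Open Scope ereal_scope.
Hypothesis gamma_gt0 : 0 < gamma.
Hypothesis hw : weight gamma w.

Let mI : measurable I := measurable_Iset gamma.
Let gamma_ge0 : 0 <= gamma := ltW gamma_gt0.

Lemma weight_gt0 t : I t -> (0 < w t)%R. Proof. by case: hw => + _ _ _; apply. Qed.

Lemma weight_ge0 t : I t -> 0 <= (w t)%:E.
Proof. by move=> /weight_gt0/ltW; rewrite lee_fin. Qed.

Lemma weight_le s t : (0 < s)%R -> (s <= t)%R -> I t -> (w t <= w s)%R.
Proof. by case: hw => _ + _ _; apply. Qed.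

(** Since [w] decreases on the open interval only, its upper level sets are intervals up to the
    point 0. *)
Lemma measurable_weight : measurable_fun I w.
Proof.
apply: (measurability (@RGenOInfty.G R)) => [|/= _ [_] [r] -> <-].
  exact: RGenOInfty.measurableE.
rewrite -(setUIDK (I `&` w @^-1` `]r, +oo[) [set 0%R]).
apply: measurableU.
  have [] := @subset_set1 _ ((I `&` w @^-1` `]r, +oo[) `&` [set 0%R]) 0%R.
  - by move=> t [].
  - by move=> ->.
  - by move=> ->; exact: measurable_set1.
apply: is_interval_measurable => s t [[[s0 sg] sr] sN] [[It tr] tN] u /andP[su ut].
have s00 : (0 < s)%R by rewrite lt_def s0 andbT; exact/eqP.
have Iu : I u.
  split; first exact: le_trans s0 su.
  by apply: le_lt_trans It.2; rewrite lee_fin.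
split; last by move=> /= u0; move: su; rewrite u0 leNgt s00.
split => //; move: tr; rewrite /= !in_itv/= !andbT => /lt_le_trans; apply.
by apply: weight_le => //; exact: lt_le_trans s00 su.
Qed.

Let mw : measurable_fun I (EFin \o w).
Proof. by apply/measurable_EFinP; exact: measurable_weight. Qed.

(** The argument is extended because it will be a level measure, possibly infinite. *)
Definition weight_integral (x : \bar R) : \bar R :=
  \int[mu]_(t in I `&` [set t | t%:E < x]) (w t)%:E.

Local Notation W := weight_integral.
Local Notation wl := (level_measure w).

Let measure_setD0 (A : set R) : measurable A -> mu (A `\ 0%R) = mu A.
Proof.
move=> mA; have := measureDI mu mA (measurable_set1 (0%R : R)).
move=> ->/=; rewrite [X in _ = _ + X](_ : _ = 0) ?adde0//.
apply/eqP; rewrite eq_le measure_ge0 andbT -(lebesgue_measure_set1 (0%R : R)).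
by apply: le_measure; rewrite ?inE//; exact: measurableI.
Qed.

(** As [w] decreases, the sets [[0, x[] and [w > r] are nested up to the point 0. The formula writes
    [W] as an average of the functions [min(a, x)] of [x]; this is the form in which concavity of
    [W] is used. *)
Lemma weight_integral_level x : 0 <= x -> x <= gamma ->
  W x = \int[mu]_(r in `[0%R, +oo[) mine (wl r) x.
Proof.
move=> x0 xg; pose A := I `&` [set t | t%:E < x].
have AE : A = Iset x by rewrite /A Iset_setI min_r.
have mA : measurable A by rewrite AE; exact: measurable_Iset.
have muA : mu A = x by rewrite AE lebesgue_measure_Iset.
rewrite /W -/A.
transitivity (\int[mu]_(t in A) ((w t)%:E * cst 1 t)).
  by apply: eq_integral => t _; rewrite /cst mule1.
rewrite ge0_layer_cake//; last 2 first.
- by apply: measurable_funS mw => //; exact: subIsetl.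
- by move=> t [It _]; exact: weight_ge0.
apply: eq_integral => r _.
pose B := I `&` [set t | (r < w t)%R].
have mB : measurable B by apply: measurable_level; exact: measurable_weight.
have mAB := measurableI _ _ mA mB.
have -> : A `&` [set t | r%:E < (w t)%:E] = A `&` B.
  by apply/seteqP; split => t [At Bt]; split => //; [split => //; exact: At.1|exact: Bt.2].
rewrite integral_cst//= mul1e.
have [AB|nAB] := pselect (A `\ 0%R `<=` B).
  have -> : mu (A `&` B) = mu A.
    apply/eqP; rewrite eq_le; apply/andP; split.
      by apply: le_measure; rewrite ?inE//; exact: subIsetl.
    rewrite -measure_setD0//; apply: le_measure; rewrite ?inE//.
      exact: measurableD.
    by move=> t At; split; [exact: At.1|exact: AB].
  rewrite muA min_r// -muA -measure_setD0//.
  by apply: le_measure; rewrite ?inE//; exact: measurableD.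
have BA : B `\ 0%R `<=` A.
  move=> u [[Iu /= ru] u0]; apply: contrapT => nAu; apply: nAB => t [[It tx] t0].
  split => //=; apply: (lt_le_trans ru); apply: weight_le => //.
    by rewrite lt_def It.1 andbT; exact/eqP.
  rewrite leNgt; apply/negP => ut; apply: nAu; split => //=.
  by apply: lt_trans tx; rewrite lte_fin.
have -> : mu (A `&` B) = mu B.
  apply/eqP; rewrite eq_le; apply/andP; split.
    by apply: le_measure; rewrite ?inE//; exact: subIsetr.
  rewrite -(measure_setD0 mB); apply: le_measure; rewrite ?inE//.
    exact: measurableD.
  by move=> t Bt; split; [exact: BA|exact: Bt.1].
rewrite min_l// -muA /wl -/B -(measure_setD0 mB).
by apply: le_measure; rewrite ?inE//; exact: measurableD.
Qed.

Lemma weight_integral_ge0 x : 0 <= W x.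
Proof. by apply: integral_ge0 => t [It _]; exact: weight_ge0. Qed.

Lemma le_weight_integral : {homo W : x y / x <= y}.
Proof.
move=> x y xy; apply: ge0_subset_integral.
- by rewrite Iset_setI; exact: measurable_Iset.
- by rewrite Iset_setI; exact: measurable_Iset.
- by apply: measurable_funS mw => //; exact: subIsetl.
- by move=> t [It _]; exact: weight_ge0.
- by move=> t [It /= tx]; split => //=; exact: lt_le_trans tx xy.
Qed.

Lemma weight_integral0 : W 0 = 0.
Proof.
rewrite /W (_ : _ `&` _ = set0) ?integral_set0//.
by apply/seteqP; split => // t [[t0 _]] /=; rewrite lte_fin ltNge t0.
Qed.

Lemma Iset_approx x : x < gamma -> exists2 t, (0 < t)%R & I t /\ x < t%:E.
Proof.
move=> xg; have [y [y0 xy yg]] : exists y, [/\ (0 <= y)%R, x <= y%:E & y%:E < gamma].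
  have [x0|/ltW x0] := leP x 0; first by exists 0%R.
  move: xg x0; case: x => [x xg x0|//|//]; first by exists x.
  by rewrite ltNge leey.
case: gamma yg => [g|_|//].
  rewrite lte_fin => yg; exists ((y + g) / 2)%R; first lra.
  split; first by split; rewrite ?lte_fin; lra.
  by apply: le_lt_trans xy _; rewrite lte_fin; lra.
exists (y + 1)%R; first lra.
split; first by split; rewrite ?ltry//; lra.
by apply: le_lt_trans xy _; rewrite lte_fin; lra.
Qed.

(** For [x < gamma] this is local integrability. Otherwise [gamma] is finite, and beyond some [t]
    inside [I] the weight is bounded by [w t]. *)
Lemma weight_integral_lty x : x < +oo -> W x < +oo.
Proof.
move=> xy.
have fin_I t : I t -> W t%:E < +oo.
  move=> It; case: hw => _ _ /(_ t It) /integrableP[_ /le_lt_trans h] _; apply: h.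
  apply: (@le_trans _ _ (\int[mu]_(s in `[0%R, t]) (w s)%:E)).
    apply: ge0_subset_integral => //.
    - by rewrite Iset_setI; exact: measurable_Iset.
    - apply: measurable_funS mw => // s /=; rewrite in_itv/= => /andP[s0 st].
      by split => //; apply: le_lt_trans It.2; rewrite lee_fin.
    - move=> s /=; rewrite in_itv/= => /andP[s0 st]; apply: weight_ge0.
      by split => //; apply: le_lt_trans It.2; rewrite lee_fin.
    - by move=> s [[s0 _]] /=; rewrite in_itv/= s0 lte_fin => /ltW.
  apply: ge0_le_integralW => s /=; rewrite in_itv/= => /andP[s0 st].
    apply: weight_ge0; split => //; apply: le_lt_trans It.2; by rewrite lee_fin.
  exact: lee_abs.
have [xg|gx] := ltP x gamma.
  have [t t0 [It xt]] := Iset_approx xg.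
  by apply: le_lt_trans (fin_I _ It); apply: le_weight_integral; exact: ltW.
have [t t0 [It _]] := Iset_approx gamma_gt0.
pose J := I `&` [set s | (t <= s)%R].
have mJ : measurable J.
  have -> : J = I `&` `[t, +oo[ by apply/seteqP; split => s; rewrite /J/= in_itv/= andbT.
  exact: measurableI.
apply: (@le_lt_trans _ _ (W t%:E + \int[mu]_(s in J) (w s)%:E)).
  rewrite -ge0_integral_setU//.
  - apply: ge0_subset_integral.
    + by rewrite Iset_setI; exact: measurable_Iset.
    + by apply: measurableU => //; rewrite Iset_setI; exact: measurable_Iset.
    + by apply: measurable_funS mw => // s [[]|[]].
    + by move=> s [[Is _]|[Is _]]; exact: weight_ge0.
    + move=> s [Is _]; have [st|ts] := ltP s t; [by left|by right].
  - by rewrite Iset_setI; exact: measurable_Iset.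
  - by apply: measurable_funS mw => // s [[]|[]].
  - by move=> s [[Is _]|[Is _]]; exact: weight_ge0.
  - by apply/disj_setPS => s [[_ /= st] [_ /= ts]]; move: st; rewrite lte_fin ltNge ts.
apply: lte_add_pinfty; first exact: fin_I.
apply: (@le_lt_trans _ _ (\int[mu]_(s in J) (cst (w t)%:E s))).
  apply: ge0_le_integralW => s [Is ts]; first exact: weight_ge0.
  by rewrite lee_fin; exact: weight_le.
rewrite integral_cst//= lte_mul_pinfty ?lee_fin ?(ltW (weight_gt0 It))//.
apply: le_lt_trans xy; apply: le_trans gx.
rewrite -(lebesgue_measure_Iset gamma_ge0); apply: le_measure; rewrite ?inE//.
exact: subIsetl.
Qed.

Lemma weight_integral_pinfty : gamma = +oo -> W +oo = +oo.
Proof.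
move=> gy; case: hw => _ _ _ /(_ gy) h; rewrite -[RHS]h /W; congr (integral _ _ _).
by rewrite setIidl// => t _ /=; exact: ltry.
Qed.

(** Dominated convergence in the formula of [weight_integral_level]; the dominating function has the
    finite integral [W t]. *)
Lemma weight_integral_cvg0 e : (0 < e)%R -> exists2 d, (0 < d)%R & W d%:E <= e%:E.
Proof.
move=> e0; have [t t0 [It _]] := Iset_approx gamma_gt0.
have tg : t%:E <= gamma by apply: ltW; exact: It.2.
pose f (n : nat) (r : R) := mine (wl r) (t * n.+1%:R^-1)%:E.
have tn n : (0 < t * n.+1%:R^-1 <= t)%R.
  by rewrite mulr_gt0 ?invr_gt0//= ler_piMr ?(ltW t0)// invf_le1// ler1n.
have fW n : \int[mu]_(r in `[0%R, +oo[) f n r = W (t * n.+1%:R^-1)%:E.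
  have /andP[h1 h2] := tn n.
  rewrite weight_integral_level//; first by rewrite lee_fin ltW.
  by apply: le_trans tg; rewrite lee_fin.
have mf y : measurable_fun (`[0%R, +oo[ : set R) (fun r => mine (wl r) y).
  apply: measurable_mine => //; apply: measurable_level_measure => //.
  exact: measurable_weight.
have wl0 r : 0 <= wl r by exact: measure_ge0.
have : \int[mu]_(r in `[0%R, +oo[) f n r @[n --> \oo] --> \int[mu]_(r in `[0%R, +oo[) (cst 0 r).
  apply: (@dominated_cvg _ (measurableTypeR R) R mu _ (measurable_itv _) f (cst 0)
    (fun r => mine (wl r) t%:E)) => //.
  - by move=> n; exact: mf.
  - move=> r _.
    apply: (@squeeze_cvge _ _ _ _ (cst 0) (f ^~ r) (fun n => (t * n.+1%:R^-1)%:E)).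
    + near=> n; rewrite /f le_min wl0 lee_fin ge_min lexx orbT andbT/=.
      by have /andP[/ltW] := tn n.
    + exact: cvg_cst.
    + apply: cvg_EFin; first by near=> n.
      rewrite -(mulr0 t); apply: cvgMr; exact: cvg_harmonic.
  - move=> r _; rewrite fin_numElt; apply/andP; split.
      by rewrite lt_min ltNyr andbT (lt_le_trans (ltNyr 0)).
    by rewrite gt_min ltry orbT.
  - apply/integrableP; split; first exact: mf.
    apply: (@le_lt_trans _ _ (W t%:E)); last by rewrite weight_integral_lty// ltry.
    rewrite weight_integral_level// ?lee_fin ?(ltW t0)//; apply: ge0_le_integralW => // r _.
    by rewrite gee0_abs// le_min wl0 lee_fin ltW.
  - move=> n r _; have /andP[h1 h2] := tn n; rewrite gee0_abs.
      by rewrite /f le_min !ge_min lexx/= lee_fin h2 orbT.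
    by rewrite /f le_min wl0 lee_fin ltW.
rewrite integral0 => /fine_cvgP[_]/cvgrPdist_le/(_ e e0)[n _ /(_ n (leqnn n))]/=.
rewrite sub0r normrN fW => h; have /andP[h1 h2] := tn n.
exists (t * n.+1%:R^-1)%R => //.
rewrite -(@fineK _ (W _)); last first.
  by rewrite ge0_fin_numE ?weight_integral_ge0// weight_integral_lty// ltry.
by rewrite lee_fin; apply: le_trans h; exact: ler_norm.
Unshelve. all: by end_near. Qed.

End weight.

Section choquet.
Context (R : realType) (gamma : \bar R) (w : R -> R).
Local Notation mu := (@lebesgue_measure R).
Local Notation I := (Iset gamma).
Local Notation level_measure := (level_measure gamma).
Local Open Scope ereal_scope.
Hypothesis gamma_gt0 : 0 < gamma.
Hypothesis hw : weight gamma w.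
Local Notation W := (weight_integral gamma w).
Local Notation wl := (level_measure w).

Let mI : measurable I := measurable_Iset gamma.
Let gamma_ge0 : 0 <= gamma := ltW gamma_gt0.

(** Levels start at 0, so the value depends on the positive part of [g] only. *)
Definition choquet (g : R -> R) : \bar R :=
  \int[mu]_(s in `[0%R, +oo[) W (level_measure g s).

Lemma choquet_ge0 g : 0 <= choquet g.
Proof. by apply: integral_ge0 => s _; exact: weight_integral_ge0 hw _. Qed.

Lemma measurable_weight_level (D : set R) (g : R -> R) : measurable D ->
  measurable_fun I g -> measurable_fun D (fun s => W (level_measure g s)).
Proof.
move=> mD mg; apply: nonincreasing_emeasurable => // s s' ss'.
by apply: le_weight_integral => //; exact: level_measure_nonincreasing.
Qed.

Lemma le_choquet (f g : R -> R) : measurable_fun I f -> measurable_fun I g ->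
  (forall t, I t -> (f t <= g t)%R) -> choquet f <= choquet g.
Proof.
move=> mf mg fg; apply: ge0_le_integralW => s _; first exact: weight_integral_ge0 hw _.
by apply: le_weight_integral => //; exact: le_level_measure.
Qed.

Let mwl : measurable_fun I w := measurable_weight hw.

(* The Choquet integral is an average of the functionals [truncated_level a],
   whose subadditivity it inherits. *)
Lemma choquetE (g : R -> R) : measurable_fun I g ->
  choquet g = \int[mu]_(r in `[0%R, +oo[) truncated_level gamma (wl r) g.
Proof.
move=> mg; pose a := wl \_ `[0%R, +oo[; pose d := level_measure g \_ `[0%R, +oo[.
have d0 s : 0 <= d s by apply: erestrict_ge0.
have a0 r : 0 <= a r by apply: erestrict_ge0.
have md : measurable_fun setT d.
  by apply/(measurable_restrictT _ (measurable_itv _)); exact: measurable_level_measure.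
have ma : measurable_fun setT a.
  by apply/(measurable_restrictT _ (measurable_itv _)); exact: measurable_level_measure.
transitivity (\int[mu]_s \int[mu]_r mine (a r) (d s)).
  rewrite /choquet integral_mkcond; apply: eq_integral => s _.
  rewrite /patch; case: ifPn => sp; last first.
    by rewrite integral0_eq// => r _; rewrite /d patchN// min_r.
  rewrite weight_integral_level//; last exact: level_measure_le_gamma.
  rewrite [LHS]integral_mkcond; apply: eq_integral => r _.
  have -> : d s = level_measure g s by rewrite /d patchT.
  rewrite /a /patch; case: ifPn => // _.
  by rewrite min_l//; exact: measure_ge0.
transitivity (\int[mu]_r \int[mu]_s mine (a r) (d s)).
  have mf : measurable_fun setT (fun z : R * R => mine (a z.2) (d z.1)).
    apply: measurable_mine => //.
      exact: (measurableT_comp ma measurable_snd).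
    exact: (measurableT_comp md measurable_fst).
  apply: (fubini_tonelli (m1 := mu) (m2 := mu) _ mf).
  by move=> z; rewrite le_min a0 d0.
apply/esym; rewrite integral_mkcond; apply: eq_integral => r _.
rewrite /patch; case: ifPn => rp; last first.
  by apply/esym/integral0_eq => s _; rewrite /a patchN// min_l.
rewrite /truncated_level integral_mkcond; apply: eq_integral => s _.
have -> : a r = wl r by rewrite /a patchT.
rewrite /d /patch; case: ifPn => // _.
by rewrite min_r//; exact: measure_ge0.
Qed.

Lemma measurable_truncated_level (D : set R) (g : R -> R) : measurable D ->
  measurable_fun I g -> measurable_fun D (fun r => truncated_level gamma (wl r) g).
Proof.
move=> mD mg; apply: nonincreasing_emeasurable => // r r' rr'.
apply: ge0_le_integralW => s _; first by rewrite le_min !measure_ge0.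
by rewrite le_min !ge_min lexx orbT andbT level_measure_nonincreasing.
Qed.

Let trunc0 r g : 0 <= truncated_level gamma (wl r) g.
Proof. by apply: truncated_level_ge0; exact: measure_ge0. Qed.

Lemma choquet_subadd (g g1 g2 : R -> R) : measurable_fun I g ->
  measurable_fun I g1 -> measurable_fun I g2 ->
  (forall t, I t -> (g t <= g1 t + g2 t)%R) ->
  choquet g <= choquet g1 + choquet g2.
Proof.
move=> mg mg1 mg2 gle; rewrite !choquetE// -ge0_integralD//; last 2 first.
- exact: measurable_truncated_level.
- exact: measurable_truncated_level.
apply: ge0_le_integralW => // r _.
by apply: truncated_level_subadd => //; exact: measure_ge0.
Qed.

Lemma choquetZ c (g : R -> R) : (0 < c)%R -> measurable_fun I g ->
  choquet (fun t => c * g t)%R = c%:E * choquet g.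
Proof.
have half b (f : R -> R) : (0 < b)%R -> measurable_fun I f ->
    choquet (fun t => b * f t)%R <= b%:E * choquet f.
  move=> b0 mf; have mbf : measurable_fun I (fun t => b * f t)%R.
    exact: measurable_funM.
  rewrite !choquetE// -ge0_integralZl_EFin//; last 2 first.
  - exact: measurable_truncated_level.
  - exact: ltW.
  apply: ge0_le_integralW => // r _.
  by apply: truncated_levelZ => //; exact: measure_ge0.
move=> c0 mg; apply/eqP; rewrite eq_le half//=.
have ci0 : (0 < c^-1)%R by rewrite invr_gt0.
have mcg : measurable_fun I (fun t => c * g t)%R by exact: measurable_funM.
have := half _ _ ci0 mcg; rewrite (_ : (fun t => _) = g); last first.
  by apply/funext => t; rewrite mulrA mulVf ?mul1r// gt_eqF.
by rewrite lee_pdivlMl.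
Qed.

(** Cuts at the levels 1 and 0 bound [truncated_level a g] by [a] and by the integral of [g].
    Averaging the minimum of the two gives [W x]. *)
Lemma choquet_le_weight_integral (g : R -> R) x : measurable_fun I g ->
  0 <= x -> x <= gamma -> (forall t, I t -> (0 <= g t <= 1)%R) ->
  \int[mu]_(t in I) (g t)%:E <= x -> choquet g <= W x.
Proof.
move=> mg x0 xg g01 gx; rewrite choquetE// weight_integral_level//.
apply: ge0_le_integralW => // r _; rewrite le_min; apply/andP; split.
  apply: le_trans (truncated_level_le (measure_ge0 _ _) mg ler01) _.
  rewrite mule1 /excess integral0_eq ?adde0// => t /g01/andP[_ g1].
  by rewrite max_r// subr_le0.
apply: le_trans (truncated_level_le (measure_ge0 _ _) mg (lexx _)) _.
rewrite mule0 add0e /excess; apply: le_trans gx.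
apply: ge0_le_integralW => t /g01/andP[g0 _]; first by rewrite lee_fin le_max lexx orbT.
by rewrite subr0 max_l.
Qed.

Lemma choquet_indic_le (A : set R) : measurable A -> A `<=` I ->
  choquet \1_A <= W (mu A).
Proof.
move=> mA AI; apply: choquet_le_weight_integral => //.
- by rewrite -(lebesgue_measure_Iset gamma_ge0); apply: le_measure; rewrite ?inE.
- by move=> t _; rewrite indicE ler0n/= lern1 leq_b1.
- by rewrite integral_indic// setIidl.
Qed.

Lemma choquet_cst_le (A : set R) c (g : R -> R) : measurable A -> A `<=` I ->
  measurable_fun I g -> (0 < c)%R -> (forall t, I t -> (g t <= c * \1_A t)%R) ->
  choquet g <= c%:E * W (mu A).
Proof.
move=> mA AI mg c0 gc.
have mA1 : measurable_fun I (\1_A : R -> R) by exact: measurable_indic.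
have mcA : measurable_fun I (fun t => c * \1_A t)%R by exact: measurable_funM.
apply: le_trans (le_choquet mg mcA gc) _.
rewrite choquetZ// lee_pmul2l//; exact: choquet_indic_le.
Qed.

(* The layer-cake representation reduces the inequality to indicators. *)
Lemma integralM_le_choquet (g v : R -> R) : measurable_fun I g -> measurable_fun I v ->
  (forall t, I t -> (0 <= g t)%R) -> (forall t, I t -> (0 <= v t)%R) ->
  (forall A, measurable A -> A `<=` I -> \int[mu]_(t in A) (v t)%:E <= W (mu A)) ->
  \int[mu]_(t in I) (g t * v t)%:E <= choquet g.
Proof.
move=> mg mv g0 v0 vW; under eq_integral do rewrite EFinM.
rewrite ge0_layer_cake//; last 2 first.
- exact/measurable_EFinP.
- exact/measurable_EFinP.
apply: ge0_le_integralW => s _.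
  by apply: integral_ge0 => t [It _]; rewrite lee_fin v0.
by apply: vW; [exact: measurable_level|exact: subIsetl].
Qed.

Lemma choquet_le0 (g : R -> R) : (forall t, I t -> (g t <= 0)%R) -> choquet g = 0.
Proof.
move=> g0; apply: integral0_eq => s /=; rewrite in_itv/= andbT => s0.
rewrite (_ : level_measure g s = 0) ?weight_integral0//.
rewrite /level_measure (_ : _ `&` _ = set0) ?measure0//.
apply/seteqP; split => // t [It /= st].
by have := lt_le_trans st (g0 _ It); rewrite ltNge s0.
Qed.

End choquet.

(** * Tails of functions with finite Choquet integral *)

Section choquet_tail.
Context (R : realType) (gamma : \bar R) (w : R -> R).
Local Notation mu := (@lebesgue_measure R).
Local Notation I := (Iset gamma).
Local Notation level_measure := (level_measure gamma).
Local Open Scope ereal_scope.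
Hypothesis gamma_gt0 : 0 < gamma.
Hypothesis hw : weight gamma w.
Local Notation W := (weight_integral gamma w).

Let mI : measurable I := measurable_Iset gamma.
Let gamma_ge0 : 0 <= gamma := ltW gamma_gt0.

(** For [gamma = +oo], divergence of the total weight enters here: an infinite level set at [s]
    would make the integrand infinite on all of [[0, s]]. *)
Lemma level_measure_lty (g : R -> R) s : measurable_fun I g ->
  choquet gamma w g < +oo -> (0 < s)%R -> level_measure g s < +oo.
Proof.
move=> mg gfin s0; have [gy|gfin'] := eqVneq gamma +oo; last first.
  by apply: le_lt_trans (level_measure_le_gamma s gamma_ge0 mg) _; rewrite ltey.
rewrite ltey; apply/eqP => ly; move: gfin; apply/negP; rewrite -leNgt leye_eq; apply/eqP.
apply/eqP; rewrite -leye_eq.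
apply: (@le_trans _ _ (\int[mu]_(r in `[0%R, s]) W (level_measure g r))); last first.
  apply: ge0_subset_integral => //.
  - exact: (measurable_weight_level hw).
  - by move=> r _; exact: weight_integral_ge0 hw _.
  - by move=> r /=; rewrite !in_itv/= => /andP[-> _].
rewrite (eq_integral (cst +oo)); last first.
  move=> r; rewrite inE/= in_itv/= => /andP[_ rs].
  suff -> : level_measure g r = +oo by exact: weight_integral_pinfty.
  by apply/eqP; rewrite -leye_eq -ly; exact: level_measure_nonincreasing.
rewrite integral_cst//= lebesgue_measure_itv/= lte_fin s0 oppr0 adde0.
by rewrite gt0_mulye// lte_fin.
Qed.

(** For each [s > 0] the level sets at [s] of the tails have finite measure and decrease to the
    empty set, so [W] of their measures tends to 0. Dominated convergence in [s] concludes. *)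
Lemma choquet_tail_cvg0 (g : R -> R) (A : nat -> set R) e :
  measurable_fun I g -> (forall t, I t -> (0 <= g t)%R) ->
  choquet gamma w g < +oo ->
  (forall n, measurable (A n)) -> (forall m n, (m <= n)%N -> A m `<=` A n) ->
  I `<=` \bigcup_n A n -> (0 < e)%R ->
  exists n, choquet gamma w (g \_ (I `\` A n)) <= e%:E.
Proof.
move=> mg g0 gfin mA leA IA e0.
pose gn n := g \_ (I `\` A n).
have mgn n : measurable_fun I (gn n).
  apply/(measurable_restrict g (measurableD mI (mA n)) mI).
  exact: (measurable_funS mI (@subIsetl _ _ _) mg).
have gn_le n t : I t -> (gn n t <= g t)%R.
  by move=> It; rewrite /gn /patch; case: ifPn => // _; exact: g0.
have Wfin s : (0 < s)%R -> level_measure g s < +oo by exact: level_measure_lty.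
have lvl s : (0 < s)%R -> forall d, (0 < d)%R ->
    \forall n \near \oo, level_measure (gn n) s <= d%:E.
  move=> s0 d d0.
  have cv : level_measure (gn n) s @[n --> \oo] --> (0 : \bar R).
    rewrite -[X in _ --> X](@measure0 _ _ _ mu).
    rewrite (_ : set0 = \bigcap_n (I `&` [set t | (s < gn n t)%R])).
      apply: (@nonincreasing_cvg_mu _ _ _ mu (fun n => I `&` [set t | (s < gn n t)%R])).
      - apply: le_lt_trans (Wfin s s0); apply: le_level_measure => //; exact: gn_le.
      - by move=> n; exact: measurable_level.
      - by apply: bigcapT_measurable => n; exact: measurable_level.
      - move=> m n mn; apply/subsetPset => t [It /= h]; split => //=; apply: (lt_le_trans h).
        rewrite /gn /patch !in_setD (mem_set It)/=.
        case: ifPn => [nAn|_].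
          by rewrite ifT//; apply: contra nAn => /set_mem /(leA _ _ mn) /mem_set.
        by case: ifPn => // _; exact: g0.
    apply/esym/seteqP; split => // t H; have [It _] := H 0%N Logic.I.
    have [n _ Ant] := IA t It; have [_ /=] := H n Logic.I.
    rewrite /gn /patch in_setD (mem_set Ant) andbF => /ltW; rewrite leNgt s0//.
  near=> n; apply: ltW; near: n; apply: (cv [set y | y < d%:E]).
  by apply: open_nbhs_nbhs; split; [exact: open_ereal_lt_ereal|rewrite /= lte_fin].
have cvW s : (0 < s)%R -> W (level_measure (gn n) s) @[n --> \oo] --> (0 : \bar R).
  move=> s0; have Wlvl0 n : 0 <= W (level_measure (gn n) s) by exact: weight_integral_ge0.
  have near_le x : (0 < x)%R -> \forall n \near \oo, W (level_measure (gn n) s) <= x%:E.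
    move=> x0; have [d d0 Wd] := weight_integral_cvg0 gamma_gt0 hw x0.
    near=> n; apply: le_trans Wd; apply: le_weight_integral => //.
    by near: n; exact: lvl.
  have fin : \forall n \near \oo, W (level_measure (gn n) s) \is a fin_num.
    near=> n; rewrite ge0_fin_numE//; apply: le_lt_trans (ltry 1%R).
    by near: n; exact: near_le.
  apply/fine_cvgP; split => //; apply/cvgr0Pnorm_le => x x0; near=> n.
  rewrite ger0_norm ?fine_ge0// -lee_fin fineK; first by near: n; exact: near_le.
  by near: n; exact: fin.
have cv : choquet gamma w (gn n) @[n --> \oo] --> (0 : \bar R).
  rewrite -[X in _ --> X](@integral0 _ _ _ mu `[0%R, +oo[).
  have [] // := @dominated_convergence _ _ _ mu `[0%R, +oo[ _
    (fun n s => W (level_measure (gn n) s)) (cst 0) (fun s => W (level_measure g s)).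
  - by move=> n; exact: (measurable_weight_level hw).
  - exists [set 0%R]; split => //; first exact: lebesgue_measure_set1.
    move=> s /= H; apply: contrapT => s0; apply: H; rewrite in_itv/= andbT => s_ge0.
    by apply: cvW; rewrite lt_def s_ge0 andbT; exact/eqP.
  - apply/integrableP; split; first exact: (measurable_weight_level hw).
    under eq_integral do rewrite gee0_abs ?(weight_integral_ge0 hw)//.
    exact: gfin.
  - apply: aeW => s n _; rewrite gee0_abs ?(weight_integral_ge0 hw)//.
    by apply: le_weight_integral => //; apply: le_level_measure => //; exact: gn_le.
have [N _ NP] : \forall n \near \oo, choquet gamma w (gn n) < e%:E.
  apply: (cv [set y | y < e%:E]).
  by apply: open_nbhs_nbhs; split; [exact: open_ereal_lt_ereal|rewrite /= lte_fin].
by exists N; apply: ltW; exact: NP N (leqnn N).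
Unshelve. all: by end_near. Qed.
End choquet_tail.

Lemma measurable_orlicz_comp (R : realType) (phi : R -> R) d (T : measurableType d)
    (D : set T) (f : T -> R) :
  orlicz_function phi -> measurable D -> measurable_fun D f ->
  (forall t, D t -> 0 <= f t) -> measurable_fun D (fun t => phi (f t)).
Proof.
move=> hphi mD mf f0.
apply: (measurability (@RGenOInfty.G R)) => [|/= _ [_] [s] -> <-].
  exact: RGenOInfty.measurableE.
have [s0|s0] := leP 0 s; last first.
  rewrite (_ : _ `&` _ = D)//; apply/seteqP; split=> [t []//|t Dt].
  split => //=; rewrite in_itv/= andbT.
  by apply: lt_le_trans s0 _; apply: orlicz_ge0 hphi _ _; exact: f0.
have [u u0 uP] := orlicz_level hphi s0.
have := mf mD _ (measurable_itv `]u, +oo[); congr (measurable _).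
apply/seteqP; split => t [Dt] /=; rewrite !in_itv/= !andbT => h; split => //=.
  by rewrite uP// f0.
by rewrite -uP// f0.
Qed.

(** * The modular as a Choquet integral, and integrals of rearrangements *)

Section modular_choquet.
Context (R : realType) (gamma : \bar R) (w : R -> R).
Local Notation mu := (@lebesgue_measure R).
Local Notation I := (Iset gamma).
Local Notation level_measure := (level_measure gamma).
Local Open Scope ereal_scope.
Hypothesis gamma_gt0 : 0 < gamma.
Hypothesis hw : weight gamma w.
Local Notation W := (weight_integral gamma w).

Let mI : measurable I := measurable_Iset gamma.
Let gamma_ge0 : 0 <= gamma := ltW gamma_gt0.
Let mw : measurable_fun I w := measurable_weight hw.

(** By [orlicz_level] a strict upper level set of [phi] is a half-line, so [phi] of the
    rearrangement exceeds [s] exactly at those [t] that are below the measure of the set where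
    [phi |f| > s]. The layer-cake formula with density [w] then produces [W] of that measure. *)
Lemma modularE (phi f : R -> R) : orlicz_function phi -> measurable_fun I f ->
  modular gamma phi w f = choquet gamma w (fun t => phi `|f t|%R).
Proof.
move=> hphi mf.
have mnf : measurable_fun I (fun t => `|f t|%R) by exact: measurableT_comp.
pose y t := extend_orlicz phi (rearrangement gamma f t).
have y0 t : 0 <= y t.
  rewrite /y; have := rearrangement_ge0 gamma f t.
  by case: rearrangement => [r||]//; rewrite !lee_fin; exact: orlicz_ge0.
have yP s t : (0 <= s)%R ->
    (s%:E < y t) = (t%:E < level_measure (fun t => phi `|f t|%R) s).
  move=> s0; have [u u0 uP] := orlicz_level hphi s0.
  transitivity (u%:E < rearrangement gamma f t).
    rewrite /y; have := rearrangement_ge0 gamma f t.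
    by case: rearrangement => [r||]//=; rewrite ?lee_fin ?lte_fin ?ltry// => /uP.
  rewrite rearrangement_gt// /level_measure; congr (_ < mu (_ `&` _)).
  by apply/seteqP; split => r /=; rewrite uP.
have my : measurable_fun I y.
  apply: (measurability _ (ErealGenOInfty.measurableE R)) => /= _ [_] [r] -> <-.
  have [r0|r0] := leP 0%R r; last first.
    rewrite (_ : _ `&` _ = I)//; apply/seteqP; split=> [t []//|t It].
    split => //=; rewrite in_itv/= andbT.
    by apply: lt_le_trans (y0 _); rewrite lte_fin.
  have -> : I `&` y @^-1` `]r%:E, +oo[ =
      I `&` [set t | t%:E < level_measure (fun t => phi `|f t|%R) r].
    by apply/seteqP; split => t; rewrite /= in_itv/= andbT yP.
  by rewrite Iset_setI; exact: measurable_Iset.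
have mEw : measurable_fun I (EFin \o w) by exact/measurable_EFinP.
have w0 t : I t -> 0 <= (EFin \o w) t by exact: weight_ge0 hw t.
transitivity (\int[mu]_(t in I) (y t * (EFin \o w) t)); first by [].
rewrite (ge0_layer_cake mI my mEw (fun t _ => y0 t) w0).
apply: eq_integral => s; rewrite inE/= in_itv/= andbT => s0.
rewrite /weight_integral; congr (integral _ _ _).
by apply/seteqP; split => t [It /=]; rewrite yP.
Qed.

Lemma measurable_rearrangement (D : set R) v : measurable D ->
  measurable_fun D (rearrangement gamma v).
Proof.
move=> mD; apply: nonincreasing_emeasurable => // s t st.
apply: ereal_inf_le_tmp => _ [l [l0 ls] <-]; exists l => //; split => //.
by apply: le_trans ls _; rewrite lee_fin.
Qed.

(** The level sets of the rearrangement are initial intervals, here cut off at [t], which produces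
    the minimum in [truncated_level]. *)
Lemma integral_rearrangement (v : R -> R) t : (0 < t)%R -> measurable_fun I v ->
  (forall t, I t -> (0 <= v t)%R) ->
  \int[mu]_(s in `[0%R, t]) rearrangement gamma v s = truncated_level gamma t%:E v.
Proof.
move=> t0 mv v0.
transitivity (\int[mu]_(s in `[0%R, t]) (rearrangement gamma v s * cst 1 s)).
  by apply: eq_integral => s _; rewrite /cst mule1.
rewrite ge0_layer_cake//; last 2 first.
- exact: measurable_rearrangement.
- by move=> s _; exact: rearrangement_ge0.
rewrite /truncated_level; apply: eq_integral => s; rewrite inE/= in_itv/= andbT => s0.
have -> : `[0%R, t] `&` [set r | s%:E < rearrangement gamma v r] =
    `[0%R, t] `&` [set r | r%:E < level_measure v s].
  have vE : level_measure (fun t => `|v t|%R) s = level_measure v s.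
    rewrite /level_measure; congr (mu _).
    by apply/seteqP; split => x [Ix /=]; rewrite ger0_norm ?v0.
  by apply/seteqP; split => r [rt /=]; rewrite rearrangement_gt// vE.
have [tl|lt] := leP t%:E (level_measure v s); last first.
  have -> : `[0%R, t]%classic `&` [set r | r%:E < level_measure v s] =
      Iset (level_measure v s).
    apply/seteqP; split => r; rewrite /Iset/= in_itv/=.
      by move=> [/andP[-> _] ->].
    move=> [r0 rl]; split => //; rewrite r0/= -lee_fin.
    by apply: ltW; exact: lt_trans rl lt.
  rewrite integral_cst; last exact: measurable_Iset.
  by rewrite mul1e/= lebesgue_measure_Iset// measure_ge0.
apply/eqP; rewrite eq_le; apply/andP; split.
  apply: (@le_trans _ _ (\int[mu]_(x in `[0%R, t]) cst 1 x)).
    apply: ge0_subset_integral => //.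
    rewrite [X in measurable X](_ : _ = `[0%R, t]%classic `&` Iset (level_measure v s)).
      by apply: measurableI => //; exact: measurable_Iset.
    by apply/seteqP; split => r; rewrite /Iset/= in_itv/= => -[/andP[-> ->]]; [|case].
  by rewrite integral_cst//= mul1e lebesgue_measure_itv/= lte_fin t0 oppr0 adde0.
rewrite -(@lebesgue_measure_Iset _ t%:E); last by rewrite lee_fin ltW.
rewrite -[leLHS]mul1e -integral_cst; last exact: measurable_Iset.
apply: ge0_subset_integral => //.
- exact: measurable_Iset.
- rewrite [X in measurable X](_ : _ = `[0%R, t]%classic `&` Iset (level_measure v s)).
    by apply: measurableI => //; exact: measurable_Iset.
  by apply/seteqP; split => r; rewrite /Iset/= in_itv/= => -[/andP[-> ->]]; [|case].
- move=> r [r0 rt]; split; first by rewrite /= in_itv/= r0 -lee_fin ltW.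
  exact: lt_le_trans rt tl.
Qed.

Lemma integral_weight_itv t : (0 < t)%R -> t%:E <= gamma ->
  \int[mu]_(s in `[0%R, t]) (w s)%:E = W t%:E.
Proof.
move=> t0 tg.
have sub : `[0%R, t[%classic `<=` I.
  move=> s /=; rewrite in_itv/= => /andP[s0 st]; split => //.
  by apply: lt_le_trans tg; rewrite lte_fin.
rewrite -integral_itv_bndo_bndc; last first.
  by apply/measurable_EFinP; exact: measurable_funS mw.
rewrite /weight_integral; congr (integral _ _ _).
apply/seteqP; split => s /=; rewrite in_itv/=.
  by move=> /andP[s0 st]; split; [apply: sub; rewrite /= in_itv/= s0|rewrite lte_fin].
by move=> [[-> _]]; rewrite lte_fin.
Qed.

End modular_choquet.

Global Opaque choquet.

(** * Submajorization *)

Section submajorization.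
Context (R : realType) (gamma : \bar R) (w : R -> R).
Local Notation mu := (@lebesgue_measure R).
Local Notation I := (Iset gamma).
Local Notation level_measure := (level_measure gamma).
Local Open Scope ereal_scope.
Hypothesis gamma_gt0 : 0 < gamma.
Hypothesis hw : weight gamma w.
Local Notation W := (weight_integral gamma w).

Let mI : measurable I := measurable_Iset gamma.
Let gamma_ge0 : 0 <= gamma := ltW gamma_gt0.
Let mw : measurable_fun I w := measurable_weight hw.

Lemma Iset_exhaust : exists t_ : nat -> R,
  [/\ forall n, (0 < t_ n)%R /\ (t_ n)%:E < gamma,
      {homo t_ : m n / (m <= n)%N >-> (m <= n)%R} &
      forall t, I t -> exists n, (t <= t_ n)%R].
Proof.
move: gamma_gt0; rewrite /Iset; case: gamma => [g| |//]; last first.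
  move=> _; exists (fun n => n.+1%:R); split.
  - by move=> n; rewrite ltr0n ltry.
  - by move=> m n mn; rewrite ler_nat.
  - move=> t [t0 _]; exists (Num.truncn t); apply/ltW; exact: Num.Theory.truncnS_gt.
(* The index [n + 2] keeps the first point, [g / 2], positive. *)
rewrite lte_fin => g0; exists (fun n => g - g * n.+2%:R^-1)%R; split.
- move=> n; rewrite lte_fin gtrBl divr_gt0// subr_gt0; split => //.
  by rewrite ltr_pdivrMr// ltr_pMr// ltr1n.
- move=> m n mn; rewrite lerD2l lerN2 ler_pM2l// lef_pV2 ?posrE// ler_nat.
  by rewrite !ltnS.
- move=> t [t0]; rewrite lte_fin => tg.
  have tg0 : (0 < (g - t) / g)%R by rewrite divr_gt0// subr_gt0.
  have [n _ /(_ n (leqnn n)) hn] := near_infty_natSinv_lt (PosNum tg0).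
  exists n; rewrite lerBrDr -lerBrDl mulrC -ler_pdivlMr//; apply: le_trans (ltW hn).
  by rewrite lef_pV2 ?posrE// ler_nat.
Qed.

(** Hardy-Littlewood: a level set of [v] inside [A] has measure at most the minimum of [mu A] and
    the full level measure. Submajorization speaks of [0 < t < gamma] only, so sets of larger
    measure are exhausted by smaller ones. *)
Lemma submajorized_integral_le (v : R -> R) (A : set R) : measurable_fun I v ->
  (forall t, I t -> (0 <= v t)%R) -> submajorized gamma v w ->
  measurable A -> A `<=` I -> \int[mu]_(t in A) (v t)%:E <= W (mu A).
Proof.
move=> mv v0 vw.
have bounded_case B : measurable B -> B `<=` I -> mu B < gamma ->
    \int[mu]_(t in B) (v t)%:E <= W (mu B).
  move=> mB BI Bg.
  have [B0|B0] := eqVneq (mu B) 0.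
    rewrite null_set_integral//; first exact: weight_integral_ge0 hw _.
    by apply/measurable_EFinP; exact: measurable_funS mv.
  have : mu B \is a fin_num.
    by rewrite ge0_fin_numE ?measure_ge0// (lt_le_trans Bg)// leey.
  move=> /fineK Bfin; set t := fine (mu B) in Bfin.
  have t0 : (0 < t)%R by rewrite -lte_fin Bfin lt_def B0 measure_ge0.
  rewrite -Bfin; have := vw t t0; rewrite Bfin => /(_ Bg).
  rewrite -Bfin integral_rearrangement// (integral_weight_itv hw)//; last first.
    by rewrite Bfin ltW.
  apply: le_trans.
  have mEv : measurable_fun B (EFin \o v).
    by apply/measurable_EFinP; exact: measurable_funS mv.
  have -> : \int[mu]_(s in B) (v s)%:E = \int[mu]_(s in B) ((v s)%:E * cst 1 s).
    by apply: eq_integral => s _; rewrite /cst mule1.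
  rewrite (ge0_layer_cake mB mEv)//; last by move=> s Bs; rewrite lee_fin v0//; exact: BI.
  apply: ge0_le_integralW => s _; first exact: integral_ge0.
  have mBs : measurable (B `&` [set t | s%:E < (v t)%:E]).
    rewrite -(setIidl BI) -setIA; apply: measurableI => //.
    exact: (@measurable_level _ _ v).
  rewrite integral_cst//= mul1e le_min Bfin; apply/andP; split.
    by apply: le_measure; rewrite ?inE//; exact: subIsetl.
  apply: le_measure; rewrite ?inE//; first exact: measurable_level.
  by move=> r [Br sr]; split => //; exact: BI.
move=> mA AI; have [t_ [t_P t_nd t_cover]] := Iset_exhaust.
pose F n := A `&` `[0%R, t_ n].
have FE : \bigcup_n F n = A.
  apply/seteqP; split => [t [n _ []]//|t At].
  have It := AI _ At; have [n tn] := t_cover t It.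
  by exists n => //; split => //; rewrite /= in_itv/= It.1 tn.
have mF n : measurable (F n) by exact: measurableI.
have cvF : \int[mu]_(t in F n) (v t)%:E @[n --> \oo] --> \int[mu]_(t in A) (v t)%:E.
  rewrite -FE; apply: ge0_nondecreasing_set_cvg_integral => //.
  - move=> m n mn; apply/subsetPset => t [At /=]; rewrite !in_itv/= => /andP[t0 tm].
    by split => //=; rewrite in_itv/= t0 (le_trans tm) ?t_nd.
  - move=> n; apply/measurable_EFinP; apply: measurable_funS mv => //.
    by move=> t [/AI].
  - by move=> n t [/AI It _]; rewrite lee_fin v0.
rewrite -(cvg_lim _ cvF)//; apply: lime_le; first by apply/cvgP; exact: cvF.
near=> n; apply: (@le_trans _ _ (W (mu (F n)))).
  apply: bounded_case => //; first by move=> t [/AI].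
  apply: le_lt_trans (t_P n).2; have -> : (t_ n)%:E = mu `[0%R, t_ n].
    by rewrite lebesgue_measure_itv/= lte_fin (t_P n).1 oppr0 adde0.
  by apply: le_measure; rewrite ?inE//; [exact: mF|exact: subIsetr].
apply: le_weight_integral => //; apply: le_measure; rewrite ?inE//; first exact: mF.
exact: subIsetl.
Unshelve. all: by end_near. Qed.

(* The test functions [\1_A + theta \1_D] with [A = {v > s0}] and
   [D] inside [{v > s}] for [s < s0] nearly attain the concave envelope
   [truncated_level t v] of the integral of [v] over sets of measure [t]. *)
Lemma submajorizedP (v : R -> R) : measurable_fun I v ->
  (forall t, I t -> (0 <= v t)%R) ->
  (forall (t : R) (g : R -> R), (0 < t)%R -> t%:E < gamma -> measurable_fun I g ->
    (forall x, I x -> (0 <= g x <= 1)%R) -> \int[mu]_(x in I) (g x)%:E <= t%:E ->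
    \int[mu]_(x in I) (g x * v x)%:E <= W t%:E) ->
  submajorized gamma v w.
Proof.
move=> mv v0 vW t t0 tg.
rewrite integral_rearrangement// (integral_weight_itv hw)//; last exact: ltW.
have Wfin : W t%:E \is a fin_num.
  rewrite ge0_fin_numE; last exact: weight_integral_ge0 hw _.
  by apply: weight_integral_lty => //; exact: ltry.
have mEv : measurable_fun I (EFin \o v) by exact/measurable_EFinP.
(* [A] is completed by a fraction of the remaining part of the set where [v > s], so that the test
   function has integral exactly [t]. *)
have key s (A : set R) : (0 <= s)%R -> measurable A -> A `<=` I -> mu A <= t%:E ->
    A `<=` [set x | (s < v x)%R] -> t%:E < level_measure v s ->
    \int[mu]_(x in A) (v x)%:E + s%:E * (t%:E - mu A) <= W t%:E.
  move=> s0 mA AI At As ts.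
  have : mu A \is a fin_num.
    by rewrite ge0_fin_numE ?measure_ge0// (le_lt_trans At)// ltry.
  move=> /fineK; set a := fine (mu A) => Afin.
  have a0 : (0 <= a)%R by rewrite -lee_fin Afin measure_ge0.
  have at_ : (a <= t)%R by rewrite -lee_fin Afin.
  pose B := (I `&` [set x | (s < v x)%R]) `\` A.
  have mlev : measurable (I `&` [set x | (s < v x)%R]) by exact: measurable_level.
  have mB : measurable B by exact: measurableD.
  have tB : (t - a)%:E < mu B.
    have vsE : level_measure v s = mu (A `|` B).
      by rewrite /B setDUK// => x Ax; split; [exact: AI|exact: As].
    rewrite EFinB lteBlDr//; apply: lt_le_trans ts _.
    by rewrite vsE addeC Afin; exact: measureU2.
  (* [B] may have infinite measure; a bounded piece of measure above [t - a] suffices, and makes the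
     fraction [th] at most 1. *)
  pose D n := B `&` `[0%R, n%:R].
  have mD n : measurable (D n) by exact: measurableI.
  have DE : \bigcup_n D n = B.
    apply/seteqP; split => [x [n _ []]//|x Bx].
    exists (Num.truncn x).+1 => //; split => //=; rewrite in_itv/=; apply/andP; split.
      by case: Bx => -[[]].
    by apply/ltW; exact: Num.Theory.truncnS_gt.
  have cvD : mu (D n) @[n --> \oo] --> mu B.
    rewrite -DE; apply: nondecreasing_cvg_mu => //; first by rewrite DE.
    move=> m n mn; apply/subsetPset => x [Bx /=]; rewrite !in_itv/= => /andP[x0 xm].
    by split => //=; rewrite in_itv/= x0 (le_trans xm)// ler_nat.
  have [n Dn] : exists n, (t - a)%:E < mu (D n).
    apply: contrapT => nex; move: tB; apply/negP; rewrite -leNgt.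
    rewrite -(cvg_lim _ cvD)//; apply: lime_le; first by apply/cvgP; exact: cvD.
    by near=> n; rewrite leNgt; apply/negP => h; apply: nex; exists n.
  have : mu (D n) \is a fin_num.
    rewrite ge0_fin_numE ?measure_ge0//; apply: (@le_lt_trans _ _ n%:R%:E); last exact: ltry.
    apply: (@le_trans _ _ (mu `[0%R, n%:R])).
      by apply: le_measure; rewrite ?inE//; [exact: mD|exact: subIsetr].
    by rewrite lebesgue_measure_itv/= lte_fin; case: ifPn; rewrite ?oppr0 ?adde0// lee_fin.
  move=> /fineK; set b := fine (mu (D n)) => Dfin.
  have tab : (t - a < b)%R by rewrite -lte_fin Dfin.
  have b0 : (0 < b)%R by apply: le_lt_trans tab; rewrite subr_ge0.
  pose th := ((t - a) / b)%R.
  have th0 : (0 <= th)%R by rewrite divr_ge0 ?subr_ge0// ltW.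
  have th1 : (th <= 1)%R by rewrite ler_pdivrMr// mul1r ltW.
  pose g x : R := (\1_A x + th * \1_(D n) x)%R.
  have mg : measurable_fun I g.
    by apply: measurable_funD; [exact: measurable_indic|apply: measurable_funM].
  have DA x : D n x -> ~ A x by move=> [[]].
  have DI : D n `<=` I by move=> x [[[]]].
  have g01 x : I x -> (0 <= g x <= 1)%R.
    move=> _; rewrite /g !indicE.
    have [xA|xA] := boolP (x \in A).
      rewrite memNset ?mulr0 ?addr0 ?ler01 ?lexx//.
      by move=> /DA; apply; exact: set_mem.
    by case: (x \in D n); rewrite ?mulr1 ?mulr0 ?add0r ?addr0 ?th0 ?th1 ?lexx ?ler01.
  have intE (f : R -> R) : measurable_fun I f -> (forall x, I x -> (0 <= f x)%R) ->
      \int[mu]_(x in I) (g x * f x)%:E =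
      \int[mu]_(x in A) (f x)%:E + th%:E * \int[mu]_(x in D n) (f x)%:E.
    move=> mf f0.
    have E1 (X : set R) : measurable X -> X `<=` I ->
        \int[mu]_(x in X) (f x)%:E = \int[mu]_(x in I) (\1_X x * f x)%:E.
      move=> mX XI; rewrite -{1}(setIidl XI) setIC integral_mkcondr.
      apply: eq_integral => x _; rewrite /patch indicE.
      by case: ifPn; rewrite ?mul1r ?mul0r.
    have m1 (X : set R) : measurable X ->
        measurable_fun I (fun x => (\1_X x * f x)%:E).
      move=> mX; apply/measurable_EFinP; apply: measurable_funM; last exact: mf.
      exact: measurable_indic.
    have p1 (X : set R) x : I x -> 0 <= (\1_X x * f x)%:E.
      by move=> Ix; rewrite lee_fin mulr_ge0// f0.
    rewrite (E1 _ mA AI) (E1 _ (mD n) DI) -ge0_integralZl_EFin//; [|exact: p1|exact: m1].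
    rewrite -ge0_integralD//; [|exact: p1|exact: m1| |]; last 2 first.
    - by move=> x Ix; apply: mule_ge0; [rewrite lee_fin|exact: p1].
    - by apply: measurable_funeM; exact: m1.
    by apply: eq_integral => x _; rewrite -EFinM -EFinD /g mulrDl mulrA.
  have gt : \int[mu]_(x in I) (g x)%:E <= t%:E.
    under eq_integral do rewrite -[g _]mulr1.
    have c1 (X : set R) : measurable X -> \int[mu]_(x in X) (cst 1%R x)%:E = mu X.
      by move=> mX; rewrite -[RHS]mul1e -integral_cst.
    rewrite (intE (cst 1%R))// (c1 _ mA) (c1 _ (mD n)) -Afin -Dfin.
    by rewrite -EFinM divfK ?gt_eqF// -EFinD lee_fin addrC subrK.
  apply: le_trans (vW t g t0 tg mg g01 gt); rewrite intE//; apply: leeD2l.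
  rewrite -Afin -EFinB -EFinM.
  apply: (@le_trans _ _ (th%:E * (s * b)%:E)).
    rewrite -EFinM lee_fin /th mulrA mulrAC divfK ?gt_eqF//.
    by rewrite mulrC.
  apply: lee_wpmul2l; first by rewrite lee_fin.
  have -> : (s * b)%:E = \int[mu]_(x in D n) (cst s%:E x).
    by rewrite EFinM Dfin integral_cst//; exact: mD.
  apply: ge0_le_integralW => x Dx.
    by rewrite lee_fin.
  by rewrite lee_fin ltW//; case: Dx => -[[]].
have [all_gt|[s0 [s00 ds0 s0lt]]] := level_quantile t%:E mv.
  (* At this level, with [A] empty, [key] reads [W t + 1 <= W t]. *)
  exfalso; pose s := ((fine (W t%:E) + 1) / t)%R.
  have s_ge0 : (0 <= s)%R.
    by rewrite divr_ge0 ?(ltW t0)// addr_ge0// fine_ge0// weight_integral_ge0.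
  have := key s set0 s_ge0 measurable0 (@sub0set _ _).
  rewrite measure0 lee_fin (ltW t0) => /(_ isT (@sub0set _ _) (all_gt _ s_ge0)).
  rewrite integral_set0 add0e sube0 -EFinM divfK ?gt_eqF// -{2}(fineK Wfin) lee_fin.
  by rewrite leNgt ltrDl ltr01.
apply: le_trans (truncated_level_le _ mv s00) _; first by rewrite lee_fin ltW.
pose A := I `&` [set x | (s0 < v x)%R].
have mA : measurable A by exact: measurable_level.
have AI : A `<=` I by exact: subIsetl.
have : mu A \is a fin_num.
  by rewrite ge0_fin_numE ?measure_ge0// (le_lt_trans ds0)// ltry.
move=> /fineK; set a := fine (mu A) => Afin.
have a0 : (0 <= a)%R by rewrite -lee_fin Afin measure_ge0.
have at_ : (a <= t)%R by rewrite -lee_fin Afin.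
have intA : \int[mu]_(x in A) (v x)%:E = excess gamma v s0 + (s0 * a)%:E.
  have -> : (s0 * a)%:E = \int[mu]_(x in A) (cst s0%:E x).
    by rewrite EFinM Afin integral_cst.
  rewrite /excess (_ : \int[mu]_(x in I) _ =
      \int[mu]_(x in A) (v x - s0)%:E).
    rewrite -ge0_integralD//.
    - by apply: eq_integral => x _; rewrite /cst -EFinD subrK.
    - by move=> x [_ /= sv]; rewrite lee_fin subr_ge0 ltW.
    - apply/measurable_EFinP; apply: measurable_funB => //; exact: measurable_funS mv.
  rewrite /A [RHS]integral_mkcondr; apply: eq_integral => x _.
  rewrite /patch; case: ifPn => [/set_mem/= sv|/negP xA].
    by rewrite max_l// subr_ge0 ltW.
  rewrite max_r// subr_le0 leNgt; apply/negP => sv; apply: xA; exact: mem_set.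
(* When [s0 = 0] there is no lower level to complete from, and the indicator of [A] is itself an
   admissible test function. *)
move: s00; rewrite le_eqVlt => /predU1P[s0E|s0_gt0].
  rewrite -s0E mule0 add0e; move: intA; rewrite -s0E mul0r adde0 => <-.
  rewrite -{1}(setIidl AI) setIC integral_mkcondr.
  have mA1 : measurable_fun I (\1_A : R -> R) by exact: measurable_indic.
  have := vW t \1_A t0 tg mA1; rewrite integral_indic// setIidl// => /(_ _ ds0).
  move=> H; apply: le_trans (H _); last first.
    by move=> x _; rewrite indicE ler0n/= lern1 leq_b1.
  apply: ge0_le_integralW => x Ix.
    by rewrite /patch; case: ifPn => // _; rewrite lee_fin v0.
  by rewrite /patch indicE; case: ifPn => _; rewrite ?mul1r ?mul0r.
apply/lee_addgt0Pr => e e0.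
(* Lowering the level from [s0] to [s] on a mass of at most [t] costs at most [e]. *)
pose s := Num.max 0%R (s0 - e / t)%R.
have s_ge0 : (0 <= s)%R by rewrite le_max lexx.
have ss0 : (s < s0)%R by rewrite gt_max s0_gt0 gtrBl divr_gt0.
have s_ge : (s0 - e / t <= s)%R by rewrite le_max lexx orbT.
have := key s A s_ge0 mA AI ds0 _ (s0lt _ s_ge0 ss0).
move=> /(_ (fun x Ax => lt_trans ss0 Ax.2)).
rewrite intA -Afin -EFinB -EFinM -EFinM -addeA -EFinD => H.
have -> : (t * s0)%:E + excess gamma v s0 = excess gamma v s0 +
    (s0 * a + s * (t - a))%:E + ((s0 - s) * (t - a))%:E.
  rewrite -[RHS]addeA [LHS]addeC; congr (_ + _).
  rewrite -EFinD; congr (_%:E); ring.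
apply: leeD => //; rewrite lee_fin.
have h1 : (s0 - s <= e / t)%R by rewrite lerBlDl -lerBlDr.
apply: (@le_trans _ _ (e / t * t)%R); last by rewrite divfK// gt_eqF.
by apply: ler_pM => //; rewrite ?subr_ge0 ?(ltW ss0)// gerBl.
Unshelve. all: by end_near. Qed.

End submajorization.

(** * Densities of functionals on test functions *)

Section density.
Context (R : realType).
Local Notation mu := (@lebesgue_measure R).
Local Open Scope ereal_scope.

(* The set function is concentrated on a set of finite measure, so smallness
   on sets of small measure gives both countable additivity and absolute
   continuity. *)
Lemma additive_density (nu : set R -> R) (J : set R) :
  measurable J -> mu J < +oo -> (forall A, nu A = nu (A `&` J)) ->
  (forall A B, measurable A -> measurable B -> A `&` B = set0 ->
    nu (A `|` B) = (nu A + nu B)%R) ->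
  (forall e, (0 < e)%R -> exists2 d, (0 < d)%R & forall A, measurable A ->
    mu A <= d%:E -> (`|nu A| <= e)%R) ->
  exists h : R -> R, [/\ measurable_fun setT h, mu.-integrable setT (EFin \o h) &
    forall A, measurable A -> (nu A)%:E = \int[mu]_(t in A) (h t)%:E].
Proof.
move=> mJ Jfin nuJ nuU small.
have nu0 : nu set0 = 0%R.
  have := nuU set0 set0 measurable0 measurable0 (setI0 _).
  by rewrite setU0 => /eqP; rewrite -subr_eq0 opprD addNKr oppr_eq0 => /eqP.
pose nuE (A : set (measurableTypeR R)) := (nu A)%:E.
have c0 : nuE set0 = 0 by rewrite /nuE nu0.
have cf A : measurable A -> nuE A \is a fin_num by [].
have cs : semi_sigma_additive nuE.
  move=> F mF tF mU.
  pose U n := \big[setU/set0]_(i < n) F i.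
  have mUn n : measurable (U n) by exact: bigsetU_measurable.
  have UE n : (\sum_(0 <= i < n) nuE (F i)) = (nu (U n))%:E.
    elim: n => [|n IH]; first by rewrite big_nil /U big_ord0 nu0.
    rewrite big_nat_recr//= IH /U big_ord_recr/= (nuU _ _ (mUn n) (mF n))//.
    apply/seteqP; split => // t [].
    rewrite /U -bigcup_mkord => -[k /= kn Fk] Fn.
    have := tF k n I I; move=> /(_ (ex_intro _ t (conj Fk Fn))) kE.
    by move: kn; rewrite kE ltnn.
  under eq_fun do rewrite UE.
  apply: cvg_EFin; first by near=> n.
  (* Cutting with [J] gives the remainders finite measure, as continuity from above requires. *)
  pose D n := (\bigcup_i F i `\` U n) `&` J.
  have mD n : measurable (D n) by apply: measurableI => //; exact: measurableD.
  have cvD : mu (D n) @[n --> \oo] --> 0.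
    have D0 : \bigcap_n D n = set0.
      apply/seteqP; split => // t Dt.
      have [[[k _ Fk] _] _] := Dt 0%N I.
      have [[_ Uk] _] := Dt k.+1 I; apply: Uk.
      by rewrite /U -bigcup_mkord; exists k => /=.
    rewrite -[X in _ --> X](measure0 mu) -D0.
    apply: nonincreasing_cvg_mu => //.
    - apply: le_lt_trans Jfin; apply: le_measure; rewrite ?inE//.
      exact: subIsetr.
    - exact: bigcapT_measurable.
    - move=> m n mn; apply/subsetPset => t [[Ft Un] Jt]; split => //; split => //.
      move=> Um; apply: Un; move: Um; rewrite /U -!bigcup_mkord => -[k /= km Fk].
      by exists k => //=; exact: leq_trans mn.
  apply/cvgrPdist_le => e e0; have [d d0 dP] := small e e0.
  have : \forall n \near \oo, mu (D n) <= d%:E.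
    move/fine_cvgP : cvD => [Dfin /cvgrPdist_le/(_ d d0)] Dd.
    near=> n; have Dn : mu (D n) \is a fin_num by near: n.
    rewrite -(fineK Dn) lee_fin; apply: le_trans (ler_norm _) _.
    by rewrite -normrN -(sub0r (fine _)); near: n.
  move=> Dd; near=> n.
  have -> : \bigcup_n F n = U n `|` (\bigcup_n F n `\` U n).
    by rewrite setDUK// /U -bigcup_mkord => t [k _ Fk]; exists k.
  have mUD : measurable (\bigcup_n F n `\` U n) by exact: measurableD.
  rewrite (nuU _ _ (mUn n) mUD); last by rewrite setDIK.
  rewrite addrAC subrr add0r nuJ -/(D n).
  by apply: dP; [exact: mD|near: n].
pose nuc : {charge set (measurableTypeR R) -> \bar R} :=
  HB.pack nuE (isCharge.Build _ (measurableTypeR R) _ nuE c0 cf cs).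
have nu_mu : nuc `<< mu.
  apply/null_content_dominatesP => A mA A0.
  rewrite /nuc/= /nuE; congr (_%:E).
  apply/eqP; rewrite -normr_le0; apply/ler_addgt0Pr => e e0; rewrite add0r.
  by have [d d0 dP] := small e e0; apply: dP => //; rewrite A0 lee_fin ltW.
pose f := Radon_Nikodym nuc mu.
have ff t : f t \is a fin_num by exact: Radon_Nikodym_fin_num.
have fE : EFin \o (fun t => fine (f t)) = f.
  by apply/funext => t /=; rewrite fineK.
have intf : mu.-integrable setT f by exact: Radon_Nikodym_integrable.
exists (fun t => fine (f t)); split.
- by apply/measurable_EFinP; rewrite fE; exact: measurable_int intf.
- by rewrite fE.
- move=> A mA; rewrite -[LHS]/(nuc A) (Radon_Nikodym_integral nu_mu mA).
  by apply: eq_integral => t _; rewrite fineK.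
Unshelve. all: by end_near. Qed.

End density.

Section test_functions.
Context (R : realType) (gamma : \bar R).
Local Notation mu := (@lebesgue_measure R).
Local Notation I := (Iset gamma).

(** Half-open, so that the strip between consecutive windows is the part of [I] where [Num.truncn]
    equals [n]. *)
Definition window (n : nat) : set R := I `&` `[0%R, n%:R[.

(** The codomain [R^o] supplies the module structure that [subspace] asks for. The bound makes [g]
    vanish outside a window, in particular outside [I]. *)
Definition test_function : set (R -> R^o) :=
  [set g | measurable_fun setT (g : R -> R) /\
    exists (n : nat) (M : R), 0 <= M /\ forall t, `|g t| <= M * \1_(window n) t].

Lemma measurable_window n : measurable (window n).
Proof. by apply: measurableI => //; exact: measurable_Iset. Qed.

Lemma window_sub n : window n `<=` I. Proof. exact: subIsetl. Qed.

Lemma le_window m n : (m <= n)%N -> window m `<=` window n.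
Proof.
move=> mn t [It /=]; rewrite in_itv/= => /andP[t0 tm]; split => //=.
by rewrite in_itv/= t0 (lt_le_trans tm)// ler_nat.
Qed.

Lemma window_cover t : I t -> window (Num.truncn t).+1 t.
Proof.
move=> It; split => //=; rewrite in_itv/= It.1/=; exact: Num.Theory.truncnS_gt.
Qed.

Lemma window_lty n : (mu (window n) < +oo)%E.
Proof.
apply: (@le_lt_trans _ _ (mu `[0%R, n%:R[)).
  by apply: le_measure; rewrite ?inE//; [exact: measurable_window|exact: subIsetr].
rewrite lebesgue_measure_itv/= lte_fin.
by case: ifPn => _; rewrite ?ltry// oppr0 adde0 ltry.
Qed.

Lemma test_functionP (g : R -> R) n M : measurable_fun setT g ->
  (forall t, `|g t| <= M * \1_(window n) t) -> test_function g.
Proof.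
move=> mg gM; split => //; exists n, `|M|; split => // t.
apply: le_trans (gM t) _; rewrite ler_wpM2r//; exact: ler_norm.
Qed.

Lemma test_function_indic n (A : set R) : measurable A -> A `<=` window n ->
  test_function \1_A.
Proof.
move=> mA An; apply: (@test_functionP _ n 1) => //.
move=> t; rewrite mul1r ger0_norm// !indicE ler_nat.
by case: (boolP (t \in A)) => // /set_mem/An tn; rewrite mem_set.
Qed.

Lemma subspace_test_function : subspace test_function.
Proof.
split.
  apply: (@test_functionP _ 0%N 0) => //; first exact: measurable_cst.
  by move=> t; rewrite mul0r normr0.
move=> c f g [mf [n [M [M0 fM]]]] [mg [m [N [N0 gN]]]].
apply: (@test_functionP _ (maxn n m) (`|c| * M + N)).
  by apply: measurable_funD => //; exact: measurable_funM.
move=> t; apply: le_trans (ler_normD _ _) _; rewrite mulrDl -mulrA.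
have sub k : (k <= maxn n m)%N -> \1_(window k) t <= \1_(window (maxn n m)) t :> R.
  move=> km; rewrite !indicE ler_nat; case: (boolP (t \in window k)) => //.
  by move=> /set_mem/(le_window km) h; rewrite mem_set.
apply: lerD.
  rewrite normrM ler_wpM2l//; apply: le_trans (fM t) _.
  by rewrite ler_wpM2l// sub// leq_maxl.
by apply: le_trans (gN t) _; rewrite ler_wpM2l// sub// leq_maxr.
Qed.

Lemma test_function_restrict (g : R -> R) (A : set R) :
  test_function g -> measurable A -> test_function (fun t => g t * \1_A t).
Proof.
move=> [mg [n [M [M0 gM]]]] mA; apply: (@test_functionP _ n M).
  by apply: measurable_funM => //; exact: measurable_indic.
move=> t; rewrite normrM; apply: le_trans (gM t); rewrite ler_piMr//.
by rewrite ger0_norm// indicE lern1 leq_b1.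
Qed.

End test_functions.

(** * Representing a functional on test functions by a density *)

Section representation.
Context (R : realType) (gamma : \bar R).
Local Notation mu := (@lebesgue_measure R).
Local Notation I := (Iset gamma).
Local Notation E := (test_function gamma).
Local Notation K := (window gamma).
Variable L : (R -> R) -> R.
Hypothesis linL : forall (c : R) (f g : R -> R), E f -> E g ->
  L (fun t => c * f t + g t) = c * L f + L g.
Hypothesis boundL : forall n, exists2 k, 0 <= k & forall M (g : R -> R), 0 <= M ->
  measurable_fun setT g -> (forall t, `|g t| <= M * \1_(K n) t) -> `|L g| <= k * M.
Hypothesis smallL : forall n e, 0 < e -> exists2 d, 0 < d & forall A : set R, measurable A ->
  A `<=` K n -> (mu A <= d%:E)%E -> `|L \1_A| <= e.

Let E0 : E (fun=> 0). Proof. exact: (subspace_test_function gamma).1. Qed.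

Let L0 : L (fun=> 0) = 0.
Proof.
have := linL 1 E0 E0.
rewrite (_ : (fun t : R => _) = (fun=> 0)); last by apply/funext => t; rewrite mulr0 addr0.
by rewrite mul1r => /eqP; rewrite -subr_eq0 opprD addNKr oppr_eq0 => /eqP.
Qed.

Let LU n (A B : set R) : measurable A -> measurable B -> A `<=` K n -> B `<=` K n ->
  A `&` B = set0 -> L \1_(A `|` B) = L \1_A + L \1_B.
Proof.
move=> mA mB An Bn AB0.
rewrite -[L \1_A]mul1r -linL; [|exact: test_function_indic An|exact: test_function_indic Bn].
congr L; apply/funext => t; rewrite mul1r !indicE in_setU.
have [/set_mem At|] := boolP (t \in A) => /=; rewrite ?add0r//.
by rewrite memNset ?addr0// => Bt; have : (A `&` B) t by []; rewrite AB0.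
Qed.

Let strip n := K n.+1 `\` K n.

Let measurable_strip n : measurable (strip n).
Proof. by apply: measurableD; exact: measurable_window. Qed.

(** Radon-Nikodym is applied strip by strip because a strip has finite measure, and because the
    glued density need only be integrable on each window. *)
Let strip_density n : exists h : R -> R, [/\ measurable_fun setT h,
  mu.-integrable setT (EFin \o h) &
  forall A, measurable A -> (L \1_(A `&` strip n))%:E = (\int[mu]_(t in A) (h t)%:E)%E].
Proof.
have sub (A : set R) : A `&` strip n `<=` K n.+1 by move=> t [_ []].
apply: (@additive_density R (fun A => L \1_(A `&` strip n)) (strip n)) => //.
- apply: le_lt_trans (window_lty gamma n.+1); apply: le_measure; rewrite ?inE.
  + exact: measurable_strip.
  + exact: measurable_window.
  + exact: subDsetl.
- by move=> A; rewrite -setIA setIid.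
- move=> A B mA mB AB0; rewrite setIUl; apply: (@LU n.+1) => //.
  + exact: measurableI.
  + exact: measurableI.
  + by rewrite setIACA AB0 set0I.
- move=> e e0; have [d d0 dP] := smallL n.+1 e0; exists d => // A mA Ad.
  apply: dP => //; first exact: measurableI.
  apply: le_trans Ad; apply: le_measure; rewrite ?inE => //.
  exact: (measurableI A (strip n) mA (measurable_strip n)).
Qed.

Let h_ n := sval (cid (strip_density n)).

Let density t := h_ (Num.truncn t) t.

Let strip_truncn n t : strip n t -> Num.truncn t = n.
Proof.
move=> [[It /=]]; rewrite in_itv/= => /andP[t0 tn1] nK.
apply: Num.Theory.truncn_def; rewrite tn1 andbT leNgt; apply/negP => tn; apply: nK.
by split => //=; rewrite in_itv/= t0.
Qed.

Let measurable_density : measurable_fun setT density.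
Proof.
pose F n := [set t : R | Num.truncn t = n].
have mF n : measurable (F n).
  case: n => [|n].
    (* [Num.truncn] is 0 on negative numbers, hence the unbounded first piece. *)
    have -> : F 0%N = `]-oo, 1[%classic.
      apply/seteqP; split => t; rewrite /F/= in_itv/=.
        by move=> t0; rewrite -(Num.Theory.truncn_le_nat t 0) t0.
      by rewrite -(Num.Theory.truncn_le_nat t 0) leqn0 => /eqP.
    exact: measurable_itv.
  have -> : F n.+1 = `[n.+1%:R, n.+2%:R[%classic.
    apply/seteqP; split => t; rewrite /F/= in_itv/=; last exact: Num.Theory.truncn_def.
    move=> tn; have [t0|t0] := leP 0 t; last first.
      have : t < 1 by exact: lt_trans t0 ltr01.
      by rewrite -(Num.Theory.truncn_le_nat t 0) tn.
    by have := Num.Theory.truncn_itv t0; rewrite tn.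
  exact: measurable_itv.
have -> : setT = \bigcup_n F n by apply/seteqP; split => // t _; exists (Num.truncn t).
apply/(measurable_fun_bigcup _ mF) => n.
apply: (eq_measurable_fun (h_ n)).
  by move=> t /set_mem tn; rewrite /density tn.
by rewrite /h_; case: cid => h [mh _ _] /=; exact: measurable_funS mh.
Qed.

Let mdens (A : set (measurableTypeR R)) : measurable_fun A (EFin \o density).
Proof.
by apply/measurable_EFinP; exact: measurable_funS (@subsetT _ A) measurable_density.
Qed.

Let mdens_abs (A : set (measurableTypeR R)) :
  measurable_fun A (fun t => `|(density t)%:E|%E).
Proof. by apply: measurableT_comp; [exact: abse_measurable|exact: mdens]. Qed.

Let density_strip n A : measurable A -> A `<=` strip n ->
  (L \1_A)%:E = (\int[mu]_(t in A) (density t)%:E)%E.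
Proof.
move=> mA An; have := svalP (cid (strip_density n)) => -[_ _ /(_ A mA)].
rewrite setIidl// => ->; apply: eq_integral => t /set_mem/An/strip_truncn tn.
by rewrite /density tn.
Qed.

Let integrable_strip n : mu.-integrable (strip n) (EFin \o density).
Proof.
have := svalP (cid (strip_density n)) => -[_ hi _].
have hn : mu.-integrable (strip n) (EFin \o h_ n).
  apply (@integrableS _ (measurableTypeR R) R mu setT (strip n)
    (EFin \o h_ n) measurableT (measurable_strip n) (@subsetT _ _) hi).
have hE : {in strip n, EFin \o h_ n =1 EFin \o density}.
  by move=> t /set_mem/strip_truncn tn; rewrite /= /density tn.
exact: (@eq_integrable _ (measurableTypeR R) R mu _ (measurable_strip n) _ _ hE hn).
Qed.

Let window0 : K 0 = set0.
Proof.
apply/seteqP; split => // t [_] /=; rewrite in_itv/= => /andP[t0 t1].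
by have := le_lt_trans t0 t1; rewrite ltxx.
Qed.

Let windowS n : K n.+1 = K n `|` strip n.
Proof. by rewrite setDUK//; exact: le_window. Qed.

Let integrable_window n : mu.-integrable (K n) (EFin \o density).
Proof.
elim: n => [|n IH]; first by rewrite window0; exact: integrable_set0.
rewrite windowS; apply/integrableP; split.
  exact: mdens.
rewrite (ge0_integral_setU mu (measurable_window gamma n) (measurable_strip n))//=.
- by apply: lte_add_pinfty; [case/integrableP : IH|case/integrableP : (integrable_strip n)].
- by apply/disj_setPS => t [? []].
Qed.

Let density_indic n A : measurable A -> A `<=` K n ->
  (L \1_A)%:E = (\int[mu]_(t in A) (density t)%:E)%E.
Proof.
elim: n A => [|n IH] A mA An.
  have -> : A = set0 by apply/seteqP; split => // t /An; rewrite window0.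
  rewrite integral_set0; congr (_%:E); rewrite -[RHS]L0; congr L.
  by apply/funext => t; rewrite indicE in_set0.
have mK := measurable_window gamma n.
have AE : A = (A `&` K n) `|` (A `&` strip n).
  by rewrite -setIUr -windowS setIidl.
have mAK := measurableI _ _ mA mK.
have mAS := measurableI _ _ mA (measurable_strip n).
have dis : A `&` K n `&` (A `&` strip n) = set0.
  by apply/seteqP; split => // t [[_ Kt] [_ [_]]].
rewrite {1}AE (@LU n.+1)//; last 2 first.
- by move=> t [_]; exact: le_window.
- by move=> t [_ []].
rewrite EFinD (IH _ mAK); last exact: subIsetr.
rewrite (@density_strip n _ mAS); last exact: subIsetr.
rewrite {3}AE integral_setU//.
by apply/disj_setPS; rewrite dis.
Qed.

Let integrableM n (g : R -> R) M : 0 <= M -> measurable_fun setT g ->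
  (forall t, `|g t| <= M * \1_(K n) t) ->
  mu.-integrable I (fun t => (g t * density t)%:E) /\
  (`|\int[mu]_(t in I) (g t * density t)%:E| <=
   M%:E * \int[mu]_(t in K n) `|(density t)%:E|)%E.
Proof.
move=> M0 mg gM; have mI := measurable_Iset gamma.
have mK := measurable_window gamma n.
have mgd : measurable_fun I (fun t => (g t * density t)%:E).
  apply/measurable_EFinP; apply: measurable_funM; first exact: measurable_funS mg.
  exact: measurable_funS measurable_density.
have le_int : (\int[mu]_(t in I) `|(g t * density t)%:E| <=
   M%:E * \int[mu]_(t in K n) `|(density t)%:E|)%E.
  rewrite -ge0_integralZl_EFin//.
  rewrite [leRHS]integral_mkcondr; apply: ge0_le_integralW => // t It.
  rewrite /patch; case: ifPn => [tK|tK].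
    rewrite !abse_EFin -EFinM lee_fin normrM ler_wpM2r//.
    apply: le_trans (gM t) _; rewrite ler_piMr// indicE lern1 leq_b1.
  have : `|g t| <= 0.
    apply: le_trans (gM t) _; rewrite indicE memNset ?mulr0// => Kt.
    by move: tK => /negP; apply; apply: mem_set; case: Kt.
  by rewrite normr_le0 => /eqP ->; rewrite mul0r abse0.
split; last exact: le_trans (le_abse_integral mu mI mgd) le_int.
apply/integrableP; split => //; apply: le_lt_trans le_int _.
have /integrableP[_ fin] := integrable_window n.
by apply: lte_mul_pinfty => //; rewrite lee_fin.
Qed.

Let integrable_test (g : R -> R) : E g -> mu.-integrable I (fun t => (g t * density t)%:E).
Proof. by move=> [mg [n [M [M0 gM]]]]; case: (integrableM M0 mg gM). Qed.

Let ifin (f : R -> \bar R) : mu.-integrable I f ->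
  (\int[mu]_(t in I) f t)%E \is a fin_num.
Proof. exact: (@integrable_fin_num _ (measurableTypeR R) R mu _ (measurable_Iset gamma)). Qed.

Let D (g : R -> R) := L g - fine (\int[mu]_(t in I) (g t * density t)%:E)%E.

Let linD (c : R) (f g : R -> R) : E f -> E g ->
  D (fun t => c * f t + g t) = c * D f + D g.
Proof.
move=> Ef Eg; have mI := measurable_Iset gamma.
have fi := integrable_test Ef; have gi := integrable_test Eg.
rewrite /D linL// (_ : (\int[mu]_(t in I) ((c * f t + g t) * density t)%:E =
  c%:E * \int[mu]_(t in I) (f t * density t)%:E + \int[mu]_(t in I) (g t * density t)%:E)%E).
  have If := ifin fi; have Ig := ifin gi.
  by rewrite fineD ?fineM// ?fin_numM//=; ring.
rewrite -integralZl// -integralD//; last exact: integrableZl.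
by apply: eq_integral => t _; rewrite -EFinM -EFinD mulrDl mulrA.
Qed.

Let D0 : D (fun=> 0) = 0.
Proof.
have := linD 1 E0 E0.
rewrite (_ : (fun t : R => _) = (fun=> 0)); last by apply/funext => t; rewrite mulr0 addr0.
by rewrite mul1r => /eqP; rewrite -subr_eq0 opprD addNKr oppr_eq0 => /eqP.
Qed.

Let D_indic n (A : set R) : measurable A -> A `<=` K n -> D \1_A = 0.
Proof.
move=> mA An; rewrite /D (_ : (\int[mu]_(t in I) _ = (L \1_A)%:E)%E) ?subrr//.
rewrite (density_indic mA An) -{2}(@setIidr _ I A); last first.
  exact: subset_trans An (@window_sub _ _ _).
rewrite [RHS]integral_mkcondr; apply: eq_integral => t _.
by rewrite /patch indicE; case: ifPn => _; rewrite ?mul1r ?mul0r.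
Qed.

Let D_bound n : exists2 k, 0 <= k & forall M (g : R -> R), 0 <= M ->
  measurable_fun setT g -> (forall t, `|g t| <= M * \1_(K n) t) -> `|D g| <= k * M.
Proof.
have [k k0 kP] := boundL n.
have /integrableP[_ fin] := integrable_window n.
set c := (\int[mu]_(t in K n) `|(density t)%:E|)%E.
have c0 : (0 <= c)%E by exact: integral_ge0.
have cfin : c \is a fin_num by rewrite ge0_fin_numE.
exists (k + fine c); first by rewrite addr_ge0// fine_ge0.
move=> M g M0 mg gM; apply: le_trans (ler_normB _ _) _; rewrite mulrDl.
apply: lerD; first exact: kP.
have [gi] := integrableM M0 mg gM.
rewrite -/c -(fineK cfin) -EFinM -(fineK (ifin gi)).
by rewrite abse_EFin lee_fin mulrC.
Qed.

(* Halving: [g = (\1_{g >= 1/2} + g') / 2] with [g'] again between [0] and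
   [\1_(K n)], and [D] vanishes on indicators. *)
Let D_unit n (g : R -> R) : measurable_fun setT g ->
  (forall t, 0 <= g t <= \1_(K n) t) -> D g = 0.
Proof.
have [k k0 kP] := D_bound n.
suff H m : forall g : R -> R, measurable_fun setT g ->
    (forall t, 0 <= g t <= \1_(K n) t) -> `|D g| <= k / 2 ^+ m.
  move=> mg g01; apply/eqP; rewrite -normr_le0.
  apply/ler_addgt0Pr => e e0; rewrite add0r.
  have [m _ /(_ m (leqnn m)) hm] := near_infty_natSinv_expn_lt
    (PosNum (ltac:(by rewrite divr_gt0// ltr_wpDl) : 0 < e / (k + 1))).
  apply: le_trans (H m g mg g01) _.
  have k1 : 0 < k + 1 by rewrite ltr_wpDl.
  apply: (@le_trans _ _ ((k + 1) * (1 / 2 ^+ m))).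
    by rewrite mul1r ler_wpM2r ?invr_ge0 ?exprn_ge0// lerDl.
  by rewrite mulrC -ler_pdivlMr// ltW.
elim: m => [|m IH] {}g mg g01.
  rewrite expr0 divr1 -[k]mulr1; apply: kP => // t; have /andP[g0 g1] := g01 t.
  by rewrite mul1r ger0_norm.
pose A := [set t | 2^-1 <= g t].
have mA : measurable A.
  have -> : A = g @^-1` `[2^-1, +oo[ by apply/seteqP; split => t; rewrite /A/= in_itv/= andbT.
  by rewrite -[X in measurable X]setTI; exact: mg.
have AK : A `<=` K n.
  move=> t /= At; have /andP[_] := g01 t; rewrite indicE.
  by case: (boolP (t \in K n)) => [/set_mem//|_ g0]; have := le_trans At g0; rewrite invr_le0 lern0.
pose g' t := 2 * g t - \1_A t.
have Eg : E g.
  apply: (@test_functionP _ _ _ n 1) => // t; have /andP[g0 g1] := g01 t.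
  by rewrite mul1r ger0_norm.
have EA : E \1_A by exact: test_function_indic AK.
have mg' : measurable_fun setT g'.
  by apply: measurable_funB => //; exact: measurable_funM.
have g'01 t : 0 <= g' t <= \1_(K n) t.
  rewrite /g'; have /andP[g0 g1] := g01 t; move: g1; rewrite !indicE.
  have [tA|tA] := boolP (t \in A).
    have h : 2^-1 <= g t := set_mem tA.
    by rewrite (mem_set (AK _ h))/= => g1; apply/andP; split; lra.
  have : g t < 2^-1 by rewrite ltNge; apply/negP => h; move/negP : tA; apply; exact: mem_set.
  by case: (t \in K n) => /= h g1; apply/andP; split; lra.
have Eg' : E g'.
  apply: (@test_functionP _ _ _ n 1) => // t; have /andP[g0 g1] := g'01 t.
  by rewrite mul1r ger0_norm.
have : D g' = 2 * D g - D \1_A.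
  have -> : g' = (fun t => 2 * g t + (-1 * \1_A t + (fun=> 0) t)).
    by apply/funext => t; rewrite /g' addr0 mulN1r.
  rewrite linD//; last first.
    exact: ((subspace_test_function gamma).2 (-1) \1_A (fun=> 0) EA E0).
  by rewrite linD// D0 addr0 mulN1r.
rewrite (D_indic mA AK) subr0 => Dg'; have := IH g' mg' g'01.
rewrite Dg' normrM ger0_norm// => h.
by rewrite exprS invfM mulrCA ler_pdivlMl.
Qed.

(** The error [D] vanishes on indicators and is bounded for the uniform norm on each window, so
    [D_unit] kills functions between 0 and an indicator. Scaling and splitting into positive and
    negative parts reduce a test function to this case. *)
Theorem test_representation : exists h : R -> R, measurable_fun setT h /\
  forall g : R -> R, E g -> mu.-integrable I (fun t => (g t * h t)%:E) /\
    (L g)%:E = (\int[mu]_(t in I) (g t * h t)%:E)%E.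
Proof.
exists density; split => // g Eg; split; first exact: integrable_test.
suff Dg : D g = 0.
  rewrite -[RHS]fineK; last exact: ifin (integrable_test Eg).
  by congr (_%:E); move/eqP : Dg; rewrite subr_eq0 => /eqP.
have [mg [n [M [M0 gM]]]] := Eg.
(* Brings functions bounded by [M] below 1; the summand 1 covers [M = 0]. *)
pose c := (M + 1)^-1; have c0 : 0 < c by rewrite invr_gt0 ltr_wpDl.
have unit (f : R -> R) : measurable_fun setT f -> (forall t, 0 <= f t <= `|g t|) ->
    D (fun t => c * f t) = 0 /\ E f.
  move=> mf fg; split.
    apply: (@D_unit n); first exact: measurable_funM.
    move=> t; have /andP[f0 f1] := fg t; apply/andP; split.
      by apply: mulr_ge0 => //; exact: ltW.
    rewrite /c ler_pdivrMl ?ltr_wpDl//.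
    by apply: le_trans f1 _; apply: le_trans (gM t) _; rewrite ler_wpM2r// lerDl.
  apply: (@test_functionP _ _ _ n M) => // t; have /andP[f0 f1] := fg t.
  by rewrite ger0_norm//; apply: le_trans f1 _.
have mp : measurable_fun setT (fun t => Num.max (g t) 0) by exact: measurable_maxr.
have mn : measurable_fun setT (fun t => Num.max (- g t) 0).
  by apply: measurable_maxr => //; exact: measurableT_comp.
have [Dp Ep] := unit _ mp
  ltac:(by move=> t; rewrite le_max lexx orbT/= ge_max normr_ge0 andbT ler_norm).
have [Dn En] := unit _ mn
  ltac:(by move=> t; rewrite le_max lexx orbT/= ge_max normr_ge0 andbT -normrN ler_norm).
have DZ (f : R -> R) : E f -> D (fun t => c * f t) = 0 -> D f = 0.
  move=> Ef; rewrite (_ : (fun t => c * f t) = (fun t => c * f t + (fun=> 0) t)); last first.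
    by apply/funext => t; rewrite addr0.
  rewrite linD// D0 addr0 => /eqP; rewrite mulf_eq0 (gt_eqF c0)/=.
  by move=> /eqP.
rewrite (_ : g = (fun t => -1 * Num.max (- g t) 0 + Num.max (g t) 0)); last first.
  apply/funext => t; rewrite mulN1r.
  by have [g0|g0] := leP (g t) 0;
    [rewrite max_l ?oppr_ge0// opprK addr0|rewrite max_r ?oppr_le0 ?ltW// oppr0 add0r].
by rewrite linD// (DZ _ En Dn) (DZ _ Ep Dp) mulr0 addr0.
Qed.

End representation.

(** * Existence of a dual weight *)

Section dual_weight.
Context (R : realType) (gamma : \bar R) (w phi b : R -> R) (c : R).
Local Notation mu := (@lebesgue_measure R).
Local Notation I := (Iset gamma).
Local Notation E := (test_function gamma).
Local Notation K := (window gamma).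
Local Notation W := (weight_integral gamma w).
Local Notation choquet := (choquet gamma w).
Hypothesis gamma_gt0 : (0 < gamma)%E.
Hypothesis hw : weight gamma w.
Hypothesis hphi : orlicz_function phi.

Let mI : measurable I := measurable_Iset gamma.

Lemma choquet_window_le (g : R -> R) n M : 0 <= M -> measurable_fun setT g ->
  (forall t, g t <= M * \1_(K n) t) -> (choquet g <= M%:E * W (mu (K n)))%E.
Proof.
rewrite le_eqVlt => /predU1P[<-|M0] mg gM.
  by rewrite mul0e choquet_le0// => t _; apply: le_trans (gM t) _; rewrite mul0r.
apply: choquet_cst_le => //.
- exact: measurable_window.
- exact: window_sub.
- exact: measurable_funS mg.
Qed.

Lemma weight_window_lty n : (W (mu (K n)) < +oo)%E.
Proof. by apply: weight_integral_lty => //; exact: window_lty. Qed.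

Lemma choquet_test_lty (g : R -> R) : E g -> (choquet g < +oo)%E.
Proof.
move=> [mg [n [M [M0 gM]]]].
apply: (@le_lt_trans _ _ (M%:E * W (mu (K n)))%E).
  by apply: choquet_window_le => // t; exact: le_trans (ler_norm _) (gM t).
by apply: lte_mul_pinfty => //; exact: weight_window_lty.
Qed.

Let pos (g : R -> R) t := Num.max (g t) 0.

Let E_pos g : E g -> E (pos g).
Proof.
move=> [mg [n [M [M0 gM]]]]; apply: (@test_functionP _ _ _ n M).
  exact: measurable_maxr.
move=> t; apply: le_trans (gM t); rewrite /pos.
by have [g0|g0] := leP (g t) 0; rewrite ?normr0.
Qed.

Lemma test_function_measurable (D : set R) (g : R -> R) : E g -> measurable_fun D g.
Proof. by move=> [mg _]; exact: measurable_funS mg. Qed.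

(** Zero on nonpositive functions, so linear functionals below [p] are positive. *)
Let p (g : R -> R) : R := fine (choquet (pos g)).

Let pE g : E g -> (p g)%:E = choquet (pos g).
Proof.
move=> Eg; rewrite /p fineK// ge0_fin_numE; last exact: choquet_ge0 hw _.
by apply: choquet_test_lty; exact: E_pos.
Qed.

Let p_ge0 g : 0 <= p g.
Proof. by apply: fine_ge0; exact: choquet_ge0 hw _. Qed.

Let pD (x y : R -> R) : E x -> E y -> E (fun t => x t + y t) ->
  p (fun t => x t + y t) <= p x + p y.
Proof.
move=> Ex Ey Exy; have me := @test_function_measurable I.
have : (choquet (pos (fun t => x t + y t)%R) <= choquet (pos x) + choquet (pos y))%E.
  apply: (choquet_subadd gamma_gt0 hw).
  - by apply: me; exact: E_pos.
  - by apply: me; exact: E_pos.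
  - by apply: me; exact: E_pos.
  - move=> t _; rewrite /pos ge_max addr_ge0 ?le_max ?lexx ?orbT// andbT.
    by apply: lerD; rewrite le_max lexx.
by rewrite -(pE Exy) -(pE Ex) -(pE Ey) -EFinD lee_fin.
Qed.

Let pZ a (x : R -> R) : 0 < a -> E x -> E (fun t => a * x t) ->
  p (fun t => a * x t) = a * p x.
Proof.
move=> a0 Ex Eax.
have : choquet (pos (fun t => a * x t)) = (a%:E * choquet (pos x))%E.
  have mx : measurable_fun I (pos x) by apply: test_function_measurable; exact: E_pos.
  rewrite -(choquetZ gamma_gt0 hw a0 mx).
  suff -> : pos (fun t => a * x t) = (fun t => a * pos x t) by [].
  by apply/funext => t; rewrite /pos maxr_pMr ?mulr0// ltW.
by rewrite -(pE Eax) -(pE Ex) -EFinM => h; exact: EFin_inj h.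
Qed.

Let p_sublinear : @sublinear R (R -> R^o) E p.
Proof.
split=> [x y Ex Ey|a x a0 Ex].
  exact: (pD Ex Ey (subspaceD (subspace_test_function gamma) Ex Ey)).
exact: (pZ a0 Ex (subspaceZ (subspace_test_function gamma) a Ex)).
Qed.

Lemma test_function_orlicz (f : R -> R) : E f -> (forall t, 0 <= f t) ->
  E (fun t => phi (f t)).
Proof.
move=> Ef f0; have [mf [n [M [M0 fM]]]] := Ef.
apply: (@test_functionP _ _ _ n (phi M)).
  exact: measurable_orlicz_comp.
move=> t; rewrite ger0_norm ?(orlicz_ge0 hphi)//.
have := fM t; rewrite ger0_norm// indicE; case: (t \in K n).
  by rewrite !mulr1; exact: orlicz_le.
rewrite !mulr0 => ft0; rewrite (_ : f t = 0) ?orlicz0//.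
by apply/eqP; rewrite eq_le ft0 f0.
Qed.

Hypothesis mb : measurable_fun setT b.
Hypothesis fb_int : forall f : R -> R, E f -> mu.-integrable I (fun t => (f t * b t)%:E).
Hypothesis young : forall f : R -> R, E f -> (forall t, 0 <= f t) ->
  (\int[mu]_(t in I) (f t * b t)%:E <= c%:E + choquet (fun t => phi (f t)))%E.

Let B (f : R -> R) : R := fine (\int[mu]_(t in I) (f t * b t)%:E)%E.

Let BE f : E f -> (B f)%:E = (\int[mu]_(t in I) (f t * b t)%:E)%E.
Proof.
move=> Ef; rewrite /B fineK//; apply: integrable_fin_num; [exact: mI|exact: fb_int].
Qed.

Let linB (a a' : R) (f g : R -> R) : E f -> E g ->
  B (fun t => a * f t + a' * g t) = a * B f + a' * B g.
Proof.
move=> Ef Eg; apply: EFin_inj; rewrite EFinD !EFinM !BE//; last first.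
  exact: ((subspace_test_function gamma).2 a f _ Ef
    (subspaceZ (subspace_test_function gamma) a' Eg)).
rewrite -integralZl//; last exact: fb_int.
rewrite -integralZl//; last exact: fb_int.
rewrite -integralD//; last 2 first.
- by apply: integrableZl => //; exact: fb_int.
- by apply: integrableZl => //; exact: fb_int.
by apply: eq_integral => t _; rewrite -!EFinM -EFinD mulrDl !mulrA.
Qed.

(** Generated by the pairs of [phi] after [f] and [B f - c]: a linear functional above [C] still
    satisfies the inequality [young] with its own value in place of the Choquet integral. The slack
    in [y] absorbs the convexity inequality when two pairs are added. *)
Let C (y : R -> R^o) (d : R) : Prop := E y /\
  exists l f, [/\ 0 <= l, E f, forall t, 0 <= f t, forall t, l * phi (f t) <= y t &
                  d <= l * (B f - c)].

Let CE y d : C y d -> E y /\ d <= p y.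
Proof.
move=> [Ey [l [f [l0 Ef f0 fy dl]]]]; split => //; apply: le_trans dl _.
have Ephi := test_function_orlicz Ef f0.
move: l0 fy; rewrite le_eqVlt => /predU1P[<- _|l0 fy]; first by rewrite mul0r p_ge0.
rewrite -lee_fin pE//; apply: (@le_trans _ _ (l%:E * choquet (fun t => phi (f t)))%E).
  rewrite EFinM lee_pmul2l ?lte_fin//.
  by rewrite EFinB leeBlDr// addeC BE// young.
have mphi := @test_function_measurable I _ Ephi.
rewrite -(choquetZ gamma_gt0 hw l0 mphi).
apply: le_choquet => //.
- by apply: measurable_funM => //; exact: test_function_measurable.
- by apply: test_function_measurable; exact: E_pos.
- by move=> t _; rewrite /pos le_max fy.
Qed.

Let C0 : C 0 0.
Proof.
have E0 := (subspace_test_function gamma).1.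
split => //; exists 0, (fun=> 0); split => //.
- by move=> t; rewrite mul0r.
- by rewrite mul0r.
Qed.

Let CZ a y d : 0 < a -> C y d -> C (a *: y) (a * d).
Proof.
move=> a0 [Ey [l [f [l0 Ef f0 fy dl]]]].
split; first exact: (subspaceZ (subspace_test_function gamma)).
exists (a * l), f; split => //.
- by apply: mulr_ge0 => //; exact: ltW.
- by move=> t; rewrite -mulrA; apply: ler_wpM2l; [exact: ltW|exact: fy].
- by rewrite -mulrA ler_pM2l.
Qed.

(* Convexity of [phi]: two constraints with multipliers [l], [l'] merge into
   one for the convex combination of [f] and [f']. *)
Let CD y d y' d' : C y d -> C y' d' -> C (y + y') (d + d').
Proof.
move=> [Ey [l [f [l0 Ef f0 fy dl]]]] [Ey' [l' [f' [l'0 Ef' f'0 fy' dl']]]].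
split; first exact: (subspaceD (subspace_test_function gamma)).
have [ll0|ll0] := eqVneq (l + l') 0.
  have lz : l = 0 by lra.
  have l'z : l' = 0 by lra.
  exists 0, f; split => //; last by move: dl dl'; rewrite lz l'z !mul0r; lra.
  move=> t; have := fy t; have := fy' t; rewrite lz l'z !mul0r => h1 h2.
  exact: addr_ge0.
have ll : 0 < l + l' by lra.
pose a := l / (l + l').
have a0 : 0 <= a by apply: divr_ge0 => //; exact: ltW.
have a1 : a <= 1 by rewrite ler_pdivrMr// mul1r lerDl.
have al : a * (l + l') = l by rewrite divfK.
have al' : (1 - a) * (l + l') = l' by rewrite mulrBl al mul1r; lra.
clearbody a.
exists (l + l'), (fun t => a * f t + (1 - a) * f' t); split.
- exact: ltW.
- exact: ((subspace_test_function gamma).2 a f _ Ef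
    (subspaceZ (subspace_test_function gamma) (1 - a) Ef')).
- by move=> t; rewrite addr_ge0// mulr_ge0// subr_ge0.
- move=> t; apply: (@le_trans _ _ (l * phi (f t) + l' * phi (f' t))).
    have -> : l * phi (f t) + l' * phi (f' t) =
        (l + l') * (a * phi (f t) + (1 - a) * phi (f' t)).
      by rewrite mulrDr !mulrA (mulrC (l + l') a) (mulrC (l + l') (1 - a)) al al'.
    by rewrite ler_pM2l//; exact: orlicz_convex.
  by apply: lerD; [exact: fy|exact: fy'].
- rewrite linB//; apply: le_trans (lerD dl dl') _.
  have -> : (l + l') * (a * B f + (1 - a) * B f' - c) =
      l * B f + l' * B f' - (l + l') * c.
    by rewrite mulrBr mulrDr !mulrA (mulrC (l + l') a) (mulrC (l + l') (1 - a)) al al'.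
  by rewrite !mulrBr mulrDl; lra.
Qed.

(* Mazur-Orlicz yields a functional between the cone [C] and the sublinear [p];
   its density, truncated at 0, is the weight [v]. *)
Theorem dual_weight : exists v : R -> R,
  [/\ measurable_fun setT v, forall t, 0 <= v t, submajorized gamma v w &
  forall f : R -> R, E f -> (forall t, 0 <= f t) ->
    (\int[mu]_(t in I) (f t * b t)%:E <= c%:E + \int[mu]_(t in I) (phi (f t) * v t)%:E)%E].
Proof.
have subE := subspace_test_function gamma.
have [L [linL Lp LC]] := mazur_orlicz subE p_sublinear CE C0 CD CZ.
have LN (g : R -> R^o) : E g -> L (- g) = - L g.
  move=> Eg; have := linL (-1) g 0 Eg subE.1; have := linL 1 0 0 subE.1 subE.1.
  by rewrite !scaler0 scaleN1r !addr0; lra.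
have boundL n : exists2 k, 0 <= k & forall M (g : R -> R), 0 <= M ->
    measurable_fun setT g -> (forall t, `|g t| <= M * \1_(K n) t) -> `|L g| <= k * M.
  have k0 : (0 <= W (mu (K n)))%E by exact: weight_integral_ge0 hw _.
  have kfin : W (mu (K n)) \is a fin_num by rewrite ge0_fin_numE// weight_window_lty.
  exists (fine (W (mu (K n)))); first exact: fine_ge0.
  move=> M g M0 mg gM; have Eg := test_functionP mg gM.
  have half (f : R -> R) : E f -> (forall t, f t <= M * \1_(K n) t) ->
      L f <= fine (W (mu (K n))) * M.
    move=> Ef fM; apply: le_trans (Lp _ Ef) _.
    rewrite -lee_fin pE// mulrC EFinM fineK//.
    apply: choquet_window_le => //; first by apply: test_function_measurable; exact: E_pos.
    by move=> t; rewrite /pos ge_max fM mulr_ge0.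
  rewrite ler_norml; apply/andP; split; last first.
    by apply: half => // t; exact: le_trans (ler_norm _) (gM t).
  rewrite lerNl -LN//; apply: half; first exact: subspaceN.
  by move=> t; apply: le_trans (gM t); rewrite -normrN; exact: ler_norm.
have smallL n e : 0 < e -> exists2 d, 0 < d & forall A : set R, measurable A ->
    A `<=` K n -> (mu A <= d%:E)%E -> `|L \1_A| <= e.
  move=> e0; have [d d0 Wd] := weight_integral_cvg0 gamma_gt0 hw e0.
  exists d => // A mA AK Ad.
  have EA : E \1_A by exact: test_function_indic AK.
  have posA : pos \1_A = \1_A by apply/funext => t; rewrite /pos max_l.
  have LA0 : 0 <= L \1_A.
    have EN := subspaceN subE EA.
    rewrite -oppr_le0 -LN//; apply: le_trans (Lp _ EN) _.
    rewrite -lee_fin (pE EN) choquet_le0// => t _.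
    by rewrite /pos max_r// oppr_le0.
  rewrite ger0_norm//; apply: le_trans (Lp _ EA) _; rewrite -lee_fin pE// posA.
  apply: le_trans Wd; apply: le_trans (choquet_indic_le gamma_gt0 hw mA _) _.
    exact: subset_trans AK (@window_sub _ _ _).
  exact: le_weight_integral.
have [v0 [mv0 v0E]] := test_representation linL boundL smallL.
pose v t := Num.max (v0 t) 0.
have mv : measurable_fun setT v by exact: measurable_maxr.
have v_ge0 t : 0 <= v t by rewrite le_max lexx orbT.
pose Q := [set t | 0 < v0 t].
have mQ : measurable Q.
  have -> : Q = v0 @^-1` `]0, +oo[ by apply/seteqP; split => t; rewrite /Q/= in_itv/= andbT.
  by rewrite -[X in measurable X]setTI; exact: mv0.
have vQ t : v t = \1_Q t * v0 t.
  rewrite /v indicE; have [t0|t0] := leP (v0 t) 0.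
    by rewrite memNset ?mul0r// => /= t1; have := lt_le_trans t1 t0; rewrite ltxx.
  by rewrite mem_set// mul1r.
(* Testing [L] with [g * \1_Q] shows that the positive part of its density is still dominated by the
   Choquet integral. *)
have alpha (g : R -> R) : E g -> (forall t, 0 <= g t) ->
    (\int[mu]_(t in I) (g t * v t)%:E <= choquet g)%E.
  move=> Eg g0; have EgQ := test_function_restrict Eg mQ.
  have [_] := v0E _ EgQ; have posQ : pos (fun t => g t * \1_Q t) = (fun t => g t * \1_Q t).
    by apply/funext => t; rewrite /pos max_l// mulr_ge0.
  have -> : (\int[mu]_(t in I) (g t * v t)%:E = \int[mu]_(t in I) (g t * \1_Q t * v0 t)%:E)%E.
    by apply: eq_integral => t _; rewrite vQ mulrA.
  move=> <-; apply: (@le_trans _ _ (p (fun t => g t * \1_Q t))%:E); first by rewrite lee_fin Lp.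
  rewrite (pE EgQ) posQ; apply: (le_choquet hw).
  - exact: test_function_measurable.
  - exact: test_function_measurable.
  - by move=> t _; rewrite ler_piMr// indicE lern1 leq_b1.
exists v; split => //; last first.
  move=> f Ef f0; have Ephi := test_function_orlicz Ef f0.
  have Cf : C (fun t => phi (f t)) (B f - c).
    by split => //; exists 1, f; split => // [t|]; rewrite mul1r.
  have := LC _ _ Cf; rewrite -BE// -lee_fin EFinB leeBlDr// addeC.
  move=> /le_trans; apply; apply: leeD2l.
  have [iphi ->] := v0E _ Ephi.
  apply: le_integral => //.
  - apply/integrableP; split.
      apply/measurable_EFinP; apply: measurable_funM; first exact: test_function_measurable.
      exact: measurable_funS mv.
    apply: le_lt_trans (choquet_test_lty Ephi).
    apply: le_trans (alpha _ Ephi (fun t => orlicz_ge0 hphi (f0 t))).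
    apply: ge0_le_integralW => // t _.
    by rewrite gee0_abs// lee_fin mulr_ge0// orlicz_ge0.
  - by move=> t _; rewrite lee_fin ler_wpM2l ?(orlicz_ge0 hphi)// le_max lexx.
apply: submajorizedP => //; first exact: measurable_funS mv.
move=> t g t0 tg mg g01 gt.
have mgv : measurable_fun I (fun x => (g x * v x)%:E).
  by apply/measurable_EFinP; apply: measurable_funM => //; exact: measurable_funS mv.
(* The functions [g] in [submajorizedP] need not be test functions, so they are cut to windows. *)
have KE : \bigcup_n K n = I.
  apply/seteqP; split => [x [n _ []]//|x Ix].
  by exists (Num.truncn x).+1 => //; exact: window_cover.
have cvK : (\int[mu]_(x in K n) (g x * v x)%:E @[n --> \oo] -->
    \int[mu]_(x in I) (g x * v x)%:E)%E.
  rewrite -KE; apply: ge0_nondecreasing_set_cvg_integral => //.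
  - by move=> m n mn; apply/subsetPset; exact: le_window.
  - by move=> n; exact: measurable_window.
  - by move=> n; apply: measurable_funS mgv => //; exact: window_sub.
  - by move=> n x [Ix _]; rewrite lee_fin mulr_ge0//; case/andP : (g01 x Ix).
rewrite -(cvg_lim _ cvK)//; apply: lime_le; first by apply/cvgP; exact: cvK.
near=> n; pose gn := g \_ (K n).
have Egn : E gn.
  apply: (@test_functionP _ _ _ n 1).
    apply/(measurable_restrictT _ (measurable_window gamma n)).
    by apply: measurable_funS mg => //; exact: window_sub.
  move=> x; rewrite mul1r /gn /patch indicE; case: ifPn => [/set_mem[/g01/andP[h0 h1] _]|_].
    by rewrite ger0_norm.
  by rewrite normr0.
have gn0 x : 0 <= gn x.
  by rewrite /gn /patch; case: ifPn => // /set_mem[/g01/andP[]].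
have gng x : I x -> gn x <= g x.
  by move=> /g01/andP[h0 h1]; rewrite /gn /patch; case: ifPn.
have -> : (\int[mu]_(x in K n) (g x * v x)%:E = \int[mu]_(x in I) (gn x * v x)%:E)%E.
  rewrite /window integral_mkcondr; apply: eq_integral => x Ix.
  rewrite /patch /gn /patch /window in_setI Ix/=.
  by case: ifPn => //; rewrite mul0r.
apply: le_trans (alpha _ Egn gn0) _.
apply: choquet_le_weight_integral => //.
- exact: test_function_measurable.
- by rewrite lee_fin ltW.
- exact: ltW.
- by move=> x Ix; rewrite gn0/=; apply: le_trans (gng x Ix) _; case/andP : (g01 x Ix).
- by apply: le_trans gt; apply: ge0_le_integralW => x Ix; rewrite lee_fin ?gn0// gng.
Unshelve. all: by end_near. Qed.

End dual_weight.

(** * The complementary function and its perspective *)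

Section complementary.
Context (R : realType) (phi : R -> R).
Hypothesis hphi : N_function phi.
Local Notation psi := (complementary phi).

Let ophi : orlicz_function phi. Proof. by case: hphi. Qed.

(** Since [phi u / u] tends to infinity, the terms are at most 0 beyond some [U]. *)
Let has_sup_complementary z : 0 <= z -> has_sup [set u * z - phi u | u in [set u : R | 0 <= u]].
Proof.
move=> z0; split; first by exists (0 * z - phi 0), 0 => //=.
have [_ _ /cvgryPge/(_ z)] := hphi.
move=> [U [_ HU]]; exists (Num.max U 0 * z) => _ [u /= u0 <-].
have U0 : 0 <= Num.max U 0 by rewrite le_max lexx orbT.
have [uU|Uu] := leP u (Num.max U 0).
  have := ler_wpM2r z0 uU; have := orlicz_ge0 ophi u0; lra.
have {}Uu' : U < u by apply: le_lt_trans Uu; rewrite le_max lexx.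
have u_gt0 : 0 < u by exact: le_lt_trans Uu.
have := HU u Uu'; rewrite ler_pdivlMr// mulrC => h.
have := mulr_ge0 U0 z0; lra.
Qed.

Lemma complementary_ge u z : 0 <= u -> 0 <= z -> u * z - phi u <= psi z.
Proof. by move=> u0 z0; apply: ub_le_sup (has_sup_complementary z0).2 _ _; exists u. Qed.

Lemma complementary_le z b : (forall u, 0 <= u -> u * z - phi u <= b) -> psi z <= b.
Proof.
move=> H; apply: ge_sup; first by exists (0 * z - phi 0), 0 => //=.
by move=> _ [u /= u0 <-]; exact: H.
Qed.

(** With [perspective_le] this identifies the perspective as the supremum over [u >= 0] of
    [u * |x| - phi u * v]; its convention at [v = 0] is the value of that supremum. *)
Lemma young_perspective u x v : 0 <= u -> 0 <= v ->
  ((u * `|x| - phi u * v)%:E <= perspective psi x v)%E.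
Proof.
move=> u0 v0; rewrite /perspective; have [->|vn0] := eqVneq v 0.
  by have [->|_] := eqVneq x 0; rewrite ?leey// normr0 !mulr0 subr0.
have v_gt0 : 0 < v by rewrite lt_def vn0.
rewrite lee_fin -ler_pdivrMr// mulrBl mulfK// -mulrA.
by apply: complementary_ge => //; exact: divr_ge0.
Qed.

Lemma perspective_le x v (B : \bar R) : 0 <= v ->
  (forall u, 0 <= u -> ((u * `|x| - phi u * v)%:E <= B)%E) ->
  (perspective psi x v <= B)%E.
Proof.
move=> v0 H; have B0 : (0 <= B)%E by have := H 0 (lexx _); rewrite !mul0r orlicz0// mul0r subr0.
case: B H B0 => [b||//] H B0; last by rewrite leey.
rewrite /perspective; have [vE|vn0] := eqVneq v 0.
  have [//|xn0] := eqVneq x 0; exfalso.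
  have x0 : 0 < `|x| by rewrite normr_gt0.
  have b0 : 0 <= b by rewrite lee_fin in B0.
  have b1 : 0 <= (b + 1) / `|x| by apply: divr_ge0 => //; apply: addr_ge0.
  have := H _ b1; rewrite vE mulr0 subr0 divfK ?gt_eqF// lee_fin; lra.
have v_gt0 : 0 < v by rewrite lt_def vn0.
rewrite lee_fin -ler_pdivlMr//; apply: complementary_le => u u0.
have := H u u0; rewrite lee_fin => h.
by rewrite ler_pdivlMr// mulrBl -mulrA divfK.
Qed.

Lemma perspective_ge0 x v : 0 <= v -> (0 <= perspective psi x v)%E.
Proof.
move=> v0; have := young_perspective x (lexx 0) v0.
by rewrite orlicz0// !mul0r subr0.
Qed.

(** Enumerates the nonnegative rationals. A countable family of [u] makes the perspective measurable
    and allows near-maximizers to be chosen measurably. *)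
Definition nneg_rat (n : nat) : R := `|ratr (odflt 0 (unpickle n : option rat))|.

Lemma nneg_ratP (q : rat) : exists n, nneg_rat n = `|ratr q|.
Proof. by exists (pickle q); rewrite /nneg_rat pickleK. Qed.

(** Replacing [u] by a rational slightly below it can only lower [phi u], and costs at most [e] in
    [u * |x|]. *)
Lemma perspective_le_rat x v (B : \bar R) : 0 <= v ->
  (forall n, ((nneg_rat n * `|x| - phi (nneg_rat n) * v)%:E <= B)%E) ->
  (perspective psi x v <= B)%E.
Proof.
move=> v0 H; apply: perspective_le => // u; rewrite le_eqVlt => /predU1P[<-|u0].
  by have [n] := nneg_ratP 0; rewrite rmorph0 normr0 => nE; have := H n; rewrite nE.
apply/lee_addgt0Pr => e e0.
have x1 : 0 < `|x| + 1 by rewrite ltr_wpDl.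
have ex : 0 < e / (`|x| + 1) by exact: divr_gt0.
have lt_u : Num.max 0 (u - e / (`|x| + 1)) < u by rewrite gt_max u0 gtrBl.
have [q] := rat_in_itvoo lt_u; rewrite in_itv/= gt_max => /andP[/andP[q0 qe] qu].
have [n] := nneg_ratP q; rewrite gtr0_norm// => nE; have := H n; rewrite nE => Hn.
apply: le_trans (leeD2r e%:E Hn); rewrite -EFinD lee_fin.
have := ler_wpM2r v0 (orlicz_le ophi (ltW q0) (ltW qu)).
have h : (u - ratr q) * (`|x| + 1) <= e by rewrite -ler_pdivlMr//; lra.
have : (u - ratr q) * `|x| <= (u - ratr q) * (`|x| + 1).
  by apply: ler_wpM2l; lra.
lra.
Qed.

Lemma measurable_perspective d (T : measurableType d) (D : set T) (x v : T -> R) :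
  measurable D -> measurable_fun D x -> measurable_fun D v -> (forall t, D t -> 0 <= v t) ->
  measurable_fun D (fun t => perspective psi (x t) (v t)).
Proof.
move=> mD mx mv v0.
pose G n t : \bar R := (nneg_rat n * `|x t| - phi (nneg_rat n) * v t)%:E.
apply: (eq_measurable_fun (fun t => esups (G ^~ t) 0)).
  move=> t /set_mem Dt; apply/eqP; rewrite eq_le; apply/andP; split.
    by apply: ge_ereal_sup => _ [n _ <-]; apply: young_perspective; rewrite ?v0// /nneg_rat.
  apply: perspective_le_rat; first exact: v0.
  by move=> n; apply: ereal_sup_ubound; exists n.
apply: measurable_fun_esups => n; apply/measurable_EFinP.
apply: measurable_funB; apply: measurable_funM => //.
exact: measurableT_comp.
Qed.

End complementary.

(** * From the dual weight to a bound on the [P]-modular *)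

Section dual_modular.
Context (R : realType) (gamma : \bar R) (w phi x : R -> R) (c : R).
Local Notation mu := (@lebesgue_measure R).
Local Notation I := (Iset gamma).
Local Notation E := (test_function gamma).
Local Notation K := (window gamma).
Local Notation choquet := (choquet gamma w).
Local Notation psi := (complementary phi).
Hypothesis gamma_gt0 : (0 < gamma)%E.
Hypothesis hw : weight gamma w.
Hypothesis hphi : N_function phi.
Hypothesis mx : measurable_fun setT x.
Hypothesis fx_int : forall f : R -> R, E f -> mu.-integrable I (fun t => (f t * `|x t|)%:E).
Hypothesis young : forall f : R -> R, E f -> (forall t, 0 <= f t) ->
  (\int[mu]_(t in I) (f t * `|x t|)%:E <= c%:E + choquet (fun t => phi (f t)))%E.

Let ophi : orlicz_function phi. Proof. by case: hphi. Qed.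

(* [best v n t] maximizes [u |x t| - phi u * v t] among [u = 0] and the first
   [n] rationals; the supremum over all [n] is the perspective. *)
Let best (v : R -> R) := fix best (n : nat) (t : R) : R :=
  if n is m.+1 then
    if best m t * `|x t| - phi (best m t) * v t <
       nneg_rat R m * `|x t| - phi (nneg_rat R m) * v t
    then nneg_rat R m else best m t
  else 0.

Let best_ge0 v n t : 0 <= best v n t.
Proof. by elim: n => //= n IH; case: ifP => // _; exact: normr_ge0. Qed.

Let best_le v n : exists2 M, 0 <= M & forall t, best v n t <= M.
Proof.
elim: n => [|n [M M0 HM]]; first by exists 0.
exists (M + nneg_rat R n); first by rewrite addr_ge0// normr_ge0.
move=> t /=; case: ifP => _; first by rewrite lerDr.
by apply: le_trans (HM t) _; rewrite lerDl normr_ge0.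
Qed.

Let measurable_best v n : measurable_fun setT v -> measurable_fun setT (best v n).
Proof.
move=> mv; elim: n => [|n IH]; first exact: measurable_cst.
apply: measurable_fun_ifT => //; first apply: measurable_fun_ltr.
- apply: measurable_funB; apply: measurable_funM => //.
    exact: measurableT_comp.
  apply: measurable_orlicz_comp => // t _; exact: best_ge0.
- apply: measurable_funB; apply: measurable_funM => //.
  exact: measurableT_comp.
Qed.

Let value v n t := best v n t * `|x t| - phi (best v n t) * v t.

Let valueS v n t : value v n t <= value v n.+1 t /\
  nneg_rat R n * `|x t| - phi (nneg_rat R n) * v t <= value v n.+1 t.
Proof.
rewrite {2 3}/value /=; case: ifP => [h|/negbT]; first by split => //; exact: ltW.
by rewrite -leNgt => h; split.
Qed.

Let value_nd v m n t : (m <= n)%N -> value v m t <= value v n t.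
Proof.
move=> /subnK <-; elim: (n - m)%N => //= k IH.
exact: le_trans IH (valueS v _ t).1.
Qed.

Let value_ge0 v n t : 0 <= value v n t.
Proof.
apply: le_trans (value_nd v t (leq0n n)).
by rewrite /value/= orlicz0// !mul0r subr0.
Qed.

(** Cut to the window [K n], [best v n] is a test function to which [dual_weight] applies. The
    values increase to the perspective, so monotone convergence moves the supremum inside the
    integral. *)
Theorem P_modular_le : (P_modular gamma psi w x <= c%:E)%E.
Proof.
have mI := measurable_Iset gamma.
have mnx : measurable_fun setT (fun t => `|x t|) by exact: measurableT_comp.
have [v [mv v0 vw vP]] :=
  dual_weight (b := fun t => `|x t|) gamma_gt0 hw ophi fx_int young.
have admissible : [/\ L0 gamma v, forall t, Iset gamma t -> 0 <= v t & submajorized gamma v w].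
  by split => //; exact: measurable_funS mv.
apply: (@le_trans _ _ (\int[mu]_(t in I) perspective psi (x t) (v t))%E).
  by apply: ereal_inf_lbound; exists v.
pose g n t : \bar R := (value v n t * \1_(K n) t)%:E.
have mval n : measurable_fun setT (value v n).
  apply: measurable_funB; apply: measurable_funM => //; first exact: measurable_best.
  by apply: measurable_orlicz_comp => //; exact: measurable_best.
have mg n : measurable_fun I (g n).
  apply/measurable_EFinP; apply: measurable_funM.
    exact: measurable_funS (mval n).
  by apply: measurable_indic; exact: measurable_window.
have g0 n t : I t -> (0 <= g n t)%E by move=> _; rewrite lee_fin mulr_ge0.
have g_nd t : I t -> {homo g ^~ t : n m / (n <= m)%N >-> (n <= m)%E}.
  move=> _ m n mn; rewrite lee_fin; apply: ler_pM => //; first exact: value_nd.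
  rewrite !indicE ler_nat; case: (boolP (t \in K m)) => //.
  by move=> /set_mem/(le_window mn) h; rewrite mem_set.
apply: (@le_trans _ _ (\int[mu]_(t in I) limn (g ^~ t))%E).
  apply: ge0_le_integralW => t It; first exact: perspective_ge0.
  apply: perspective_le_rat => // n.
  have [N nN KN] : exists2 N, (n < N)%N & K N t.
    exists (maxn n.+1 (Num.truncn t).+1); first exact: leq_maxl.
    by apply: le_window (window_cover It); exact: leq_maxr.
  apply: (@le_trans _ _ (g N t)).
    rewrite /g indicE mem_set// mulr1 lee_fin.
    exact: le_trans (valueS v n t).2 (value_nd v t nN).
  rewrite (cvg_lim _ (ereal_nondecreasing_cvgn (g_nd t It)))//.
  by apply: ereal_sup_ubound; exists N.
rewrite (monotone_convergence mu mI mg g0 g_nd).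
apply: lime_le.
  apply: ereal_nondecreasing_is_cvgn => m n mn; apply: ge0_le_integralW => t It.
    exact: g0.
  exact: g_nd.
near=> n; pose f t := best v n t * \1_(K n) t.
have mf : measurable_fun setT f.
  apply: measurable_funM; first exact: measurable_best.
  by apply: measurable_indic; exact: measurable_window.
have f0 t : 0 <= f t by rewrite mulr_ge0.
have Ef : E f.
  have [M M0 HM] := best_le v n; apply: (@test_functionP _ _ _ n M) => // t.
  by rewrite ger0_norm// ler_wpM2r.
have Ephi := test_function_orlicz ophi Ef f0.
have := vP f Ef f0.
have mphi := @test_function_measurable _ _ I _ Ephi.
have mvI : measurable_fun I v by exact: measurable_funS mv.
(* Finiteness allows this integral to be moved to the other side. *)
have phiv_fin : (\int[mu]_(t in I) (phi (f t) * v t)%:E < +oo)%E.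
  apply: le_lt_trans (choquet_test_lty gamma_gt0 hw Ephi).
  apply: (integralM_le_choquet mphi mvI) => [t _|t _|A mA AI]; first exact: orlicz_ge0.
    exact: v0.
  exact: (submajorized_integral_le gamma_gt0 hw mvI _ vw mA AI).
have phiv_int : mu.-integrable I (fun t => (phi (f t) * v t)%:E).
  apply/integrableP; split.
    by apply/measurable_EFinP; exact: measurable_funM mphi mvI.
  apply: le_lt_trans phiv_fin; apply: ge0_le_integralW => // t _.
  by rewrite gee0_abs// lee_fin mulr_ge0// orlicz_ge0.
rewrite addeC -leeBlDl; last first.
  by apply: integrable_fin_num; [exact: mI|exact: phiv_int].
rewrite -integralB_EFin//; last exact: fx_int.
congr (_ <= _)%E; apply: eq_integral => t _.
rewrite -EFinB /g /f /value indicE; case: (t \in K n); first by rewrite !mulr1.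
by rewrite !mulr0 orlicz0// !mul0r subr0.
Unshelve. all: by end_near. Qed.

End dual_modular.

(** * Modular and Luxemburg norm *)

Section luxemburg.
Context (R : realType) (gamma : \bar R) (phi w : R -> R).
Local Notation mu := (@lebesgue_measure R).
Local Notation I := (Iset gamma).
Local Notation E := (test_function gamma).
Local Notation K := (window gamma).
Local Notation W := (weight_integral gamma w).
Local Notation choquet := (choquet gamma w).
Local Notation rho := (modular gamma phi w).
Local Notation norm := (luxemburg_norm gamma phi w).
Local Notation X := (Lambda gamma phi w).
Hypothesis gamma_gt0 : (0 < gamma)%E.
Hypothesis hw : weight gamma w.
Hypothesis ophi : orlicz_function phi.

Let mI : measurable I := measurable_Iset gamma.

Lemma measurable_phi_norm (f : R -> R) : L0 gamma f ->
  measurable_fun I (fun t => phi `|f t|).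
Proof. by move=> mf; apply: measurable_orlicz_comp => //; exact: measurableT_comp. Qed.

Lemma modular_ge0 f : L0 gamma f -> (0 <= rho f)%E.
Proof. by move=> mf; rewrite (modularE hw ophi mf); exact: choquet_ge0 hw _. Qed.

Lemma modular_le (f g : R -> R) : L0 gamma f -> L0 gamma g ->
  (forall t, I t -> `|f t| <= `|g t|) -> (rho f <= rho g)%E.
Proof.
move=> mf mg fg; rewrite (modularE hw ophi mf) (modularE hw ophi mg).
apply: (le_choquet hw (measurable_phi_norm mf) (measurable_phi_norm mg)) => t It.
by apply: orlicz_le => //; exact: fg.
Qed.

Lemma modular_subadd (u f g : R -> R) : L0 gamma u -> L0 gamma f -> L0 gamma g ->
  (forall t, I t -> phi `|u t| <= phi `|f t| + phi `|g t|) -> (rho u <= rho f + rho g)%E.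
Proof.
move=> mu_ mf mg ufg.
rewrite (modularE hw ophi mu_) (modularE hw ophi mf) (modularE hw ophi mg).
exact: (choquet_subadd gamma_gt0 hw (measurable_phi_norm mu_) (measurable_phi_norm mf)
  (measurable_phi_norm mg)).
Qed.

Lemma L0_scale c (f : R -> R) : L0 gamma f -> L0 gamma (fun t => c * f t).
Proof. by move=> mf; exact: measurable_funM. Qed.

Lemma L0_div c (f : R -> R) : L0 gamma f -> L0 gamma (fun t => f t / c).
Proof. by move=> mf; exact: measurable_funM. Qed.

Lemma modular_scale c (f : R -> R) : L0 gamma f -> 0 < c -> c <= 1 ->
  (rho (fun t => c * f t)%R <= c%:E * rho f)%E.
Proof.
move=> mf c0 c1; have mcf := @L0_scale c _ mf.
rewrite (modularE hw ophi mf) (modularE hw ophi mcf).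
rewrite -(choquetZ gamma_gt0 hw c0 (measurable_phi_norm mf)).
apply: (le_choquet hw (measurable_phi_norm mcf)).
  by apply: measurable_funM => //; exact: measurable_phi_norm.
by move=> t _; rewrite normrM gtr0_norm//; apply: orlicz_scale => //; exact: ltW.
Qed.

Lemma luxemburg_le f e : 0 < e -> (rho (fun t => f t / e)%R <= 1)%E -> (norm f <= e%:E)%E.
Proof. by move=> e0 h; apply: ereal_inf_lbound; exists e. Qed.

Lemma luxemburg_ge0 f : (0 <= norm f)%E.
Proof. by apply: le_ereal_inf_tmp => _ [e [e0 _] <-]; rewrite lee_fin ltW. Qed.

(** The strict inequality provides an admissible [d < e], so the infimum need not be attained; norm
    at most 1 is later handled through factors [e > 1]. *)
Lemma luxemburg_lt f e : L0 gamma f -> (norm f < e%:E)%E ->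
  (rho (fun t => f t / e)%R <= 1)%E.
Proof.
move=> mf /ereal_inf_lt[_ [d [d0 hd] <-]]; rewrite lte_fin => de.
apply: le_trans hd; apply: modular_le; [exact: L0_div|exact: L0_div|].
move=> t _; rewrite !normrM ler_wpM2l//.
rewrite !gtr0_norm ?invr_gt0//; last exact: lt_trans de.
by rewrite lef_pV2 ?posrE//; [exact: ltW|exact: lt_trans de].
Qed.

Lemma LambdaS (f g : R -> R) : X g -> L0 gamma f ->
  (forall t, I t -> `|f t| <= `|g t|) -> X f.
Proof.
move=> [mg [l l0 lg]] mf fg; split; first exact: mf.
exists l; first exact: l0.
apply: le_lt_trans lg.
apply: modular_le; [exact: L0_scale|exact: L0_scale|].
by move=> t It; rewrite !normrM ler_wpM2l// fg.
Qed.

Lemma Lambda_luxemburg f : X f -> exists2 e, 0 < e & (rho (fun t => f t / e)%R <= 1)%E.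
Proof.
move=> [mf [l l0 lf]]; have r0 := modular_ge0 (@L0_scale l _ mf).
have rfin : rho (fun t => l * f t) \is a fin_num by rewrite ge0_fin_numE.
set r := fine (rho (fun t => l * f t)).
have r_ge0 : 0 <= r by exact: fine_ge0.
(* By convexity, scaling by [c] brings the modular down to [r / (1 + r)]. *)
pose c := (1 + r)^-1; have r1 : 0 < 1 + r by rewrite ltr_pwDl.
have c0 : 0 < c by rewrite invr_gt0.
have c1 : c <= 1 by rewrite invf_le1// lerDl.
exists (c * l)^-1; first by rewrite invr_gt0 mulr_gt0.
have -> : (fun t => f t / (c * l)^-1) = (fun t => c * (l * f t)).
  by apply/funext => t; rewrite invrK mulrC mulrA.
apply: le_trans (modular_scale (@L0_scale l _ mf) c0 c1) _.
rewrite -(fineK rfin) -/r -EFinM lee_fin /c mulrC ler_pdivrMr// mul1r lerDr//.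
Qed.

Lemma luxemburg_test n : exists2 k, 0 < k & forall M (g : R -> R), 0 < M ->
  measurable_fun setT g -> (forall t, `|g t| <= M * \1_(K n) t) ->
  (rho (fun t => g t / (k * M))%R <= 1)%E.
Proof.
have W0 : (0 <= W (mu (K n)))%E by exact: weight_integral_ge0 hw _.
have Wfin : W (mu (K n)) \is a fin_num.
  by rewrite ge0_fin_numE// (weight_window_lty gamma_gt0 hw n).
set b := fine (W (mu (K n))); have b0 : 0 <= b by exact: fine_ge0.
have p0 : 0 <= phi 1 by exact: orlicz_ge0.
(* The constant [k = 1 + phi 1 * b] is at least 1, whence [phi (1 / k) <= phi 1 / k], and at least
   [phi 1 * b], whence the modular is at most 1. *)
have k1 : 1 <= 1 + phi 1 * b by rewrite lerDl mulr_ge0.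
have k0 : 0 < 1 + phi 1 * b by exact: lt_le_trans k1.
exists (1 + phi 1 * b) => // M g M0 mg gM; set k := 1 + phi 1 * b in k1 k0 *.
have ki0 : 0 <= k^-1 by rewrite invr_ge0 ltW.
have mgI : L0 gamma g by exact: measurable_funS mg.
rewrite (modularE hw ophi (@L0_div _ _ mgI)).
have le1 t : phi `|g t / (k * M)| <= phi k^-1 * \1_(K n) t.
  have h : `|g t / (k * M)| <= k^-1 * \1_(K n) t.
    have kM0 : 0 < k * M by exact: mulr_gt0.
    rewrite normrM (gtr0_norm (ltac:(by rewrite invr_gt0) : 0 < (k * M)^-1)).
    rewrite ler_pdivrMr//; have -> : k^-1 * \1_(K n) t * (k * M) = M * \1_(K n) t.
      by rewrite mulrACA mulrA mulVf ?gt_eqF// mul1r mulrC.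
    exact: gM.
  move: h; rewrite indicE; case: (t \in K n); rewrite ?mulr1 ?mulr0 => h.
    exact: orlicz_le.
  have /eqP -> : `|g t / (k * M)| == 0 by rewrite eq_le h normr_ge0.
  by rewrite orlicz0.
have mphi : measurable_fun setT (fun t => phi `|g t / (k * M)|).
  apply: measurable_orlicz_comp => //; apply: measurableT_comp => //.
  exact: measurable_funM.
have H := choquet_window_le gamma_gt0 hw (orlicz_ge0 ophi ki0) mphi le1.
apply: le_trans H _.
rewrite -(fineK Wfin) -/b -EFinM lee_fin.
have h1 : phi k^-1 <= k^-1 * phi 1.
  by rewrite -{1}[k^-1]mulr1; apply: orlicz_scale => //; rewrite invf_le1.
apply: le_trans (ler_wpM2r b0 h1) _.
by rewrite -mulrA ler_pdivrMl// mulr1 /k lerDr.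
Qed.

Lemma luxemburg_small e : 0 < e -> exists2 d, 0 < d & forall A : set R,
  measurable A -> A `<=` I -> (mu A <= d%:E)%E -> (rho (fun t => \1_A t / e)%R <= 1)%E.
Proof.
move=> e0; have p0 : 0 < phi e^-1 by case: ophi => _ _; apply; rewrite invr_gt0.
have pi0 : 0 < (phi e^-1)^-1 by rewrite invr_gt0.
have [d d0 Wd] := weight_integral_cvg0 gamma_gt0 hw pi0.
exists d => // A mA AI Ad.
have mA1 : L0 gamma (\1_A : R -> R) by exact: measurable_indic.
rewrite (modularE hw ophi (@L0_div _ _ mA1)).
have le1 t : I t -> phi `|\1_A t / e| <= phi e^-1 * \1_A t.
  move=> _; rewrite indicE; case: (t \in A); last by rewrite mul0r normr0 orlicz0// mulr0.
  by rewrite mul1r mulr1 gtr0_norm// invr_gt0.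
have mphi := measurable_phi_norm (@L0_div e _ mA1).
apply: le_trans (choquet_cst_le gamma_gt0 hw mA AI mphi p0 le1) _.
apply: (@le_trans _ _ ((phi e^-1)%:E * (phi e^-1)^-1%:E)%E).
  rewrite lee_pmul2l ?lte_fin//; apply: le_trans Wd.
  exact: le_weight_integral.
by rewrite -EFinM mulfV ?gt_eqF.
Qed.

Lemma Lambda_test g : E g -> X g.
Proof.
move=> Eg; have [mg [n [M [M0 gM]]]] := Eg.
have [k k0 kP] := luxemburg_test n; have M1 : 0 < M + 1 by rewrite ltr_wpDl.
split; first exact: measurable_funS mg.
exists (k * (M + 1))^-1; first by rewrite invr_gt0 mulr_gt0.
rewrite (_ : (fun t => _) = (fun t => g t / (k * (M + 1)))); last first.
  by apply/funext => t; rewrite mulrC.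
apply: le_lt_trans (kP _ g M1 mg _) _; last exact: ltry.
by move=> t; apply: le_trans (gM t) _; rewrite ler_wpM2r// lerDl.
Qed.

Lemma integralM_le_modular (v f : R -> R) : L0 gamma v ->
  (forall t, I t -> 0 <= v t) -> submajorized gamma v w -> L0 gamma f ->
  (\int[mu]_(t in I) (phi `|f t| * v t)%:E <= rho f)%E.
Proof.
move=> mv v0 vw mf; rewrite (modularE hw ophi mf).
apply: (integralM_le_choquet (measurable_phi_norm mf) mv) => [t _|t|A mA AI].
- exact: orlicz_ge0.
- exact: v0.
- exact: (submajorized_integral_le gamma_gt0 hw mv v0 vw mA AI).
Qed.

End luxemburg.

(** * Bounded functionals on the Orlicz-Lorentz space *)

Section core.
Context (R : realType) (gamma : \bar R).
Local Notation I := (Iset gamma).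
Local Notation E := (test_function gamma).
Local Notation K := (window gamma).

Let mI : measurable I := measurable_Iset gamma.

Definition core (f : R -> R) (n : nat) : set R := K n `&` [set t | `|f t| <= n%:R].

Lemma measurable_core f n : measurable_fun I f -> measurable (core f n).
Proof.
move=> mf; have mnf : measurable_fun I (fun t => `|f t|) by exact: measurableT_comp.
have := mnf mI _ (measurable_itv `]-oo, n%:R]) => h.
have -> : core f n = K n `&` (I `&` (fun t => `|f t|) @^-1` `]-oo, n%:R]).
  apply/seteqP; split => t.
    by move=> [Kt ft]; split => //; split; [case: Kt|rewrite /= in_itv].
  by move=> [Kt [_]]; rewrite /= in_itv/=.
by apply: measurableI => //; exact: measurable_window.
Qed.

Lemma le_core f m n : (m <= n)%N -> core f m `<=` core f n.
Proof.
move=> mn t [Kt /= ft]; split; first exact: le_window Kt.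
by rewrite /= (le_trans ft)// ler_nat.
Qed.

Lemma core_sub f n : core f n `<=` I.
Proof. by move=> t [[]]. Qed.

Lemma bigcup_core f : \bigcup_n core f n = I.
Proof.
apply/seteqP; split => [t [n _ /core_sub]//|t It].
exists (maxn (Num.truncn t).+1 (Num.truncn `|f t|).+1) => //; split => /=.
  by apply: le_window (window_cover It); exact: leq_maxl.
apply: (@le_trans _ _ (Num.truncn `|f t|).+1%:R).
  by apply: ltW; exact: Num.Theory.truncnS_gt.
by rewrite ler_nat leq_maxr.
Qed.

Lemma test_function_core (f u : R -> R) n : measurable_fun I f -> measurable_fun I u ->
  (forall t, I t -> `|f t| <= `|u t|) -> E (f \_ (core u n)).
Proof.
move=> mf mu fu; have mc := measurable_core n mu.
apply: (@test_functionP _ _ _ n n%:R).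
  by apply/(measurable_restrictT _ mc); apply: measurable_funS mf => //; exact: core_sub.
move=> t; rewrite /patch indicE; case: ifPn => [/set_mem[Kt ut]|_].
  by rewrite mem_set// mulr1; apply: le_trans ut; apply: fu; case: Kt.
by rewrite normr0 mulr_ge0.
Qed.

End core.

Section functional.
Context (R : realType) (gamma : \bar R) (phi w : R -> R) (F : (R -> R) -> R).
Local Notation mu := (@lebesgue_measure R).
Local Notation I := (Iset gamma).
Local Notation E := (test_function gamma).
Local Notation K := (window gamma).
Local Notation rho := (modular gamma phi w).
Local Notation norm := (luxemburg_norm gamma phi w).
Local Notation X := (Lambda gamma phi w).
Hypothesis gamma_gt0 : (0 < gamma)%E.
Hypothesis hw : weight gamma w.
Hypothesis ophi : orlicz_function phi.
Hypothesis hF : bounded_linear_functional gamma phi w F.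

Let mI : measurable I := measurable_Iset gamma.

Lemma functional_eq (f g : R -> R) : X f -> X g ->
  (forall t, I t -> f t = g t) -> F f = F g.
Proof. by case: hF => h _ _ Xf Xg fg; apply: h => //; exact: aeW. Qed.

Lemma functional_lin (a : R) (f g : R -> R) : X f -> X g ->
  F (fun t => a * f t + g t) = a * F f + F g.
Proof. by case: hF => _ h _; exact: h. Qed.

(** Boundedness on the modular unit ball, with a real [e] in place of the extended norm; this form
    is used throughout. *)
Lemma functional_bound : exists2 c, 0 < c & forall f e, X f -> 0 < e ->
  (rho (fun t => f t / e)%R <= 1)%E -> `|F f| <= c * e.
Proof.
case: hF => _ _ [c cF]; exists (`|c| + 1); first by rewrite ltr_wpDl.
move=> f e Xf e0 fe; have ne := luxemburg_le e0 fe.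
have n0 := luxemburg_ge0 gamma phi w f.
have nfin : norm f \is a fin_num by rewrite ge0_fin_numE// (le_lt_trans ne)// ltry.
have := cF f Xf; rewrite -(fineK nfin) -EFinM lee_fin => h.
move: ne n0; rewrite -(fineK nfin) !lee_fin => ne n0.
apply: le_trans h _; apply: (@le_trans _ _ ((`|c| + 1) * fine (norm f))).
  by apply: ler_wpM2r => //; apply: le_trans (ler_norm c) _; rewrite lerDl.
by apply: ler_wpM2l => //; rewrite addr_ge0.
Qed.

Lemma functional_split (f : R -> R) (A : set R) : X f -> measurable A -> A `<=` I ->
  [/\ X (f \_ A), X (f \_ (I `\` A)) & F f = F (f \_ A) + F (f \_ (I `\` A))].
Proof.
move=> Xf mA AI; have mf := Xf.1.
have XB (B : set R) : measurable B -> B `<=` I -> X (f \_ B).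
  move=> mB BI; apply: (LambdaS hw ophi Xf).
    apply/(measurable_restrict f mB mI).
    exact: (measurable_funS mI (@subIsetl _ _ _) mf).
  by move=> t _; rewrite /patch; case: ifPn => //; rewrite normr0.
have XA := XB _ mA AI; have XD := XB _ (measurableD mI mA) (@subDsetl _ _ _).
have fE t : I t -> f t = 1 * (f \_ A) t + (f \_ (I `\` A)) t.
  move=> It; rewrite mul1r /patch in_setD (mem_set It)/=.
  by case: (t \in A) => /=; rewrite ?addr0 ?add0r.
have Xs : X (fun t => 1 * (f \_ A) t + (f \_ (I `\` A)) t).
  apply: (LambdaS hw ophi Xf).
    apply: measurable_funD; last exact: XD.1.
    by apply: measurable_funM; [exact: measurable_cst|exact: XA.1].
  by move=> t It; rewrite -fE.
split; [exact: XA|exact: XD|].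
by rewrite -[F (f \_ A)]mul1r -(functional_lin 1 XA XD); exact: functional_eq Xf Xs fE.
Qed.

(** The estimate makes [f * h] integrable for every [f] in [Lambda]. On a core, the integral of
    [|f h|] is the value of [F] at a test function with the sign of [f h] built in, whose modulus is
    at most [|f|]. *)
Theorem functional_density c : 0 < c ->
  (forall f e, X f -> 0 < e -> (rho (fun t => f t / e)%R <= 1)%E -> `|F f| <= c * e) ->
  exists h : R -> R, [/\ measurable_fun setT h,
  forall f e, X f -> 0 < e -> (rho (fun t => f t / e)%R <= 1)%E ->
    (\int[mu]_(t in I) `|(f t * h t)%:E| <= (c * e)%:E)%E &
  forall g, E g -> (F g)%:E = (\int[mu]_(t in I) (g t * h t)%:E)%E].
Proof.
move=> c0 cP.
have linF a (f g : R -> R) : E f -> E g -> F (fun t => a * f t + g t) = a * F f + F g.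
  by move=> Ef Eg; apply: functional_lin; exact: (Lambda_test gamma_gt0 hw ophi).
have boundF n : exists2 k, 0 <= k & forall M (g : R -> R), 0 <= M ->
    measurable_fun setT g -> (forall t, `|g t| <= M * \1_(K n) t) -> `|F g| <= k * M.
  have [k k0 kP] := luxemburg_test gamma_gt0 hw ophi n.
  exists (c * k); first by rewrite mulr_ge0// ltW.
  move=> M g M0 mg gM; have Xg := Lambda_test gamma_gt0 hw ophi (test_functionP mg gM).
  (* [luxemburg_test] asks for a positive bound, so [M] is enlarged by an amount that costs [e]. *)
  apply/ler_addgt0Pr => e e0; pose M' := M + e / (c * k).
  have M'0 : 0 < M' by rewrite ltr_wpDl// divr_gt0// mulr_gt0.
  have gM' t : `|g t| <= M' * \1_(K n) t.
    by apply: le_trans (gM t) _; rewrite ler_wpM2r// lerDl divr_ge0 ?ltW// mulr_gt0.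
  have kM' : 0 < k * M' by exact: mulr_gt0.
  apply: le_trans (cP g _ Xg kM' (kP M' g M'0 mg gM')) _.
  rewrite mulrA /M' mulrDr lerD2l mulrC divfK// gt_eqF// mulr_gt0//.
have smallF n e : 0 < e -> exists2 d, 0 < d & forall A : set R, measurable A ->
    A `<=` K n -> (mu A <= d%:E)%E -> `|F \1_A| <= e.
  move=> e0; have ec0 : 0 < e / c by exact: divr_gt0.
  have [d d0 dP] := luxemburg_small gamma_gt0 hw ophi ec0.
  exists d => // A mA AK Ad.
  have XA := Lambda_test gamma_gt0 hw ophi (test_function_indic mA AK).
  have AI : A `<=` I by apply: subset_trans AK (@window_sub _ _ _).
  apply: le_trans (cP _ _ XA ec0 (dP A mA AI Ad)) _.
  by rewrite mulrC divfK// gt_eqF.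
have [h [mh hE]] := test_representation linF boundF smallF.
exists h; split => // [f e Xf e0 fe|g Eg]; last by case: (hE g Eg).
have mf := Xf.1.
have mfh : measurable_fun I (fun t => `|(f t * h t)%:E|%E).
  apply: measurableT_comp => //; apply/measurable_EFinP; apply: measurable_funM => //.
  exact: measurable_funS mh.
have cv : (\int[mu]_(t in core gamma f n) `|(f t * h t)%:E| @[n --> \oo] -->
    \int[mu]_(t in I) `|(f t * h t)%:E|)%E.
  rewrite -(bigcup_core gamma f); apply: ge0_nondecreasing_set_cvg_integral.
  - by move=> m n mn; apply/subsetPset; exact: le_core.
  - by move=> n; exact: measurable_core.
  - by move=> n; apply: measurable_funS mfh => //; exact: core_sub.
  - by [].
rewrite -(cvg_lim _ cv)//; apply: lime_le; first by apply/cvgP; exact: cv.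
near=> n; pose sg t : R := if 0 <= f t * h t then 1 else -1.
have msg : measurable_fun I sg.
  have mfhI : measurable_fun I (fun t => f t * h t).
    by apply: measurable_funM => //; exact: measurable_funS mh.
  apply: measurable_fun_if => //; first exact: measurable_fun_ler.
pose fs t := f t * sg t.
have fsf t : `|fs t| = `|f t|.
  by rewrite /fs /sg normrM; case: ifP => _; rewrite ?normrN normr1 mulr1.
have mfs : measurable_fun I fs by exact: measurable_funM.
have fs_le t : I t -> `|fs t| <= `|f t| by rewrite fsf.
have Eg := test_function_core n mfs mf fs_le.
have [_ gE] := hE _ Eg.
have gh t : (fs \_ (core gamma f n)) t * h t =
    if t \in core gamma f n then `|f t * h t| else 0.
  rewrite /patch; case: ifPn => _; last by rewrite mul0r.
  rewrite /fs /sg mulrAC; case: ifPn => [fh|]; first by rewrite mulr1 ger0_norm.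
  by rewrite -ltNge => fh; rewrite mulrN1 ltr0_norm.
have -> : (\int[mu]_(t in core gamma f n) `|(f t * h t)%:E| =
   \int[mu]_(t in I) ((fs \_ (core gamma f n)) t * h t)%:E)%E.
  rewrite -{1}(setIidr (@core_sub _ gamma f n)) integral_mkcondr.
  by apply: eq_integral => t _; rewrite gh /patch; case: ifPn.
have Xg := Lambda_test gamma_gt0 hw ophi Eg.
rewrite -gE lee_fin; apply: le_trans (ler_norm _) _; apply: (cP _ e Xg e0).
apply: le_trans fe; apply: (modular_le hw ophi).
- by apply: L0_div; exact: (@test_function_measurable _ _ I _ Eg).
- exact: L0_div.
- move=> t It; rewrite !normrM ler_wpM2r// /patch; case: ifPn => _; first by rewrite fsf.
  by rewrite normr0.
Unshelve. all: by end_near. Qed.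

End functional.

(** * The dual norm of a regular functional *)

Lemma ler_mulgt1P (R : realFieldType) (a b : R) : 0 <= b ->
  (forall e, 1 < e -> a <= e * b) -> a <= b.
Proof.
move=> b0 H; apply/ler_addgt0Pr => d d0; have b1 : 0 < b + 1 by rewrite ltr_wpDl.
have db : 0 < d / (b + 1) by exact: divr_gt0.
apply: le_trans (H (1 + d / (b + 1)) _) _; first by rewrite ltrDl.
rewrite mulrDl mul1r lerD2l mulrAC ler_pdivrMr// ler_pM2l// lerDl//.
Qed.

(** Chord slopes decrease across 1: [D] bounds the value at every convex combination with abscissa
    at most 1, and the weight [a] in the proof makes this abscissa exactly 1. *)
Lemma slope_le (R : realFieldType) (x y A B D : R) : x < 1 -> 1 < y ->
  (forall a, 0 < a -> a < 1 -> a * x + (1 - a) * y <= 1 -> a * A + (1 - a) * B <= D) ->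
  (B - D) / (y - 1) <= (D - A) / (1 - x).
Proof.
move=> x1 y1 H; rewrite ler_pdivrMr ?subr_gt0// mulrAC ler_pdivlMr ?subr_gt0//.
have d0 : 0 < y - x by lra.
pose a := (y - 1) / (y - x).
have aE : a * (y - x) = y - 1 by rewrite divfK// gt_eqF.
have a0 : 0 < a by apply: divr_gt0; lra.
have a1 : a < 1 by rewrite ltr_pdivrMr//; lra.
have {}H : a * A + (1 - a) * B <= D by apply: H => //; lra.
have := ler_wpM2r (ltW d0) H.
have -> : (a * A + (1 - a) * B) * (y - x) =
    (a * (y - x)) * A + ((y - x) - a * (y - x)) * B by ring.
by rewrite aE; lra.
Qed.

Section dual_norm.
Context (R : realType) (gamma : \bar R) (phi w : R -> R).
Local Notation mu := (@lebesgue_measure R).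
Local Notation I := (Iset gamma).
Local Notation E := (test_function gamma).
Local Notation rho := (modular gamma phi w).
Local Notation norm := (luxemburg_norm gamma phi w).
Local Notation X := (Lambda gamma phi w).
Local Notation psi := (complementary phi).
Hypothesis gamma_gt0 : (0 < gamma)%E.
Hypothesis hw : weight gamma w.
Hypothesis hphi : N_function phi.

Let ophi : orlicz_function phi. Proof. by case: hphi. Qed.
Let mI : measurable I := measurable_Iset gamma.

Lemma functional_bound_norm (G : (R -> R) -> R) c : 0 < c ->
  (forall f e, X f -> 0 < e -> (rho (fun t => f t / e)%R <= 1)%E -> `|G f| <= c * e) ->
  forall f, X f -> (`|G f|%:E <= c%:E * norm f)%E.
Proof.
move=> c0 cP f Xf; rewrite -lee_pdivrMl// -EFinM.
apply: le_ereal_inf_tmp => _ [e [e0 fe] <-].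
by rewrite lee_fin ler_pdivrMl//; exact: cP.
Qed.

Lemma dual_norm_ge (G : (R -> R) -> R) f : X f -> (norm f <= 1)%E ->
  (`|G f|%:E <= dual_norm gamma phi w G)%E.
Proof. by move=> Xf f1; apply: ereal_sup_ubound; exists f. Qed.

Lemma dual_norm_le (G : (R -> R) -> R) b :
  (forall f, X f -> (norm f <= 1)%E -> (`|G f|%:E <= b)%E) ->
  (dual_norm gamma phi w G <= b)%E.
Proof. by move=> H; apply: ge_ereal_sup => _ [f [Xf f1] <-]; exact: H. Qed.

Let X0 : X (fun=> 0).
Proof. apply: (Lambda_test gamma_gt0 hw ophi); exact: (subspace_test_function gamma).1. Qed.

Let norm0 : (norm (fun=> 0%R) <= 1)%E.
Proof.
have [k k0 kP] := luxemburg_test gamma_gt0 hw ophi 0.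
apply: luxemburg_le => //.
have := kP k^-1 (fun=> 0); rewrite mulfV ?gt_eqF// invr_gt0; apply => // t.
by rewrite normr0 mulr_ge0// invr_ge0 ltW.
Qed.

Lemma dual_norm_ge0 (G : (R -> R) -> R) : (0 <= dual_norm gamma phi w G)%E.
Proof. by apply: le_trans (dual_norm_ge G X0 norm0); rewrite lee_fin. Qed.

Lemma dual_norm_bound (G : (R -> R) -> R) c : 0 < c ->
  (forall f e, X f -> 0 < e -> (rho (fun t => f t / e)%R <= 1)%E -> `|G f| <= c * e) ->
  (dual_norm gamma phi w G <= c%:E)%E.
Proof.
move=> c0 cP; apply: dual_norm_le => f Xf f1.
apply: le_trans (functional_bound_norm c0 cP Xf) _.
by rewrite -[leRHS]mule1 lee_pmul2l ?lte_fin.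
Qed.

Variables (h : R -> R) (c : R).
Hypothesis mh : measurable_fun setT h.
Hypothesis c0 : 0 < c.
Hypothesis hc : forall f e, X f -> 0 < e -> (rho (fun t => f t / e)%R <= 1)%E ->
  (\int[mu]_(t in I) `|(f t * h t)%:E| <= (c * e)%:E)%E.

Definition pairing (f : R -> R) : R := fine (\int[mu]_(t in I) (f t * h t)%:E)%E.

Lemma measurable_pairing f : L0 gamma f -> measurable_fun I (fun t => (f t * h t)%:E).
Proof.
move=> mf; apply/measurable_EFinP; apply: measurable_funM => //.
exact: measurable_funS mh.
Qed.

Lemma integrable_pairing f : X f -> mu.-integrable I (fun t => (f t * h t)%:E).
Proof.
move=> Xf; have [e e0 fe] := Lambda_luxemburg gamma_gt0 hw ophi Xf.
apply/integrableP; split; first exact: measurable_pairing Xf.1.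
by apply: le_lt_trans (hc Xf e0 fe) _; exact: ltry.
Qed.

Lemma pairingE f : X f -> (pairing f)%:E = (\int[mu]_(t in I) (f t * h t)%:E)%E.
Proof.
move=> Xf; rewrite /pairing fineK//; apply: integrable_fin_num; [exact: mI|].
exact: integrable_pairing.
Qed.

Lemma abs_pairing_le f : X f ->
  (`|pairing f|%:E <= \int[mu]_(t in I) `|(f t * h t)%:E|)%E.
Proof.
move=> Xf; rewrite -abse_EFin (pairingE Xf).
by apply: le_abse_integral => //; exact: measurable_pairing Xf.1.
Qed.

Lemma pairing_bound f e : X f -> 0 < e -> (rho (fun t => f t / e)%R <= 1)%E ->
  `|pairing f| <= c * e.
Proof.
move=> Xf e0 fe; rewrite -lee_fin; apply: le_trans (abs_pairing_le Xf) _; exact: hc.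
Qed.

Lemma pairing_functional : bounded_linear_functional gamma phi w pairing.
Proof.
split.
- move=> f g Xf Xg fg; apply: EFin_inj; rewrite (pairingE Xf) (pairingE Xg).
  apply: ae_eq_integral; [exact: mI|exact: measurable_pairing Xf.1|exact: measurable_pairing Xg.1|].
  by apply: (@filterS _ _ (ae_filter_ringOfSetsType mu) _ _ _ fg) => t /= fgt It; rewrite fgt.
- move=> a f g Xf Xg; rewrite /pairing.
  have fi := integrable_pairing Xf; have gi := integrable_pairing Xg.
  have := pairingE Xf; have := pairingE Xg; rewrite /pairing.
  have -> : (\int[mu]_(t in I) ((a * f t + g t) * h t)%:E =
      a%:E * \int[mu]_(t in I) (f t * h t)%:E + \int[mu]_(t in I) (g t * h t)%:E)%E.
    rewrite -integralZl// -integralD//; last exact: integrableZl.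
    by apply: eq_integral => t _; rewrite -EFinM -EFinD mulrDl mulrA.
  by move=> <- <-; rewrite -EFinM -EFinD.
- by exists c => f Xf; apply: functional_bound_norm => //; exact: pairing_bound.
Qed.

Lemma dual_norm_pairing_le :
  (dual_norm gamma phi w pairing <= M0_norm gamma psi w h)%E.
Proof.
apply: dual_norm_le => f Xf f1; have mf := Xf.1.
apply: le_ereal_inf_tmp => _ [k k0 <-]; have k_gt0 : 0 < k := k0.
suff : ((k * `|pairing f| - 1)%:E <= P_modular gamma psi w (fun t => k * h t)%R)%E.
  case: (P_modular _ _ _ _) => [p| |//].
    by rewrite lee_fin => H; rewrite -EFinD -EFinM lee_fin ler_pdivlMl//; lra.
  by move=> _; rewrite addey// gt0_muley ?leey// lte_fin invr_gt0.
apply: le_ereal_inf_tmp => _ [v [mv v0 vw] <-].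
have mkh : measurable_fun I (fun t => k * h t).
  by apply: measurable_funM => //; exact: measurable_funS mh.
set P := (\int[mu]_(t in I) _)%E.
have P0 : (0 <= P)%E by apply: integral_ge0 => t It; apply: perspective_ge0 => //; exact: v0.
have [Pfin|] := boolP (P \is a fin_num); last first.
  by rewrite ge0_fin_numE// -leNgt leye_eq => /eqP ->; rewrite leey.
have pf : 0 <= fine P by exact: fine_ge0.
(* Norm at most 1 gives modular at most 1 after division by any [e > 1]. *)
have key e : 1 < e -> k * `|pairing f| <= e * (1 + fine P).
  move=> e1; have e0 : 0 < e by exact: lt_trans e1.
  have fe : (rho (fun t => f t / e)%R <= 1)%E.
    by apply: (luxemburg_lt hw ophi mf); apply: le_lt_trans f1 _; rewrite lte_fin.
  have mfe : L0 gamma (fun t => f t / e) by exact: L0_div.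
  rewrite -ler_pdivrMl// mulrA -lee_fin EFinM EFinD (fineK Pfin).
  have ke0 : 0 <= e^-1 * k by rewrite mulr_ge0 ?invr_ge0// ltW.
  have kefin : (0 <= (e^-1 * k)%:E)%E by rewrite lee_fin.
  apply: le_trans (lee_wpmul2l kefin (abs_pairing_le Xf)) _.
  have mphi := measurable_phi_norm ophi mfe.
  apply: (@le_trans _ _ (\int[mu]_(t in I) ((phi `|f t / e| * v t)%:E +
      perspective psi (k * h t) (v t)))%E).
    rewrite -ge0_integralZl_EFin//; last first.
      by apply: measurableT_comp => //; exact: measurable_pairing.
    apply: ge0_le_integralW => t It.
      by rewrite mule_ge0// lee_fin.
    have := young_perspective hphi (k * h t) (normr_ge0 (f t / e)) (v0 t It).
    rewrite EFinB leeBlDr// addeC; apply: le_trans.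
    rewrite abse_EFin -EFinM lee_fin !normrM (gtr0_norm k_gt0).
    rewrite (gtr0_norm (_ : 0 < e^-1)) ?invr_gt0//.
    by rewrite le_eqVlt; apply/orP; left; apply/eqP; ring.
  rewrite ge0_integralD//.
  - apply: leeD => //.
    exact: le_trans (integralM_le_modular gamma_gt0 hw ophi mv v0 vw mfe) fe.
  - by move=> t It; rewrite lee_fin mulr_ge0 ?v0// orlicz_ge0.
  - by apply/measurable_EFinP; exact: measurable_funM mphi mv.
  - by move=> t It; apply: perspective_ge0 => //; exact: v0.
  - by apply: measurable_perspective.
have := ler_mulgt1P _ key; rewrite addr_ge0// => /(_ isT) H.
by rewrite -(fineK Pfin) lee_fin; lra.
Qed.

Let D : R := fine (dual_norm gamma phi w pairing).

Let DE : D%:E = dual_norm gamma phi w pairing.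
Proof.
rewrite /D fineK// ge0_fin_numE; last exact: dual_norm_ge0.
by apply: le_lt_trans (dual_norm_bound c0 pairing_bound) _; exact: ltry.
Qed.

Let D0 : 0 <= D. Proof. by rewrite -lee_fin DE; exact: dual_norm_ge0. Qed.

Let A (f : R -> R) : R := fine (\int[mu]_(t in I) (f t * `|h t|)%:E)%E.
Let r (f : R -> R) : R := fine (rho f).

Let sg t : R := if 0 <= h t then 1 else -1.

Let measurable_sg : measurable_fun setT sg.
Proof. by apply: measurable_fun_ifT => //; exact: measurable_fun_ler. Qed.

Let norm_sg t : `|sg t| = 1.
Proof. by rewrite /sg; case: ifP => _; rewrite ?normrN normr1. Qed.

Let E_sg (f : R -> R) : E f -> E (fun t => f t * sg t).
Proof.
move=> [mf [n [M [M0 fM]]]]; apply: (@test_functionP _ _ _ n M).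
  exact: measurable_funM.
by move=> t; rewrite normrM norm_sg mulr1.
Qed.

Let sgE (f : R -> R) t : f t * sg t * h t = f t * `|h t|.
Proof.
rewrite /sg; have [h0|h0] := leP 0 (h t); first by rewrite ger0_norm// mulr1.
by rewrite ltr0_norm// mulrN1 mulrN mulNr.
Qed.

Let integrable_abs (f : R -> R) : E f -> mu.-integrable I (fun t => (f t * `|h t|)%:E).
Proof.
move=> Ef; have := integrable_pairing (Lambda_test gamma_gt0 hw ophi (E_sg Ef)).
by apply: eq_integrable => // t _; rewrite sgE.
Qed.

Let AE (f : R -> R) : E f -> (A f)%:E = (\int[mu]_(t in I) (f t * `|h t|)%:E)%E.
Proof.
move=> Ef; rewrite /A fineK//; apply: integrable_fin_num; [exact: mI|].
exact: integrable_abs.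
Qed.

Let A_lin a b (f g : R -> R) : E f -> E g ->
  A (fun t => a * f t + b * g t) = a * A f + b * A g.
Proof.
move=> Ef Eg; have fi := integrable_abs Ef; have gi := integrable_abs Eg.
have := AE Ef; have := AE Eg; rewrite /A.
have -> : (\int[mu]_(t in I) ((a * f t + b * g t) * `|h t|)%:E =
    a%:E * \int[mu]_(t in I) (f t * `|h t|)%:E + b%:E * \int[mu]_(t in I) (g t * `|h t|)%:E)%E.
  rewrite -integralZl// -integralZl// -integralD//; [|exact: integrableZl|exact: integrableZl].
  by apply: eq_integral => t _; rewrite -!EFinM -EFinD mulrDl !mulrA.
by move=> <- <-; rewrite -!EFinM -EFinD.
Qed.

Let mE (f : R -> R) : E f -> L0 gamma f.
Proof. by move=> Ef; exact: (@test_function_measurable _ _ I _ Ef). Qed.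

Let rE (f : R -> R) : E f -> (forall t, 0 <= f t) -> (r f)%:E = rho f.
Proof.
move=> Ef f0; rewrite /r fineK// ge0_fin_numE; last by apply: (modular_ge0 hw ophi); exact: mE.
rewrite (modularE hw ophi (mE Ef)).
apply: (choquet_test_lty gamma_gt0 hw); have Ephi := test_function_orlicz ophi Ef f0.
rewrite (_ : (fun t => phi `|f t|) = (fun t => phi (f t)))//.
by apply/funext => t; rewrite ger0_norm.
Qed.

Let r_ge0 f : E f -> 0 <= r f.
Proof. by move=> Ef; apply: fine_ge0; apply: (modular_ge0 hw ophi); exact: mE. Qed.

Let A_le_D (f : R -> R) : E f -> (forall t, 0 <= f t) -> r f <= 1 -> A f <= D.
Proof.
move=> Ef f0 r1; have Es := E_sg Ef; have Xs := Lambda_test gamma_gt0 hw ophi Es.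
have n1 : (norm (fun t => f t * sg t)%R <= 1)%E.
  apply: luxemburg_le => //; apply: (@le_trans _ _ (rho f)); last by rewrite -(rE Ef f0) lee_fin.
  apply: (modular_le hw ophi); [exact: L0_div (mE Es)|exact: mE|].
  by move=> t _; rewrite divr1 normrM norm_sg mulr1.
have := dual_norm_ge pairing Xs n1; rewrite -DE lee_fin; apply: le_trans.
rewrite /pairing (_ : (\int[mu]_(t in I) _)%E = (A f)%:E); first exact: ler_norm.
by rewrite AE//; apply: eq_integral => t _; rewrite sgE.
Qed.

Let E_scale a (f : R -> R) : E f -> E (fun t => a * f t).
Proof. by move=> Ef; exact: (subspaceZ (subspace_test_function gamma) a Ef). Qed.

(** By convexity, [f] divided by [r f] has modular at most 1. This is what bounds the slopes in
    [multiplier] by [D]. *)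
Let A_le_rD (f : R -> R) : E f -> (forall t, 0 <= f t) -> 1 <= r f -> A f <= r f * D.
Proof.
move=> Ef f0 r1; have r0 : 0 < r f by exact: lt_le_trans r1.
have ri0 : 0 < (r f)^-1 by rewrite invr_gt0.
have fr0 t : 0 <= (r f)^-1 * f t by rewrite mulr_ge0// ltW.
have := A_le_D (E_scale (r f)^-1 Ef) fr0.
have -> : A (fun t => (r f)^-1 * f t) = (r f)^-1 * A f.
  have := A_lin (r f)^-1 0 Ef Ef; rewrite mul0r addr0 => <-.
  by congr A; apply/funext => t; rewrite mul0r addr0.
rewrite ler_pdivrMl//; apply; rewrite -lee_fin (rE (E_scale _ Ef) fr0).
apply: le_trans (modular_scale gamma_gt0 hw ophi (mE Ef) ri0 _) _; first by rewrite invf_le1.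
by rewrite -(rE Ef f0) -EFinM mulVf// gt_eqF.
Qed.

Let r_convex a (f g : R -> R) : 0 < a -> a < 1 -> E f -> E g ->
  (forall t, 0 <= f t) -> (forall t, 0 <= g t) ->
  [/\ E (fun t => a * f t + (1 - a) * g t), forall t, 0 <= a * f t + (1 - a) * g t &
  r (fun t => a * f t + (1 - a) * g t) <= a * r f + (1 - a) * r g].
Proof.
move=> a0 a1 Ef Eg f0 g0; have b0 : 0 < 1 - a by rewrite subr_gt0.
have Eu : E (fun t => a * f t + (1 - a) * g t).
  exact: ((subspace_test_function gamma).2 a f _ Ef (E_scale (1 - a) Eg)).
have u0 t : 0 <= a * f t + (1 - a) * g t by rewrite addr_ge0// mulr_ge0// ltW.
split; [exact: Eu|exact: u0|].
suff : (rho (fun t => a * f t + (1 - a) * g t)%R <= a%:E * rho f + (1 - a)%:E * rho g)%E.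
  have := rE Eu u0; have := rE Ef f0; have := rE Eg g0.
  by move=> <- <- <-; rewrite -[X in (_ <= X)%E]/((a * r f + (1 - a) * r g)%:E) lee_fin.
have mf := measurable_phi_norm ophi (mE Ef); have mg := measurable_phi_norm ophi (mE Eg).
rewrite (modularE hw ophi (mE Eu)) (modularE hw ophi (mE Ef)) (modularE hw ophi (mE Eg)).
rewrite -(choquetZ gamma_gt0 hw a0 mf) -(choquetZ gamma_gt0 hw b0 mg).
apply: (choquet_subadd gamma_gt0 hw).
- exact: (measurable_phi_norm ophi (mE Eu)).
- exact: measurable_funM.
- exact: measurable_funM.
- by move=> t _; rewrite !ger0_norm//; apply: orlicz_convex => //; exact: ltW.
Qed.

(* Lagrange multiplier: the slopes of the concave function
   s |-> sup {A f | r f <= s} beyond s = 1 are bounded by D, and their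
   supremum is a supergradient at 1. *)
Let multiplier : exists2 m, 0 <= m & forall f : R -> R, E f -> (forall t, 0 <= f t) ->
  A f <= D + m * (r f - 1).
Proof.
(* The element 0 makes [T] nonempty and the multiplier nonnegative. *)
pose T := [set s | s = 0 \/ exists f : R -> R, [/\ E f, forall t, 0 <= f t, 1 < r f &
                                                  s = (A f - D) / (r f - 1)]].
have ubT : ubound T D.
  move=> _ [->//|[f [Ef f0 r1 ->]]]; rewrite ler_pdivrMr ?subr_gt0//.
  by have := A_le_rD Ef f0 (ltW r1); rewrite mulrBr mulr1 mulrC; lra.
have T0 : T 0 by left.
have supT : has_sup T by split; [exists 0|exists D].
have m0 : 0 <= sup T by exact: ub_le_sup supT.2 _ T0.
exists (sup T) => // f Ef f0.
have [r1|r1] := ltP 1 (r f).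
  suff : (A f - D) / (r f - 1) <= sup T by rewrite ler_pdivrMr ?subr_gt0//; lra.
  by apply: ub_le_sup supT.2 _ _; right; exists f.
move: (r1); rewrite le_eqVlt => /predU1P[rE1|r_lt1].
  by rewrite rE1 subrr mulr0 addr0; exact: A_le_D.
have AD := A_le_D Ef f0 r1.
suff : sup T <= (D - A f) / (1 - r f) by rewrite ler_pdivlMr ?subr_gt0//; lra.
apply: ge_sup; first by exists 0.
move=> _ [->|[g [Eg g0 rg ->]]]; first by apply: divr_ge0; lra.
apply: (slope_le r_lt1 rg) => a a0 a1 ar.
have [Eu u0 ru] := r_convex a0 a1 Ef Eg f0 g0.
by rewrite -(A_lin _ _ Ef Eg); apply: (A_le_D Eu u0); exact: le_trans ru ar.
Qed.

Lemma M0_norm_le_dual_norm :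
  (M0_norm gamma psi w h <= dual_norm gamma phi w pairing)%E.
Proof.
have [m m0 mP] := multiplier.
rewrite -DE; apply/lee_addgt0Pr => e e0; rewrite -EFinD.
have me0 : 0 < m + e by rewrite ltr_wpDl.
(* The multiplier [m] may be 0. Adding [e] makes it invertible and, as [r f >= 0], raises the bound
   by at most [e]. *)
pose k := (m + e)^-1; have k0 : 0 < k by rewrite invr_gt0.
have mkh : measurable_fun setT (fun t => k * h t) by exact: measurable_funM.
have absE (f : R -> R) t : f t * `|k * h t| = (k * f t) * `|h t|.
  by rewrite normrM gtr0_norm// mulrCA mulrA.
have P_le : (P_modular gamma psi w (fun t => k * h t)%R <= (k * (D + e) - 1)%:E)%E.
  apply: (P_modular_le gamma_gt0 hw hphi mkh) => [f Ef|f Ef f0].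
    have := integrable_abs (E_scale k Ef).
    by apply: eq_integrable => // t _; rewrite absE.
  have -> : (\int[mu]_(t in I) (f t * `|k * h t|)%:E = (k * A f)%:E)%E.
    have <- : A (fun t => k * f t) = k * A f.
      have := A_lin k 0 Ef Ef; rewrite mul0r addr0 => <-.
      by congr A; apply/funext => t; rewrite mul0r addr0.
    by rewrite (AE (E_scale k Ef)); apply: eq_integral => t _; rewrite absE.
  have -> : choquet gamma w (fun t => phi (f t)) = (r f)%:E.
    rewrite (rE Ef f0) (modularE hw ophi (mE Ef)).
    by congr (choquet _ _ _); apply/funext => t; rewrite ger0_norm.
  rewrite -EFinD lee_fin.
  have h1 := mP f Ef f0; have h2 := r_ge0 Ef.
  have h3 : A f <= D + e + (m + e) * (r f - 1).
    by rewrite mulrDl; have := mulr_ge0 (ltW e0) h2; rewrite mulrBr; lra.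
  have := ler_wpM2l (ltW k0) h3.
  rewrite [k * (_ + (m + e) * _)]mulrDr mulrA mulVf ?gt_eqF// mul1r; lra.
apply: (@le_trans _ _ (k^-1%:E * (1 + P_modular gamma psi w (fun t => (k * h t)%R)))%E).
  by apply: ereal_inf_lbound; exists k.
apply: (@le_trans _ _ (k^-1%:E * (1 + (k * (D + e) - 1)%:E))%E).
  by rewrite lee_pmul2l ?lte_fin ?invr_gt0//; exact: leeD2l.
by rewrite -EFinD -EFinM lee_fin addrC subrK mulKf// gt_eqF.
Qed.

Lemma dual_norm_pairing : dual_norm gamma phi w pairing = M0_norm gamma psi w h.
Proof.
by apply/eqP; rewrite eq_le dual_norm_pairing_le M0_norm_le_dual_norm.
Qed.

Lemma M0_pairing : M0 gamma psi w h.
Proof.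
split; first exact: measurable_funS mh.
have : (M0_norm gamma psi w h < +oo)%E by rewrite -dual_norm_pairing -DE ltry.
move=> /ereal_inf_lt[_ [k k0 <-] fin]; exists k => //.
move: fin; case: (P_modular _ _ _ _) => [p _|/=|_]; [exact: ltry| |by []].
by rewrite addey// gt0_muley// lte_fin invr_gt0.
Qed.

End dual_norm.

(** * Homogeneity, and vanishing on the order-continuous part *)

Section functional_scale.
Context (R : realType) (gamma : \bar R) (phi w : R -> R) (G : (R -> R) -> R).
Local Notation I := (Iset gamma).
Local Notation E := (test_function gamma).
Local Notation rho := (modular gamma phi w).
Local Notation norm := (luxemburg_norm gamma phi w).
Local Notation X := (Lambda gamma phi w).
Hypothesis gamma_gt0 : (0 < gamma)%E.
Hypothesis hw : weight gamma w.
Hypothesis hphi : N_function phi.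
Hypothesis hG : bounded_linear_functional gamma phi w G.

Let ophi : orlicz_function phi. Proof. by case: hphi. Qed.

Lemma Lambda0 : X (fun=> 0).
Proof. apply: (Lambda_test gamma_gt0 hw ophi); exact: (subspace_test_function gamma).1. Qed.

Lemma LambdaZ a f : X f -> X (fun t => a * f t).
Proof.
move=> [mf [l l0 lf]]; split; first exact: L0_scale.
have a1 : 0 < `|a| + 1 by rewrite ltr_wpDl.
exists (l / (`|a| + 1)); first exact: divr_gt0.
apply: le_lt_trans lf; apply: (modular_le hw ophi).
- by apply: L0_scale; exact: L0_scale.
- exact: L0_scale.
move=> t _; rewrite -mulrA normrM [in leRHS]normrM ler_wpM2l// mulrA normrM.
rewrite -[leRHS]mul1r ler_wpM2r// normrM normfV (gtr0_norm a1).
by rewrite ler_pdivrMl// mulr1 lerDl.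
Qed.

Lemma functional0 : G (fun=> 0) = 0.
Proof.
have := functional_lin hG (-1) Lambda0 Lambda0.
rewrite (_ : (fun t => _) = fun=> 0); last by apply/funext => t; rewrite mulr0 addr0.
by rewrite mulN1r addNr.
Qed.

Lemma functionalZ a f : X f -> G (fun t => a * f t) = a * G f.
Proof.
move=> Xf; have := functional_lin hG a Xf Lambda0; rewrite functional0 addr0 => <-.
by congr G; apply/funext => t; rewrite addr0.
Qed.

Lemma fin_dual_norm : dual_norm gamma phi w G \is a fin_num.
Proof.
rewrite ge0_fin_numE; last exact: dual_norm_ge0.
have [c c0 cP] := functional_bound hG.
by apply: le_lt_trans (dual_norm_bound c0 cP) _; exact: ltry.
Qed.

Lemma functional_le_dual_norm u k : X u -> 0 < k ->
  (rho (fun t => u t / k)%R <= 1)%E -> G u <= k * fine (dual_norm gamma phi w G).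
Proof.
move=> Xu k0 uk.
have uE : u = (fun t => k * (k^-1 * u t)).
  by apply/funext => t; rewrite mulrA mulfV ?mul1r// gt_eqF.
have Xk := LambdaZ k^-1 Xu.
rewrite [in leLHS]uE (functionalZ k Xk); apply: ler_wpM2l; first exact: ltW.
apply: le_trans (ler_norm _) _; rewrite -lee_fin (fineK fin_dual_norm).
apply: (dual_norm_ge _ Xk); apply: (luxemburg_le ltr01).
have -> : (fun t => k^-1 * u t / 1) = (fun t => u t / k).
  by apply/funext => t; rewrite divr1 mulrC.
exact: uk.
Qed.

(* Truncation to the cores makes [f] a limit of test functions when its norm
   is order continuous. *)
Lemma singular_order_continuous : (forall g, E g -> G g = 0) ->
  forall f, Lambda_oc gamma phi w f -> G f = 0.
Proof.
move=> G0 f [Xf hf]; have mf := Xf.1; have mI := measurable_Iset gamma.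
have mcore n : measurable (core gamma f n) by exact: measurable_core.
pose r n := f \_ (I `\` core gamma f n).
have split_f n := functional_split hw ophi hG Xf (mcore n) (@core_sub _ gamma f n).
have Xr n : X (r n) by have [] := split_f n.
have fr n : G f = G (r n).
  have [_ _ ->] := split_f n.
  by rewrite G0 ?add0r//; exact: test_function_core.
have r_core n t : t \in core gamma f n -> r n t = 0.
  by move=> tA; rewrite /r /patch in_setD tA andbF.
have r_out n t : I t -> t \notin core gamma f n -> r n t = f t.
  by move=> It tA; rewrite /r /patch in_setD (mem_set It) tA.
have [||_ cv] := hf (fun n t => `|r n t|).
- by move=> n; apply: measurableT_comp => //; exact: (Xr n).1.
- apply: aeW => t It; split => [n|m n mn|].
  + by rewrite normr_ge0/= /r /patch; case: ifP => //; rewrite normr0.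
  + have [tA|tA] := boolP (t \in core gamma f n); first by rewrite r_core// normr0.
    rewrite !r_out//; apply: contra tA => /set_mem tm; apply/mem_set; exact: le_core tm.
  + have := It; rewrite -(bigcup_core gamma f) => -[N _ tN].
    apply: cvg_near_cst; exists N => // n /= Nn.
    by rewrite r_core ?normr0//; apply/mem_set; exact: le_core tN.
have [c c0 cP] := functional_bound hG.
apply/eqP; rewrite -normr_le0; apply/ler_addgt0Pr => e e0; rewrite add0r.
have [N _ NP] : \forall n \near \oo, (norm (fun t => `|r n t|)%R < (e / c)%:E)%E.
  apply: (cv [set y | (y < (e / c)%:E)%E]).
  apply: open_nbhs_nbhs; split; first exact: open_ereal_lt_ereal.
  by rewrite /= lte_fin divr_gt0.
have ec0 : 0 < e / c by exact: divr_gt0.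
have mr : L0 gamma (fun t => `|r N t|) by apply: measurableT_comp => //; exact: (Xr N).1.
rewrite (fr N); apply: le_trans (cP _ _ (Xr N) ec0 _) _.
  apply: le_trans (luxemburg_lt hw ophi mr (NP N (leqnn N))).
  apply: (modular_le hw ophi); [exact: L0_div (Xr N).1|exact: L0_div|].
  by move=> t _; rewrite !normrM normr_id.
by rewrite mulrC divfK// gt_eqF.
Qed.

End functional_scale.

(** * Additivity of the dual norm *)

Section norm_sum.
Context (R : realType) (gamma : \bar R) (phi w h : R -> R) (F S : (R -> R) -> R).
Local Notation mu := (@lebesgue_measure R).
Local Notation I := (Iset gamma).
Local Notation E := (test_function gamma).
Local Notation rho := (modular gamma phi w).
Local Notation norm := (luxemburg_norm gamma phi w).
Local Notation X := (Lambda gamma phi w).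
Local Notation H := (pairing gamma h).
Hypothesis gamma_gt0 : (0 < gamma)%E.
Hypothesis hw : weight gamma w.
Hypothesis hphi : N_function phi.
Hypothesis mh : measurable_fun setT h.
Hypothesis hF : bounded_linear_functional gamma phi w F.
Hypothesis hH : bounded_linear_functional gamma phi w H.
Hypothesis hS : bounded_linear_functional gamma phi w S.
Hypothesis H_int : forall f, X f -> mu.-integrable I (fun t => (f t * h t)%:E).
Hypothesis FHS : forall f, X f -> F f = H f + S f.
Hypothesis S0 : forall g, E g -> S g = 0.

Let ophi : orlicz_function phi. Proof. by case: hphi. Qed.
Let mI : measurable I := measurable_Iset gamma.
Let dF : R := fine (dual_norm gamma phi w F).

Let dF0 : 0 <= dF.
Proof. by apply: fine_ge0; exact: dual_norm_ge0. Qed.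

(* [splice f g n] is [f] on the n-th core of [|f| + |g|] and [g] elsewhere:
   [S] only sees [g] there while [H] sees [f] in the limit. *)
Let splice (f g : R -> R) n : R -> R :=
  fun t => 1 * ((fun t => f t - g t) \_ (core gamma (fun t => `|f t| + `|g t|) n)) t + g t.

Let spliceE f g n t :
  splice f g n t = if t \in core gamma (fun t => `|f t| + `|g t|) n then f t else g t.
Proof. by rewrite /splice mul1r /patch; case: ifP; rewrite ?add0r// subrK. Qed.

(** The norm of the tail of [g] need not become small, only its modular does. So the splice is
    controlled by subadditivity of the modular, which gives [1 + d], and not by the triangle
    inequality. *)
Let sum_unit (f g : R -> R) : X f -> X g -> (rho f <= 1)%E -> (rho g <= 1)%E ->
  H f + S g <= dF.
Proof.
move=> Xf Xg f1 g1; have mf := Xf.1; have mg := Xg.1.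
pose u t := `|f t| + `|g t|.
have m_u : measurable_fun I u by apply: measurable_funD; exact: measurableT_comp.
pose A n := core gamma u n.
have mA n : measurable (A n) by exact: measurable_core.
have Ed n : E ((fun t => f t - g t) \_ (A n)).
  apply: test_function_core => //; first exact: measurable_funB.
  by move=> t _; rewrite [in leRHS]ger0_norm ?addr_ge0//; exact: ler_normB.
have msp n : L0 gamma (splice f g n).
  apply: measurable_funD => //; apply: measurable_funM => //.
  exact: (@test_function_measurable _ _ I _ (Ed n)).
have SE n : S (splice f g n) = S g.
  rewrite (functional_lin hS 1 (Lambda_test gamma_gt0 hw ophi (Ed n)) Xg).
  by rewrite (S0 (Ed n)) mulr0 add0r.
pose gB n := g \_ (I `\` A n).
have mgB n : L0 gamma (gB n).
  apply/(measurable_restrict g (measurableD mI (mA n)) mI).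
  exact: (measurable_funS mI (@subIsetl _ _ _) mg).
have rho_splice n : (rho (splice f g n) <= rho f + rho (gB n))%E.
  apply: (modular_subadd gamma_gt0 hw ophi); [exact: msp|exact: mf|exact: mgB|].
  move=> t It; rewrite spliceE -/(A n) /gB /patch in_setD (mem_set It)/=.
  by case: (t \in A n) => /=; rewrite ?lerDl ?lerDr; exact: orlicz_ge0.
have tail d : 0 < d -> \forall n \near \oo, (rho (gB n) <= d%:E)%E.
  move=> d0; have mphi := measurable_phi_norm ophi mg.
  have gfin : (choquet gamma w (fun t => phi `|g t|%R) < +oo)%E.
    by rewrite -(modularE hw ophi mg); apply: le_lt_trans g1 _; exact: ltry.
  have phi0 t : I t -> 0 <= phi `|g t| by move=> _; exact: orlicz_ge0.
  have AI : I `<=` \bigcup_n A n by rewrite bigcup_core.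
  have [N NP] := choquet_tail_cvg0 gamma_gt0 hw mphi phi0 gfin mA (@le_core _ gamma u) AI d0.
  exists N => // n /= Nn; apply: le_trans NP.
  rewrite (_ : (_ \_ _) = (fun t => phi `|gB N t|)).
    rewrite -(modularE hw ophi (mgB N)); apply: (modular_le hw ophi (mgB n) (mgB N)) => t It.
    rewrite /gB /patch !in_setD (mem_set It)/=.
    case: ifPn => [tn|_]; last by rewrite normr0.
    by rewrite ifT//; apply: contra tn => /set_mem tN; apply/mem_set; exact: le_core tN.
  by apply/funext => t; rewrite /gB /patch; case: ifP => //; rewrite normr0 orlicz0.
have cvH : H (splice f g n) @[n --> \oo] --> H f.
  apply: fine_cvg; rewrite [X in _ --> X](_ : _ = \int[mu]_(t in I) (f t * h t)%:E)%E; last first.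
    by rewrite /pairing fineK//; apply: integrable_fin_num; [exact: mI|exact: H_int].
  have mhI : measurable_fun I h by exact: measurable_funS mh.
  have [] // := @dominated_convergence _ _ _ mu I mI
    (fun n t => (splice f g n t * h t)%:E) (fun t => (f t * h t)%:E)
    (fun t => `|(f t * h t)%:E| + `|(g t * h t)%:E|)%E.
  - by move=> n; apply/measurable_EFinP; exact: measurable_funM (msp n) mhI.
  - by apply/measurable_EFinP; exact: measurable_funM mf mhI.
  - apply: aeW => t It; have := It; rewrite -(bigcup_core gamma u) => -[N _ tN].
    apply: cvg_near_cst; exists N => // n /= Nn.
    by rewrite spliceE mem_set//; exact: le_core tN.
  - by apply: integrableD => //; apply: integrable_abse; exact: H_int.
  - by apply: aeW => t n It; rewrite spliceE; case: ifP => _; rewrite ?leeDl ?leeDr.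
(* The error [d] from [H] and the error [d * dF] from the modular bound [1 + d] add up to [e]. *)
apply/ler_addgt0Pr => e e0; pose d := e / (1 + dF).
have D1 : 0 < 1 + dF by rewrite ltr_pwDl.
have d0 : 0 < d by exact: divr_gt0.
have [N _ NP] := tail _ d0.
have [M _ MP] : \forall n \near \oo, `|H f - H (splice f g n)| <= d.
  by have /cvgrPdist_le := cvH; apply.
set n := maxn N M; have d1 : 0 < 1 + d by rewrite ltr_pwDl// ltW.
have rs : (rho (splice f g n) <= (1 + d)%:E)%E.
  apply: le_trans (rho_splice n) _; rewrite EFinD; apply: (leeD f1); apply: NP.
  exact: leq_maxl.
have Xs : X (splice f g n).
  split; first exact: msp.
  exists 1 => //; rewrite (_ : (fun t => _) = splice f g n).
    by apply: le_lt_trans rs _; exact: ltry.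
  by apply/funext => t; rewrite mul1r.
have r1 : (rho (fun t => splice f g n t / (1 + d))%R <= 1)%E.
  rewrite (_ : (fun t => _) = (fun t => (1 + d)^-1 * splice f g n t)); last first.
    by apply/funext => t; rewrite mulrC.
  have di0 : 0 < (1 + d)^-1 by rewrite invr_gt0.
  have di1 : (1 + d)^-1 <= 1 by rewrite invf_le1// lerDl ltW.
  apply: le_trans (modular_scale gamma_gt0 hw ophi (msp n) di0 di1) _.
  by rewrite lee_pdivrMl// mule1.
have := functional_le_dual_norm gamma_gt0 hw hphi hF Xs d1 r1.
rewrite (FHS Xs) SE -/dF => Fs.
have := MP n (leq_maxr N M); rewrite ler_norml => /andP[_ Hs].
have -> : e = d * (1 + dF) by rewrite divfK// gt_eqF.
lra.
Qed.

Lemma sum_functional_le (f g : R -> R) : X f -> X g -> (norm f <= 1)%E -> (norm g <= 1)%E ->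
  `|H f| + `|S g| <= dF.
Proof.
have sg (x : R) : exists2 s, `|s| = 1 & `|x| = s * x.
  have [x0|x0] := leP 0 x; first by exists 1; rewrite ?normr1 ?mul1r ?ger0_norm.
  by exists (-1); rewrite ?normrN1 ?mulN1r ?ltr0_norm.
move=> Xf Xg f1 g1; apply: (ler_mulgt1P dF0) => e e1; have e0 : 0 < e by exact: lt_trans e1.
(* The sign [s] makes the value of the functional nonnegative, and the factor [1 / e] turns norm at
   most 1 into modular at most 1. *)
have unit k s : X k -> (norm k <= 1)%E -> `|s| = 1 -> (rho (fun t => e^-1 * s * k t)%R <= 1)%E.
  move=> Xk k1 s1; have mk := Xk.1.
  have ke : (norm k < e%:E)%E by apply: le_lt_trans k1 _; rewrite lte_fin.
  apply: le_trans (luxemburg_lt hw ophi mk ke).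
  apply: (modular_le hw ophi); [exact: L0_scale|exact: L0_div|].
  by move=> t _; rewrite !normrM s1 mulr1 mulrC.
have [s s1 ->] := sg (H f); have [r r1 ->] := sg (S g).
have := sum_unit (LambdaZ hw hphi (e^-1 * s) Xf) (LambdaZ hw hphi (e^-1 * r) Xg)
  (unit _ _ Xf f1 s1) (unit _ _ Xg g1 r1).
rewrite (functionalZ gamma_gt0 hw hphi hH _ Xf) (functionalZ gamma_gt0 hw hphi hS _ Xg).
by rewrite -!mulrA -mulrDr ler_pdivrMl.
Qed.

Theorem dual_norm_sum :
  dual_norm gamma phi w F = (dual_norm gamma phi w H + dual_norm gamma phi w S)%E.
Proof.
have FE := fin_dual_norm gamma_gt0 hw hphi hF.
have HE := fin_dual_norm gamma_gt0 hw hphi hH.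
have SE := fin_dual_norm gamma_gt0 hw hphi hS.
apply/eqP; rewrite eq_le; apply/andP; split.
  apply: dual_norm_le => f Xf f1; rewrite (FHS Xf).
  apply: (@le_trans _ _ (`|H f|%:E + `|S f|%:E)%E).
    by rewrite -EFinD lee_fin; exact: ler_normD.
  by apply: leeD; exact: dual_norm_ge.
(* The unit vectors for [H] and [S] are independent, so the two suprema are taken one after the
   other. *)
have step g : X g -> (norm g <= 1)%E ->
    (dual_norm gamma phi w H <= dual_norm gamma phi w F - `|S g|%:E)%E.
  move=> Xg g1; apply: dual_norm_le => f Xf f1.
  rewrite -(fineK FE) -EFinB lee_fin lerBrDr; exact: sum_functional_le.
rewrite addeC -leeBrDr//; apply: dual_norm_le => g Xg g1.
have := step g Xg g1; rewrite -(fineK FE) -(fineK HE) -!EFinB !lee_fin; lra.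
Qed.

End norm_sum.

Theorem theorem3p2 (R : realType) (gamma : \bar R) (phi w : R -> R)
    (F : (R -> R) -> R)
    (hgamma : (0 < gamma)%E)
    (hphi : N_function phi)
    (hw : weight gamma w)
    (hF : bounded_linear_functional gamma phi w F) :
  exists (H S : (R -> R) -> R) (h : R -> R),
    (forall f, Lambda gamma phi w f -> F f = H f + S f) /\
    M0 gamma (complementary phi) w h /\
    bounded_linear_functional gamma phi w H /\
    (forall f, Lambda gamma phi w f ->
       lebesgue_measure.-integrable (Iset gamma) (fun t => (f t * h t)%:E) /\
       (H f)%:E = (\int[lebesgue_measure]_(t in Iset gamma) (f t * h t)%:E)%E) /\
    dual_norm gamma phi w H = M0_norm gamma (complementary phi) w h /\
    bounded_linear_functional gamma phi w S /\
    (forall f, Lambda_oc gamma phi w f -> S f = 0) /\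
    dual_norm gamma phi w F
      = (M0_norm gamma (complementary phi) w h + dual_norm gamma phi w S)%E.
Proof.
have ophi : orlicz_function phi by case: hphi.
have [c c0 cP] := functional_bound hF.
have [h [mh hc FE]] := functional_density hgamma hw ophi hF c0 cP.
pose H := pairing gamma h; pose S f := F f - H f.
have H_int := integrable_pairing hgamma hw hphi mh hc.
have HE := pairingE hgamma hw hphi mh hc.
have hH : bounded_linear_functional gamma phi w H.
  exact (pairing_functional hgamma hw hphi mh c0 hc).
have hS : bounded_linear_functional gamma phi w S.
  split.
  - by move=> f g Xf Xg fg; case: hF hH => F1 _ _ [H1 _ _]; rewrite /S (F1 f g)// (H1 f g).
  - move=> a f g Xf Xg; rewrite /S (functional_lin hF a Xf Xg) (functional_lin hH a Xf Xg).
    by rewrite mulrBr opprD addrACA.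
  - exists (c + c) => f Xf; apply: functional_bound_norm => // [|k e Xk e0 ke].
      exact: addr_gt0.
    apply: le_trans (ler_normB _ _) _; rewrite mulrDl; apply: lerD; first exact: cP.
    exact: (pairing_bound hgamma hw hphi mh hc).
have FHS f : Lambda gamma phi w f -> F f = H f + S f by rewrite /S addrC subrK.
have S0 g : test_function gamma g -> S g = 0.
  move=> Eg; apply/eqP; rewrite subr_eq0; apply/eqP/EFin_inj.
  by rewrite (FE g Eg) (HE _ (Lambda_test hgamma hw ophi Eg)).
have normH := dual_norm_pairing hgamma hw hphi mh c0 hc.
exists H, S, h; split; first exact: FHS.
split; first exact: (M0_pairing hgamma hw hphi mh c0 hc).
split; first exact: hH.
split; first by move=> f Xf; split; [exact: H_int|exact: HE].
split; first exact: normH.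
split; first exact: hS.
split; first exact (singular_order_continuous hw hphi hS S0).
by rewrite -normH; exact (dual_norm_sum hgamma hw hphi mh hF hH hS H_int FHS S0).
Qed.
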